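(* Assume that $W$ and $r$ are independent and that $f$, $g$ and $\bar f_\eta$ satisfy conditions (GL), (LG), (GL') and (LG') listed in the context. Let $y(t)$, $t\in[0,T]$, be the unique strong solution of $$dy(t)=f(y(t),r(t))\,dt+g(y(t),r(t))\,dW(t),\qquad y(0)=y_0,\quad r(0)=i_0,$$ and let $Y(t)$, $t\in[0,T]$, be the continuous predictor-corrector Euler-Maruyama approximation with step size $\Delta$ and parameters $\theta,\eta\in[0,1]$ defined in the context. Then there is a positive constant $C$ independent of $\Delta$ such that $$E\Big(\sup_{0\le t\le T}|Y(t)-y(t)|^2\Big)\le C\Delta+o(\Delta)\qquad\text{as }\Delta\downarrow 0.$$
   Context: Setting. $(\Omega,\mathcal F,\{\mathcal F_t\}_{t\ge0},P)$ is a complete filtered probability space satisfying the usual conditions, $T>0$, $S=\{1,\dots,N\}$. $W$ is a one-dimensional standard $\mathcal F_t$-adapted Brownian motion, and $r$ is a continuous-time Markov chain with values in $S$ and generator $Q=(q_{ij})_{N\times N}$, i.e. as $\delta\downarrow0$, $P\{r(t+\delta)=j\mid r(t)=i\}=q_{ij}\delta+o(\delta)$ for $i\ne j$ and $=1+q_{ii}\delta+o(\delta)$ for $i=j$, with $-q_{ii}=\sum_{j\neq i}q_{ij}<\infty$. $W$ and $r$ are independent. The functions $f,g:\mathbb R\times S\to\mathbb R$ are Borel measurable, $g$ is differentiable in $x$, and $y_0\in\mathbb R$, $i_0\in S$ are deterministic. Fix $\theta,\eta\in[0,1]$ and define the corrected drift $$\bar f_\eta(x,i)=f(x,i)-\eta\,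 g(x,i)\frac{\partial g(x,i)}{\partial x}.$$ Conditions. There are constants $L_1,L_2,L_3,L_4>0$ such that for all $x,y\in\mathbb R$, $i\in S$: (GL) $|f(x,i)-f(y,i)|^2+|g(x,i)-g(y,i)|^2\le L_1|x-y|^2$; (LG) $|f(x,i)|^2\vee|g(x,i)|^2\le L_2(1+|x|^2)$; (GL') $|\bar f_\eta(x,i)-\bar f_\eta(y,i)|^2\le L_3|x-y|^2$; (LG') $|\bar f_\eta(x,i)|^2\le L_4(1+|x|^2)$. Scheme. Given a step size $\Delta>0$, let $t_0=0$, $t_k-t_{k-1}=\Delta$, and if $t_{n-1}<T\le t_n$ set $t_n=T$ (in the last step $\Delta$ is understood as the actual step length). Put $\Delta W_{t_k}=W(t_{k+1})-W(t_k)$, $r_{t_k}=r(t_k)$, $Y_{t_0}=y_0$, and recursively $$\widetilde Y_{t_{k+1}}=Y_{t_k}+f(Y_{t_k},r_{t_k})\Delta+g(Y_{t_k},r_{t_k})\Delta W_{t_k},$$ $$Y_{t_{k+1}}=Y_{t_k}+\{\theta\bar f_\eta(\widetilde Y_{t_{k+1}},r_{t_k})+(1-\theta)\bar f_\eta(Y_{t_k},r_{t_k})\}\Delta+\{\eta g(\widetilde Y_{t_{k+1}},r_{t_k})+(1-\eta)g(Y_{t_k},r_{t_k})\}\Delta W_{t_k}.$$ Equivalently $Y_{t_{k+1}}=Y_{t_k}+f(Y_{t_k},r_{t_k})\Delta+g(Y_{t_k},r_{t_k})\Delta W_{t_k}+\sum_{l=1}^4R_{l,k}$, where $R_{1,k}=\theta\{f(\widetilde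 Y_{t_{k+1}},r_{t_k})-f(Y_{t_k},r_{t_k})\}\Delta$, $R_{2,k}=-\theta\eta\{g(\widetilde Y_{t_{k+1}},r_{t_k})\frac{\partial g}{\partial x}(\widetilde Y_{t_{k+1}},r_{t_k})-g(Y_{t_k},r_{t_k})\frac{\partial g}{\partial x}(Y_{t_k},r_{t_k})\}\Delta$, $R_{3,k}=-\eta g(Y_{t_k},r_{t_k})\frac{\partial g}{\partial x}(Y_{t_k},r_{t_k})\Delta$, $R_{4,k}=\eta\{g(\widetilde Y_{t_{k+1}},r_{t_k})-g(Y_{t_k},r_{t_k})\}\Delta W_{t_k}$. Continuous approximation. For $t\in[t_k,t_{k+1})$ let $\bar Y(t)=Y_{t_k}$, $\bar r(t)=r_{t_k}$, $\bar R_l(t)=R_{l,k}/\Delta$ for $l=1,2,3$, and $\bar R_4(t)=R_{4,k}/\Delta W_{t_k}$, i.e. $\bar R_4(t)=\eta\{g(\widetilde Y_{t_{k+1}},r_{t_k})-g(Y_{t_k},r_{t_k})\}$. Then $$Y(t)=y_0+\int_0^tf(\bar Y(s),\bar r(s))ds+\int_0^tg(\bar Y(s),\bar r(s))dW(s)+\sum_{l=1}^3\int_0^t\bar R_l(s)ds+\int_0^t\bar R_4(s)dW(s),\quad t\in[0,T].$$ Since $\bar R_4$ is piecewise constant in time (its value on $[t_k,t_{k+1})$ depends on $\Delta W_{t_k}$), the last integral is understood pathwise as the sum of the values of $\bar R_4$ times the corresponding increments of $W$. One has $Y(t_k)=Y_{t_k}$ at the grid points. *)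

(* Defs.v *)
From HB Require Import structures.
From mathcomp Require Import all_boot all_order all_algebra.
From mathcomp Require Import all_classical all_reals all_analysis.
Import Order.TTheory GRing.Theory Num.Theory.
Import numFieldNormedType.Exports.

Set Implicit Arguments.
Unset Strict Implicit.
Unset Printing Implicit Defensive.

Local Open Scope classical_set_scope.
Local Open Scope ring_scope.

(* Processes are indexed by all of [R], but only nonnegative times (times in
   [[0, T]] for the solution and its approximation) are ever constrained.
   The state space [S = {1, ..., N}] is ['I_N]. *)

Section Stochastic.
Context {R : realType} {d : measure_display} {Om : measurableType d}.
Implicit Types (P : probability Om R) (F : R -> set (set Om))
  (W H I X : R -> Om -> R).

Record usual_filtration P F : Prop := {
  filt_complete : measure_is_complete P ;
  filt_sigma_algebra : forall t : R, 0 <= t -> sigma_algebra setT (F t) ;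
  filt_sub : forall t : R, 0 <= t -> F t `<=` measurable ;
  filt_mono : forall s t : R, 0 <= s -> s <= t -> F s `<=` F t ;
  filt_right_continuous : forall t : R, 0 <= t ->
    F t = \bigcap_(s in `]t, +oo[) F s ;
  filt_null : forall A, P.-negligible A -> F 0 A }.

Definition sub_measurable (G : set (set Om)) (Z : Om -> R) : Prop :=
  forall B : set R, measurable B -> G (Z @^-1` B).

Record brownian_motion P F W : Prop := {
  bm_adapted : forall t : R, 0 <= t -> sub_measurable (F t) (W t) ;
  bm_init : {ae P, forall w, W 0 w = 0} ;
  bm_continuous :
    {ae P, forall w, {within `[0, +oo[, continuous (fun t => W t w)}} ;
  bm_gaussian : forall s t : R, 0 <= s -> s < t -> forall B : set R,
    measurable B ->
    P [set w | B (W t w - W s w)] = normal_prob 0 (Num.sqrt (t - s)) B ;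
  bm_independent : forall s t : R, 0 <= s -> s <= t ->
    forall (A : set Om) (B : set R), F s A -> measurable B ->
    P (A `&` [set w | B (W t w - W s w)]) =
      (P A * P [set w | B (W t w - W s w)%R])%E }.

(* [p u i j] is the transition probability from [i] to [j] in time [u].  The
   Markov property is expressed on finite-dimensional cylinders, multiplied out
   so that no conditioning on a null event occurs; the values of [p] at a state
   that is never visited are immaterial. *)
Record markov_chain P F (N : nat) (Q : 'M[R]_N) (r : R -> Om -> 'I_N)
    : Prop := {
  mc_adapted : forall (t : R) (i : 'I_N), 0 <= t -> F t [set w | r t w = i] ;
  mc_right_continuous : {ae P, forall w, forall t : R, 0 <= t ->
    \forall s \near t^'+, r s w = r t w} ;
  mc_rate_ge0 : forall i j, i != j -> 0 <= Q i j ;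
  mc_rate_sum : forall i, - Q i i = \sum_(j | j != i) Q i j ;
  mc_transition : exists p : R -> 'I_N -> 'I_N -> R,
    (forall i j,
       (p u i j - ((i == j)%:R + Q i j * u)) / u @[u --> 0^'+] --> 0) /\
    (forall (n : nat) (s : nat -> R) (a : nat -> 'I_N) (u : R) (j : 'I_N),
       0 <= s 0%N -> (forall k, (k < n)%N -> s k < s k.+1) -> 0 <= u ->
       P [set w | (forall k, (k <= n)%N -> r (s k) w = a k) /\
                  r (s n + u) w = j] =
       (P [set w | forall k, (k <= n)%N -> r (s k) w = a k] *
        (p u (a n) j)%:E)%E) }.

Definition process_sigma_algebra {V : Type} (mV : set (set V))
    (X : R -> Om -> V) : set (set Om) :=
  <<s [set A | exists (t : R) (B : set V), [/\ 0 <= t, mV B & A = X t @^-1` B]] >>.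

Definition independent_processes P (V1 V2 : Type)
    (m1 : set (set V1)) (m2 : set (set V2))
    (X1 : R -> Om -> V1) (X2 : R -> Om -> V2) : Prop :=
  forall A B, process_sigma_algebra m1 X1 A -> process_sigma_algebra m2 X2 B ->
    P (A `&` B) = (P A * P B)%E.

(* The integral over [[0, t]] against the path [x] of the step function equal
   to [v k] on [[tau k, tau k.+1[], for [k < n]. *)
Definition step_integral (n : nat) (tau v : nat -> R) (x : R -> R) (t : R) : R :=
  \sum_(k < n) v k * (x (Num.min t (tau k.+1)) - x (Num.min t (tau k))).

Record simple_process := SimpleProcess {
  sp_size : nat ;
  sp_time : nat -> R ;
  sp_coef : nat -> Om -> R }.

Record is_simple F (T : R) (h : simple_process) : Prop := {
  sp_time_first : sp_time h 0 = 0 ;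
  sp_time_last : sp_time h (sp_size h) = T ;
  sp_time_mono : forall k, (k < sp_size h)%N -> sp_time h k <= sp_time h k.+1 ;
  sp_adapted : forall k, (k < sp_size h)%N ->
    sub_measurable (F (sp_time h k)) (sp_coef h k) ;
  sp_bounded : exists M, forall k w, (k < sp_size h)%N -> `|sp_coef h k w| <= M }.

Definition simple_value (h : simple_process) (t : R) (w : Om) : R :=
  \sum_(k < sp_size h)
    sp_coef h k w * \1_(`[sp_time h k, sp_time h k.+1[%classic) t.

Definition simple_integral W (h : simple_process) (t : R) (w : Om) : R :=
  step_integral (sp_size h) (sp_time h) (fun k => sp_coef h k w)
    (fun s => W s w) t.

Definition cvg_in_probability P (Z : nat -> Om -> \bar R) : Prop :=
  forall e : R, 0 < e -> (fun n => P [set w | (e%:E < Z n w)%E]) @ \oo --> 0%E.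

(* Measurable adapted processes [H] with [\int_0^T |H|^q dt < oo] a.s. *)
Record class_L P F (T : R) (q : nat) H : Prop := {
  cl_adapted : forall t : R, 0 <= t <= T -> sub_measurable (F t) (H t) ;
  cl_measurable :
    measurable_fun (`[0, T] `*` setT) (fun z : R * Om => H z.1 z.2) ;
  cl_integrable : {ae P, forall w,
    (\int[lebesgue_measure]_(t in `[0%R, T]) (`|H t w| ^+ q)%R%:E < +oo)%E} }.

(* [I] is (the continuous version of) the Ito integral process
   [\int_0^t H dW], [0 <= t <= T]: the limit in probability of integrals of
   simple processes approximating [H]. *)
Record is_ito_integral P F W (T : R) H I : Prop := {
  ito_integrand : class_L P F T 2 H ;
  ito_adapted : forall t : R, 0 <= t <= T -> sub_measurable (F t) (I t) ;
  ito_continuous :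
    {ae P, forall w, {within `[0, T], continuous (fun t => I t w)}} ;
  ito_limit : exists h : nat -> simple_process,
    [/\ forall n, is_simple F T (h n),
        cvg_in_probability P (fun n w =>
          \int[lebesgue_measure]_(t in `[0%R, T])
            (`|H t w - simple_value (h n) t w| ^+ 2)%R%:E)%E
      & forall t : R, 0 <= t <= T -> cvg_in_probability P (fun n w =>
          `|simple_integral W (h n) t w - I t w|%:E)] }.

Record strong_solution P F W (N : nat) (r : R -> Om -> 'I_N) (T : R)
    (f g : R -> 'I_N -> R) (y0 : R) (y : R -> Om -> R) : Prop := {
  sol_adapted : forall t : R, 0 <= t <= T -> sub_measurable (F t) (y t) ;
  sol_continuous :
    {ae P, forall w, {within `[0, T], continuous (fun t => y t w)}} ;
  sol_drift : class_L P F T 1 (fun t w => f (y t w) (r t w)) ;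
  sol_equation : exists I : R -> Om -> R,
    is_ito_integral P F W T (fun t w => g (y t w) (r t w)) I /\
    {ae P, forall w, forall t : R, 0 <= t <= T ->
      y t w = y0 + \int[lebesgue_measure]_(s in `[0, t]) f (y s w) (r s w)
                 + I t w} }.

End Stochastic.

Section Scheme.
Context {R : realType} {N : nat}.
Implicit Types (f g : R -> 'I_N -> R).

Definition partial_x g (x : R) (i : 'I_N) : R := derive1 (g^~ i) x.

Definition corrected_drift f g (eta : R) (x : R) (i : 'I_N) : R :=
  f x i - eta * g x i * partial_x g x i.

(* [t_k = k Delta], except that the grid stops at [T]: if
   [(n - 1) Delta < T <= n Delta] then [t_k = T] for all [k >= n]. *)
Definition grid (T Delta : R) (k : nat) : R := Num.min (k%:R * Delta) T.

(* For [0 <= t < T], the [k] such that [t_k <= t < t_{k+1}]. *)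
Definition grid_index (Delta t : R) : nat := Num.truncn (t / Delta).

Section Path.
(* [W] and [r] are here one trajectory of the driving processes. *)
Variables (f g : R -> 'I_N -> R) (theta eta T : R) (y0 : R).
Variables (W : R -> R) (r : R -> 'I_N) (Delta : R).

Let tau := grid T Delta.
Let dt (k : nat) : R := tau k.+1 - tau k.
Let dW (k : nat) : R := W (tau k.+1) - W (tau k).
Let rg (k : nat) : 'I_N := r (tau k).
Let fbar := corrected_drift f g eta.

Definition predictor (k : nat) (x : R) : R :=
  x + f x (rg k) * dt k + g x (rg k) * dW k.

Fixpoint pc_em (k : nat) : R :=
  if k is m.+1 then
    let x := pc_em m in
    let xt := predictor m x in
    x + (theta * fbar xt (rg m) + (1 - theta) * fbar x (rg m)) * dt m
      + (eta * g xt (rg m) + (1 - eta) * g x (rg m)) * dW m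
  else y0.

(* [pc_pred k] is the predicted value at [t_{k+1}]. *)
Definition pc_pred (k : nat) : R := predictor k (pc_em k).

(* The step processes below are obtained from [R_{l,k}] by cancelling the
   factor [Delta] (for [l = 1, 2, 3]) or [Delta W_{t_k}] (for [l = 4]). *)
Definition rem1 (k : nat) : R :=
  theta * (f (pc_pred k) (rg k) - f (pc_em k) (rg k)).
Definition rem2 (k : nat) : R :=
  - (theta * eta * (g (pc_pred k) (rg k) * partial_x g (pc_pred k) (rg k)
                    - g (pc_em k) (rg k) * partial_x g (pc_em k) (rg k))).
Definition rem3 (k : nat) : R :=
  - (eta * g (pc_em k) (rg k) * partial_x g (pc_em k) (rg k)).
Definition rem4 (k : nat) : R :=
  eta * (g (pc_pred k) (rg k) - g (pc_em k) (rg k)).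

Let step (v : nat -> R) (t : R) : R := v (grid_index Delta t).
Definition Ybar (t : R) : R := pc_em (grid_index Delta t).
Definition rbar (t : R) : 'I_N := rg (grid_index Delta t).

(* The intervals [[t_k, t_{k+1}[] with [k <= grid_index Delta t] cover
   [[0, t[], so the [dW] integrals are sums over these [k]. *)
Definition pc_em_cont (t : R) : R :=
  y0 + \int[lebesgue_measure]_(s in `[0, t]) f (Ybar s) (rbar s)
     + step_integral (grid_index Delta t).+1 tau
         (fun k => g (pc_em k) (rg k)) W t
     + \int[lebesgue_measure]_(s in `[0, t]) step rem1 s
     + \int[lebesgue_measure]_(s in `[0, t]) step rem2 s
     + \int[lebesgue_measure]_(s in `[0, t]) step rem3 s
     + step_integral (grid_index Delta t).+1 tau rem4 W t.

End Path.
End Scheme.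

(* Main.v *)
Require Import Defs.
From HB Require Import structures.
From mathcomp Require Import all_boot all_order all_algebra.
From mathcomp Require Import all_classical all_reals all_analysis.
From mathcomp Require Import measurable_realfun ring lra.
Import Order.TTheory GRing.Theory Num.Theory.
Import numFieldNormedType.Exports.

(* Idea.  The drift corrections are arranged so that, up to terms of order
   [Delta], the local remainder of the scheme is [h * (dW ^ 2 - dt)] with
   [h = eta * g * g_x], a martingale difference; this needs no second derivative
   of [g], only that [h] is Lipschitz, through [(g ^ 2 / 2)' = g * g_x].  With
   uniform second moments of the scheme, Doob's inequality bounds the mean of
   the squared supremum of the accumulated remainder by [C * Delta].  The
   switching error is of order [Delta] because [W] and [r] are independent, so
   that one may condition on the path of [r].  The Ito integral is only known as
   a limit in probability of integrals of simple processes; on the adapted sets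
   where [y] stays below a level, Doob's inequality for the differences with
   these simple processes, followed by Lenglart's argument, gives the isometry
   bound.  Gronwall's lemma then yields a bound independent of the level, and
   Fatou's lemma removes the localization. *)

Local Open Scope classical_set_scope.
Local Open Scope ring_scope.

Set Implicit Arguments.
Unset Strict Implicit.
Unset Printing Implicit Defensive.

(** * Expectations *)

(** That [h] is Lipschitz with linear growth comes from writing it as [f - corrected_drift], a
    difference of two maps with these properties; hence every estimate on the correction goes
    through [h], never through the derivative of [g] alone. Suprema over a continuum of times are
    never shown measurable. The integral of a nonnegative function is monotone without
    measurability, so each supremum is dominated by a measurable envelope, obtained from maxima over
    finitely many times of a countable dense set and extended by path continuity. Localization uses
    no stopping times. A decreasing family of adapted events [G s] multiplies the integrands, and on
    [G t] all earlier indicators equal 1, so localized and original sums agree there. The level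
    bounds the Ito integrand and gives Gronwall's lemma a finite quantity to start from, but does
    not enter the final constant. Gronwall's lemma is applied to the mean squared error of the
    coefficients along the two processes rather than of the state. The outcome is a bound
    [C * Delta] for all small [Delta], so the term of order [o(Delta)] can be taken to be zero. *)

Section ge0_integral.
Context d (Om : measurableType d) (R : realType) (P : {measure set Om -> \bar R}).
Local Open Scope ereal_scope.

Import HBNNSimple.

(* The integral of a nonnegative function is a supremum over the simple
   functions below it, whence monotonicity without measurability. *)
Lemma ge0_le_integralT (f g : Om -> \bar R) :
  (forall x, 0 <= f x) -> (forall x, f x <= g x) ->
  \int[P]_x f x <= \int[P]_x g x.
Proof.
move=> f0 fg.
rewrite !ge0_integralTE//; last by move=> x; exact: le_trans (f0 x) (fg x).
apply: le_ereal_sup => _ [h hf <-]; exists h => // x.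
exact: le_trans (hf x) (fg x).
Qed.

(** On simple functions this is the hypothesis on measurable sets; monotone convergence on both
    sides carries it to every nonnegative [f]. It turns Gaussian expectations into Lebesgue
    integrals against the density. *)
Lemma ge0_integral_density (mu nu : {measure set Om -> \bar R}) (p : Om -> R)
    (f : Om -> \bar R) :
  measurable_fun setT p -> (forall x, 0 <= p x)%R ->
  (forall A, measurable A -> nu A = \int[mu]_(x in A) (p x)%:E) ->
  measurable_fun setT f -> (forall x, 0 <= f x) ->
  \int[nu]_x f x = \int[mu]_x (f x * (p x)%:E).
Proof.
move=> mp p0 nuE mf f0.

pose h := nnsfun_approx (measurableT) mf.
have hnu n : \int[nu]_x (h n x)%:E = \int[mu]_x ((h n x)%:E * (p x)%:E).
  rewrite integralT_nnsfun sintegralE.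
  have -> : (fun x => (h n x)%:E * (p x)%:E) = 
     (fun x => \sum_(r \in range (h n)) ((r * \1_(h n @^-1` [set r]) x)%:E * (p x)%:E)).
    apply/funext => x; rewrite {1}(fimfunE (h n)) -fsumEFin//.
    rewrite !fsbig_finite//= ge0_sume_distrl//.
    by move=> r _; rewrite EFinM nnfun_muleindic_ge0.
  rewrite ge0_integral_fsum//=.
  - apply: eq_fsbigr => r /[!inE] -[y _ <-].
    under eq_integral do rewrite EFinM -muleA.
    rewrite ge0_integralZl//=.
    + rewrite nuE// integral_mkcond; congr (_ * _).
      apply: eq_integral => x _; rewrite /patch indicE.
      by case: (x \in _); rewrite ?mul1e ?mul0e.
    + by apply: emeasurable_funM; apply/measurable_EFinP.
    + by move=> x _; rewrite mule_ge0// lee_fin.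
    + by rewrite lee_fin.
  - move=> r; apply: emeasurable_funM; apply/measurable_EFinP => //.
    exact: measurable_funM.
  - by move=> r x _; apply: mule_ge0; [rewrite EFinM nnfun_muleindic_ge0|rewrite lee_fin].
transitivity (limn (fun n => \int[nu]_x (h n x)%:E)).
  rewrite -monotone_convergence//=.
  - apply: eq_integral => x _; apply/esym/cvg_lim => //.
    exact: cvg_nnsfun_approx.
  - by move=> n; apply/measurable_EFinP.
  - by move=> n x _; rewrite lee_fin.
  - by move=> x _ m n mn; rewrite lee_fin; exact/lefP/nd_nnsfun_approx.
under eq_fun do rewrite hnu.
rewrite -monotone_convergence//=.
- apply: eq_integral => x _; apply/cvg_lim => //.
  by apply: cvgeZr => //; exact: cvg_nnsfun_approx.
- by move=> n; apply: emeasurable_funM; apply/measurable_EFinP.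
- by move=> n x _; rewrite mule_ge0// lee_fin.
- move=> x _ m n mn; rewrite lee_wpmul2r// ?lee_fin//.
  exact/lefP/nd_nnsfun_approx.
Qed.

End ge0_integral.

Definition Ex d (Om : measurableType d) (R : realType)
    (P : set Om -> \bar R) (X : Om -> R) : \bar R :=
  (\int[P]_w (X w)%:E)%E.

Definition indep2 d (Om : measurableType d) (R : realType)
    (P : set Om -> \bar R) (X Z : Om -> R) : Prop :=
  forall A B : set R, measurable A -> measurable B ->
    P (X @^-1` A `&` Z @^-1` B) = (P (X @^-1` A) * P (Z @^-1` B))%E.

Section expectation.
Context d (Om : measurableType d) (R : realType) (P : probability Om R).
Implicit Types X Y Z : Om -> R.
Local Notation E := (Ex P).

Lemma Ex_ge0 X : (forall w, 0 <= X w) -> (0 <= E X)%E.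
Proof. by move=> X0; apply: integral_ge0 => w _; rewrite lee_fin. Qed.

Lemma Ex_le X Y : (forall w, 0 <= X w) -> (forall w, X w <= Y w) ->
  (E X <= E Y)%E.
Proof.
by move=> X0 XY; apply: ge0_le_integralT => w; rewrite lee_fin.
Qed.

Lemma Ex_cst c : E (fun=> c) = c%:E.
Proof.
by rewrite /Ex integral_cst// [X in (_ * X)%E](probability_setT P) mule1.
Qed.

Lemma Ex_indic A : measurable A -> E (\1_A) = P A.
Proof. by move=> mA; rewrite /Ex integral_indic// setIT. Qed.

Lemma Ex_Z c X : 0 <= c -> measurable_fun setT X -> (forall w, 0 <= X w) ->
  E (fun w => c * X w) = (c%:E * E X)%E.
Proof.
move=> c0 mX X0; rewrite /Ex; under eq_integral do rewrite EFinM.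
by rewrite ge0_integralZl//; [exact/measurable_EFinP|move=> w _; rewrite lee_fin].
Qed.

Lemma Ex_D X Y : measurable_fun setT X -> (forall w, 0 <= X w) ->
  measurable_fun setT Y -> (forall w, 0 <= Y w) ->
  E (fun w => X w + Y w) = (E X + E Y)%E.
Proof.
move=> mX X0 mY Y0; rewrite /Ex; under eq_integral do rewrite EFinD.
by rewrite ge0_integralD//; do ?[exact/measurable_EFinP|move=> w _; rewrite lee_fin].
Qed.

Lemma Ex_sum I (s : seq I) (X : I -> Om -> R) :
  (forall i, measurable_fun setT (X i)) -> (forall i w, 0 <= X i w) ->
  E (fun w => \sum_(i <- s) X i w) = (\sum_(i <- s) E (X i))%E.
Proof.
move=> mX X0; rewrite /Ex; under eq_integral do rewrite -sumEFin.
by rewrite ge0_integral_sum//; do ?[move=> i; exact/measurable_EFinP|move=> i w _; rewrite lee_fin].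
Qed.

Lemma Ex_lty_integrable X : measurable_fun setT X ->
  (E (fun w => `|X w|)%R < +oo)%E <-> P.-integrable setT (EFin \o X).
Proof.
move=> mX; split => [h|/integrableP[_ h]]; last exact: h.
by apply/integrableP; split => //; exact/measurable_EFinP.
Qed.

Lemma indep2_comp X Z (f g : R -> R) : measurable_fun setT f ->
  measurable_fun setT g -> indep2 P X Z -> indep2 P (f \o X) (g \o Z).
Proof.
move=> mf mg h A B mA mB.
by apply: (h (f @^-1` A) (g @^-1` B)); rewrite -[X in measurable X]setTI; [exact: mf|exact: mg].
Qed.

(** Independence says that the joint law and the product of the marginal laws agree on rectangles,
    hence everywhere; Tonelli's theorem then factors the integral. *)
Lemma ge0_Ex_indepM X Z : measurable_fun setT X -> measurable_fun setT Z ->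
  (forall w, 0 <= X w) -> (forall w, 0 <= Z w) -> indep2 P X Z ->
  E (fun w => X w * Z w) = (E X * E Z)%E.
Proof.
move=> mX mZ X0 Z0 XZ.
pose X' : {mfun Om >-> R} := mfun_Sub (mem_set mX).
pose Z' : {mfun Om >-> R} := mfun_Sub (mem_set mZ).
have mXZ : measurable_fun setT (fun w => (X w, Z w)).
  exact: measurable_fun_pair.
pose XZ' : {mfun Om >-> (R * R)%type} := mfun_Sub (mem_set mXZ).
pose mu := distribution P X'; pose nu := distribution P Z'.
have prodE A : measurable A -> (mu \x nu)%E A = distribution P XZ' A.
  move=> mA; apply: product_measure_unique => // B C mB mC; exact: XZ.
(* Tonelli's theorem asks for an integrand that is nonnegative on the whole plane, whence the
   absolute values; they disappear along [(X, Z)]. *)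
pose F (z : R * R) := (`|z.1| * `|z.2|)%:E.
have mF : measurable_fun setT F.
  apply/measurable_EFinP; apply: measurable_funM; exact: measurableT_comp.
have F0 z : (0 <= F z)%E by rewrite lee_fin mulr_ge0.
transitivity (\int[distribution P XZ']_z F z)%E.
  rewrite ge0_integral_distribution//; apply: eq_integral => w _ /=.
  by rewrite /F/= !ger0_norm.
transitivity (\int[mu \x nu]_z F z)%E.
  by apply: eq_measure_integral => A mA _; exact/esym/prodE.
rewrite fubini_tonelli1// /fubini_F/=.
transitivity (\int[mu]_x (`|x|%:E * \int[nu]_y (`|y|%:E)))%E.
  apply: eq_integral => x _; rewrite -ge0_integralZl ?lee_fin//.
  by apply/measurable_EFinP; exact: normr_measurable.
rewrite ge0_integralZr//; last by apply: integral_ge0.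
  congr (_ * _)%E; rewrite ge0_integral_distribution//.
  - by apply: eq_integral => w _ /=; rewrite ger0_norm.
  - by apply/measurable_EFinP; exact: normr_measurable.
  - by apply: eq_integral => w _ /=; rewrite ger0_norm.
  - by apply/measurable_EFinP; exact: normr_measurable.
by apply/measurable_EFinP; exact: normr_measurable.
Qed.

(** The factorization is known for nonnegative factors only, so both variables are split into
    positive and negative parts. Mean zero makes the two parts of [Z] have equal mean, and the four
    products cancel in pairs. First moments suffice: integrability of the product comes from
    independence. *)
Lemma Ex_indepM_eq0 X Z : measurable_fun setT X -> measurable_fun setT Z ->
  (E (fun w => `|X w|)%R < +oo)%E -> (E (fun w => `|Z w|)%R < +oo)%E ->
  E Z = 0%E -> indep2 P X Z ->
  P.-integrable setT (EFin \o (fun w => X w * Z w)) /\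
  E (fun w => X w * Z w) = 0%E.
Proof.
move=> mX mZ iX iZ EZ0 XZ.
have pos0 (Y : Om -> R) w : 0 <= (Y^\+)%R w by exact: funrpos_ge0.
have neg0 (Y : Om -> R) w : 0 <= (Y^\-)%R w by exact: funrneg_ge0.
have mpos (Y : Om -> R) : measurable_fun setT Y -> measurable_fun setT (Y^\+)%R.
  exact: measurable_funrpos.
have mneg (Y : Om -> R) : measurable_fun setT Y -> measurable_fun setT (Y^\-)%R.
  exact: measurable_funrneg.
have fin (Y V : Om -> R) : (forall w, 0 <= Y w) -> (forall w, Y w <= `|V w|) ->
    (E (fun w => `|V w|)%R < +oo)%E -> E Y \is a fin_num.
  move=> Y0 YV iV; rewrite ge0_fin_numE ?Ex_ge0//.
  by apply: le_lt_trans iV; exact: Ex_le.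
have posle (Y : Om -> R) w : (Y^\+)%R w <= `|Y w|.
  by rewrite /funrpos/= ge_max ler_norm normr_ge0.
have negle (Y : Om -> R) w : (Y^\-)%R w <= `|Y w|.
  by rewrite /funrneg/= ge_max normr_ge0 andbT -normrN ler_norm.
have fXp := fin _ _ (pos0 X) (posle X) iX.
have fXn := fin _ _ (neg0 X) (negle X) iX.
have fZp := fin _ _ (pos0 Z) (posle Z) iZ.
have fZn := fin _ _ (neg0 Z) (negle Z) iZ.
have posneg (Y : Om -> R) w : Y w = (Y^\+)%R w - (Y^\-)%R w.
  by have /(congr1 (fun f => f w)) <- := funrposBneg Y.
have int (Y : Om -> R) : measurable_fun setT Y -> (forall w, 0 <= Y w) ->
    E Y \is a fin_num -> P.-integrable setT (EFin \o Y).
  move=> mY Y0 fY; apply/Ex_lty_integrable => //.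
  under eq_fun do rewrite ger0_norm//.
  by rewrite ltey_eq fY.
have EZpn : E (Z^\+)%R = E (Z^\-)%R.
  move: EZ0; rewrite {1}/Ex.
  have -> : (fun w => (Z w)%:E) = (fun w => ((Z^\+)%R w)%:E - ((Z^\-)%R w)%:E)%E.
    by apply/funext => w; rewrite -EFinB -posneg.
  rewrite integralB_EFin//; [|exact: int (mpos _ mZ) _ _|exact: int (mneg _ mZ) _ _].
  by move=> /eqP; rewrite sube_eq ?add0e// ?fin_num_adde_defl// => /eqP.
have mp (f : R -> R) : f = (fun x => Num.max x 0) \/ f = (fun x => Num.max (- x) 0) ->
    measurable_fun setT f.
  move=> [->|->]; first exact: measurable_maxr.
  by apply: measurable_maxr => //; exact: measurable_funN.
have ind (f g : R -> R) := fun h1 h2 => @indep2_comp X Z f g (mp f h1) (mp g h2) XZ.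
have pp : indep2 P (X^\+)%R (Z^\+)%R by exact: (ind _ _ (or_introl erefl) (or_introl erefl)).
have pn : indep2 P (X^\+)%R (Z^\-)%R by exact: (ind _ _ (or_introl erefl) (or_intror erefl)).
have np : indep2 P (X^\-)%R (Z^\+)%R by exact: (ind _ _ (or_intror erefl) (or_introl erefl)).
have nn : indep2 P (X^\-)%R (Z^\-)%R by exact: (ind _ _ (or_intror erefl) (or_intror erefl)).
have Epp := ge0_Ex_indepM (mpos _ mX) (mpos _ mZ) (pos0 X) (pos0 Z) pp.
have Epn := ge0_Ex_indepM (mpos _ mX) (mneg _ mZ) (pos0 X) (neg0 Z) pn.
have Enp := ge0_Ex_indepM (mneg _ mX) (mpos _ mZ) (neg0 X) (pos0 Z) np.
have Enn := ge0_Ex_indepM (mneg _ mX) (mneg _ mZ) (neg0 X) (neg0 Z) nn.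
have ipp := int _ (measurable_funM (mpos _ mX) (mpos _ mZ)) (fun w => mulr_ge0 (pos0 X w) (pos0 Z w)).
have ipn := int _ (measurable_funM (mpos _ mX) (mneg _ mZ)) (fun w => mulr_ge0 (pos0 X w) (neg0 Z w)).
have inp := int _ (measurable_funM (mneg _ mX) (mpos _ mZ)) (fun w => mulr_ge0 (neg0 X w) (pos0 Z w)).
have inn := int _ (measurable_funM (mneg _ mX) (mneg _ mZ)) (fun w => mulr_ge0 (neg0 X w) (neg0 Z w)).
have {}ipp := ipp ltac:(by rewrite /= Epp fin_numM).
have {}ipn := ipn ltac:(by rewrite /= Epn fin_numM).
have {}inp := inp ltac:(by rewrite /= Enp fin_numM).
have {}inn := inn ltac:(by rewrite /= Enn fin_numM).
have XZE w : (X w * Z w)%:E = (((X^\+)%R w * (Z^\+)%R w)%:E -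
    ((X^\+)%R w * (Z^\-)%R w)%:E - (((X^\-)%R w * (Z^\+)%R w)%:E -
    ((X^\-)%R w * (Z^\-)%R w)%:E))%E.
  rewrite -!EFinB; congr EFin.
  by rewrite [X w]posneg [Z w]posneg; ring.
have ip := integrableB measurableT ipp ipn.
have iN := integrableB measurableT inp inn.
split.
  apply: eq_integrable (integrableB measurableT ip iN) => //.
  by move=> w _; rewrite /= XZE.
rewrite /Ex; under eq_integral do rewrite XZE.
have := integralB measurableT ip iN => /= ->.
have := integralB measurableT ipp ipn => /= ->.
have := integralB measurableT inp inn => /= ->.
move: Epp Epn Enp Enn; rewrite /Ex => -> -> -> ->.
move: EZpn; rewrite /Ex => ->.
by rewrite !subee ?fin_numM// sube0.
Qed.

(** This is how martingale terms are dropped from a pathwise inequality. If [E A] is infinite there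
    is nothing to prove, otherwise the integral is additive. *)
Lemma Ex_le_addmean0 X (A B : Om -> R) : measurable_fun setT X -> measurable_fun setT A ->
  (forall w, 0 <= X w) -> (forall w, 0 <= A w) ->
  P.-integrable setT (EFin \o B) -> E B = 0%E ->
  (forall w, X w <= A w + B w) -> (E X <= E A)%E.
Proof.
move=> mX mA X0 A0 iB EB0 XAB.
have [->|] := eqVneq (E A) +oo%E; first exact: leey.
rewrite -ltey => finA.
have iA : P.-integrable setT (EFin \o A).
  by apply/Ex_lty_integrable => //; under eq_fun do rewrite ger0_norm//.
rewrite -[leRHS]adde0 -EB0 /Ex -integralD//; apply: ge0_le_integralT => w.
  by rewrite lee_fin.
by rewrite -EFinD lee_fin.
Qed.

End expectation.

(** * Gaussian moments *)

Section normal_moments.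
Context {R : realType}.
Local Notation mu := (@lebesgue_measure R).
Variable s : R.
Hypothesis s0 : s != 0.
Local Notation p := (normal_pdf 0 s).

Let p_ge0 x : 0 <= p x. Proof. exact: normal_pdf_ge0. Qed.

Let mp : measurable_fun setT p. Proof. exact: measurable_normal_pdf. Qed.

Let cp : continuous p. Proof. exact: continuous_normal_pdf. Qed.

Let s2_neq0 : s ^+ 2 != 0. Proof. by rewrite expf_neq0. Qed.

Lemma ge0_integral_normal_prob (f : R -> \bar R) :
  measurable_fun setT f -> (forall x, (0 <= f x)%E) ->
  (\int[normal_prob 0 s]_x f x = \int[mu]_x (f x * (p x)%:E))%E.
Proof.
by move=> mf f0; apply: (@ge0_integral_density _ _ _ mu (normal_prob 0 s)).
Qed.

Lemma is_derive_normal_pdf (x : R) : is_derive x 1 p (- (x / s ^+ 2) * p x).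
Proof.
rewrite normal_pdfE//; rewrite /normal_fun.
apply: is_derive_eq.
by rewrite /GRing.scale/= subr0; field.
Qed.

Lemma normal_pdf_even x : p (- x) = p x.
Proof. by rewrite normal_pdfE// /normal_fun !subr0 sqrrN. Qed.

Lemma ge0_integral_oppr (f : R -> \bar R) : measurable_fun setT f ->
  (forall x, (0 <= f x)%E) -> (\int[mu]_x f x = \int[mu]_x f (- x)%R)%E.
Proof.
move=> mf f0.
transitivity (\int[mu]_(x in (-%R : measurableTypeR R -> measurableTypeR R) @^-1` setT)
    (f \o -%R) x)%E; last by rewrite preimage_setT.
rewrite -ge0_integral_pushforward//.
by apply: eq_measure_integral => A mA _; exact/esym/lebesgue_measureN.
Qed.

(** The density is even. This expresses mean zero through nonnegative integrals, so no integrability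
    has to be established first. *)
Lemma normal_mean_posneg : (\int[normal_prob 0 s]_x (Num.max x 0)%:E =
  \int[normal_prob 0 s]_x (Num.max (- x) 0)%:E)%E.
Proof.
have m1 : measurable_fun setT (fun x : R => (Num.max x 0)%:E).
  by apply/measurable_EFinP; exact: measurable_maxr.
have m2 : measurable_fun setT (fun x : R => (Num.max (- x) 0)%:E).
  by apply/measurable_EFinP; apply: measurable_maxr => //; exact: oppr_measurable.
have max0 (x : R) : (0 <= (Num.max x 0)%:E)%E by rewrite lee_fin le_max lexx orbT.
rewrite !ge0_integral_normal_prob// ge0_integral_oppr.
- by apply: eq_integral => x _; rewrite normal_pdf_even.
- by apply: emeasurable_funM => //; exact/measurable_EFinP.
- by move=> x; rewrite mule_ge0// lee_fin.
Qed.

Let mom (k : nat) (D : set R) : \bar R := (\int[mu]_(x in D) (x ^+ k * p x)%:E)%E.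

Let mpow k D : measurable_fun D (fun x : R => (x ^+ k * p x)%:E).
Proof.
by apply/measurable_EFinP/measurable_funTS/measurable_funM.
Qed.

Let pow_ge0 k x : (0 <= (x ^+ k.*2 * p x)%:E)%E.
Proof. by rewrite lee_fin mulr_ge0// -mul2n exprM exprn_ge0// sqr_ge0. Qed.

Let cpow k : continuous (fun x : R => x ^+ k * p x).
Proof. by move=> x; apply: cvgM; [exact: exprn_continuous|exact: cp]. Qed.

Let LR (f : R -> R) (df : R -> R) (a b : R) :
  (forall x : R, is_derive x 1 f (df x)) -> derivable_oo_LRcontinuous f a b.
Proof.
move=> fdf; have cf : continuous f.
  by move=> x; apply/differentiable_continuous/derivable1_diffP; have [] := fdf x.
split => [x _||].
- by have [] := fdf x.
- exact/cvg_at_right_filter/cf.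
- exact/cvg_at_left_filter/cf.
Qed.

(** Integration by parts, with [x * p x] as the derivative of [- s ^+ 2 * p x]. Since an odd power
    meets an even density, the two boundary terms add up instead of cancelling. *)
Let momS k (n : R) : 0 < n -> mom k.*2.+2 `[(- n)%R, n] =
  (((k.*2.+1%:R * s ^+ 2)%:E * mom k.*2 `[(- n)%R, n]) -
   (2 * s ^+ 2 * (n ^+ k.*2.+1 * p n))%:E)%E.
Proof.
move=> n0; have nn : - n < n by rewrite gtrN.
rewrite /mom.
have d1 (x : R) : is_derive x 1 (fun x : R => x ^+ k.*2.+1) (k.*2.+1%:R * x ^+ k.*2).
  apply: DeriveDef; first exact: exprn_derivable.
  by rewrite -derive1E exp_derive1.
have d2 (x : R) : is_derive x 1 (fun x => - s ^+ 2 * p x) (x ^+ 1 * p x).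
  have h := is_derive_normal_pdf x.
  by apply: is_derive_eq; rewrite /GRing.scale/=; field.
have cf : {within `[(- n)%R, n], continuous (fun x : R => k.*2.+1%:R * x ^+ k.*2)}.
  by apply: continuous_subspaceT => x; apply: cvgM; [exact: cvg_cst|exact: exprn_continuous].
have e1 : {in `]- n, n[, (fun x : R => x ^+ k.*2.+1)^`()%classic =1 (fun x => k.*2.+1%:R * x ^+ k.*2)}.
  by move=> x _; rewrite derive1E; have [_ ->] := d1 x.
have cg : {within `[(- n)%R, n], continuous (fun x => x ^+ 1 * p x)}.
  exact/continuous_subspaceT/cpow.
have e2 : {in `]- n, n[, (fun x => - s ^+ 2 * p x)^`()%classic =1 (fun x => x ^+ 1 * p x)}.
  by move=> x _; rewrite derive1E; have [_ ->] := d2 x.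
have h := integration_by_parts nn cf (LR _ _ d1) e1 cg (LR _ _ d2) e2.
transitivity (\int[mu]_(x in `[(- n)%R, n]) (x ^+ k.*2.+1 * (x ^+ 1 * p x))%:E)%E.
  by apply: eq_integral => x _; rewrite mulrA -exprD addn1.
rewrite h; rewrite normal_pdf_even.
transitivity ((- (2 * s ^+ 2 * (n ^+ k.*2.+1 * p n)))%:E +
   - \int[mu]_(x in `[(- n)%R, n]) ((- (k.*2.+1%:R * s ^+ 2))%:E * (x ^+ k.*2 * p x)%:E))%E.
  congr (_ + - _)%E.
    have -> : (- n) ^+ k.*2.+1 = - n ^+ k.*2.+1.
      by rewrite !exprS -mul2n !exprM sqrrN mulNr.
    by congr EFin; ring.
  by apply: eq_integral => x _; rewrite -EFinM; congr EFin; ring.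
have fint : mu.-integrable `[(- n)%R, n] (fun x => (x ^+ k.*2 * p x)%:E).
  apply: continuous_compact_integrable; first exact: segment_compact.
  exact/continuous_subspaceT/cpow.
rewrite integralZl//= EFinN addeC; congr (_ + _)%E.
by rewrite EFinN mulNe oppeK.
Qed.

Let cvg_mom k : mom k.*2 `[(- n.+1%:R)%R, n.+1%:R]%classic @[n --> \oo] --> mom k.*2 setT.
Proof.
have -> : [set: R] = \bigcup_n `[(- n.+1%:R)%R, n.+1%:R]%classic.
  apply/esym; rewrite -subTset => x _.
  exists (Num.trunc `|x|) => //=; rewrite in_itv/= -ler_norml.
  by rewrite ltW// truncnS_gt.
apply: ge0_nondecreasing_set_cvg_integral => //=.
- move=> m n mn; rewrite subsetEset => x/=; rewrite !in_itv/= -!ler_norml => h.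
  by rewrite (le_trans h)// ler_nat ltnS.
- by move=> n; exact: mpow.
Qed.

(** The boundary term of the recursion has a favourable sign, so it may be discarded before the
    truncation is removed. An upper bound is all that the fourth and sixth moments need. *)
Let mom_le k : (mom k.+1.*2 setT <= (k.*2.+1%:R * s ^+ 2)%:E * mom k.*2 setT)%E.
Proof.
have h := @cvg_mom k.+1.
rewrite -(cvg_lim _ h)//; apply: lime_le; first by apply/cvg_ex; eexists; exact: h.
apply: nearW => n; rewrite doubleS momS//.
apply: (@le_trans _ _ ((k.*2.+1%:R * s ^+ 2)%:E * mom k.*2 `[(- n.+1%:R)%R, n.+1%:R]%classic))%E.
  rewrite leeBlDr// leeDl// lee_fin mulr_ge0//; first by rewrite mulr_ge0// sqr_ge0.
  by rewrite mulr_ge0// exprn_ge0.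
apply: lee_wpmul2l; first by rewrite lee_fin mulr_ge0// sqr_ge0.
by apply: ge0_subset_integral => //; exact: mpow.
Qed.

Let mom0 : mom 0 setT = 1%E.
Proof.
rewrite /mom -[RHS](integral_normal_pdf 0 s).
by apply: eq_integral => x _; rewrite expr0 mul1r.
Qed.

(** The variance is needed exactly, because [dt] must compensate [dW ^+ 2] with no error. Hence here
    the boundary term must be shown to vanish in the limit. *)
Let mom2_eq : mom 2 setT = (s ^+ 2)%:E.
Proof.
apply/eqP; rewrite eq_le; apply/andP; split.
  by have := mom_le 0; rewrite double0 mom0 mule1 mul1r.
(* [1 + a <= expR a] at [a = n ^+ 2 / (2 * s ^+ 2)] makes the Gaussian tail at most [1 / a], enough
   to beat the factor [n]. *)
have bnd n : (0 < n)%R -> n * p n <= 2 * s ^+ 2 * normal_peak s * n^-1.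
  move=> n0; rewrite normal_pdfE//= /normal_fun subr0.
  have s2 : 0 < s ^+ 2 by rewrite exprn_even_gt0.
  rewrite mulNr expRN.
  have A0 : 0 < n ^+ 2 / (s ^+ 2 *+ 2) by rewrite divr_gt0 ?exprn_gt0// mulrn_wgt0.
  have -> : 2 * s ^+ 2 * normal_peak s * n^-1 =
      n * (normal_peak s * (n ^+ 2 / (s ^+ 2 *+ 2))^-1).
    by rewrite -mulr_natl; field; rewrite s0 gt_eqF.
  rewrite ler_wpM2l ?(ltW n0)// ler_wpM2l ?normal_peak_ge0//.
  rewrite lef_pV2 ?posrE ?expR_gt0//.
  by apply: le_trans (expR_ge1Dx _); rewrite lerDr.
have h := @cvg_mom 1; rewrite -(cvg_lim _ h)//.
have h0 := @cvg_mom 0; rewrite double0 mom0 in h0.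
have hn : (2 * s ^+ 2 * (n.+1%:R * p n.+1%:R))%:E @[n --> \oo] --> 0%E.
  apply: cvg_EFin; first exact: nearW.
  apply: (@squeeze_cvgr _ _ _ _ (fun=> 0)
    (fun n => 2 * s ^+ 2 * (2 * s ^+ 2 * normal_peak s * n.+1%:R^-1))).
  - have s2 : 0 <= 2 * s ^+ 2 by rewrite mulr_ge0 ?sqr_ge0.
    apply: nearW => n /=; apply/andP; split; last by rewrite ler_wpM2l ?bnd.
    by apply: mulr_ge0 => //; exact: mulr_ge0.
  - exact: cvg_cst.
  - have h1 : (fun n : nat => 2 * s ^+ 2 * (2 * s ^+ 2 * normal_peak s * n.+1%:R^-1)) @ \oo -->
        2 * s ^+ 2 * (2 * s ^+ 2 * normal_peak s * 0).
      apply: cvgM; first exact: cvg_cst.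
      by apply: cvgM; [exact: cvg_cst|exact: cvg_harmonic].
    by rewrite !mulr0 in h1.
suff -> : limn (fun n => mom (1.*2) `[(- n.+1%:R)%R, n.+1%:R]%classic) = (s ^+ 2)%:E by [].
apply/cvg_lim => //.
under eq_fun do rewrite (@momS 0)// double0 expr1 mul1r.
have h1 : (fun n : nat => ((s ^+ 2)%:E * mom 0 `[(- n.+1%:R)%R, n.+1%:R]%classic -
    (2 * s ^+ 2 * (n.+1%:R * p n.+1%:R))%:E)%E) @ \oo --> ((s ^+ 2)%:E * 1 - 0)%E.
  by apply: cvgeB => //; exact: cvgeZl.
by rewrite mule1 sube0 in h1.
Qed.

Lemma normal_moment2 : (\int[normal_prob 0 s]_x (x ^+ 2)%:E = (s ^+ 2)%:E)%E.
Proof.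
rewrite ge0_integral_normal_prob//; last by move=> x; rewrite lee_fin sqr_ge0.
by apply/measurable_EFinP; exact: exprn_measurable.
Qed.

Lemma normal_moment4 : (\int[normal_prob 0 s]_x (x ^+ 4)%:E <= (3 * s ^+ 4)%:E)%E.
Proof.
rewrite ge0_integral_normal_prob//.
- apply: (le_trans (mom_le 1)); rewrite mom2_eq -EFinM lee_fin.
  by rewrite -mulrA -exprD.
- by apply/measurable_EFinP; exact: exprn_measurable.
- by move=> x; rewrite lee_fin (exprM x 2 2) sqr_ge0.
Qed.

(** Two uses of the recursion on top of the variance: [15 = 5 * 3]. *)
Lemma normal_moment6 : (\int[normal_prob 0 s]_x (x ^+ 6)%:E <= (15 * s ^+ 6)%:E)%E.
Proof.
rewrite ge0_integral_normal_prob//.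
- apply: (le_trans (mom_le 2)).
  apply: (@le_trans _ _ ((5 * s ^+ 2)%:E * (3 * s ^+ 4)%:E)%E).
    apply: lee_wpmul2l; first by rewrite lee_fin mulr_ge0// sqr_ge0.
    apply: (le_trans (mom_le 1)); rewrite mom2_eq -EFinM lee_fin.
    by rewrite -mulrA -exprD.
  by rewrite -EFinM lee_fin le_eqVlt; apply/orP; left; apply/eqP; ring.
- by apply/measurable_EFinP; exact: exprn_measurable.
- by move=> x; rewrite lee_fin (exprM x 2 3) exprn_ge0// sqr_ge0.
Qed.

End normal_moments.

(** * Doob's inequality *)

Definition rmax (R : realType) (x : nat -> R) : nat -> R :=
  fix M n := if n is m.+1 then Num.max (M m) `|x m.+1| else `|x 0%N|.

Section running_max.
Context {R : realType}.
Implicit Types (x h z : nat -> R).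

Lemma rmax_ge0 x n : 0 <= rmax x n.
Proof. by elim: n => [|n ih] //=; rewrite le_max ih. Qed.

Lemma le_rmax x n i : (i <= n)%N -> `|x i| <= rmax x n.
Proof.
elim: n => [|n ih]; first by rewrite leqn0 => /eqP->.
rewrite leq_eqVlt => /orP[/eqP->|/ih h] /=; rewrite le_max ?lexx ?orbT//.
by rewrite h.
Qed.

(** A crude bound, whose only purpose is to make the running maximum square integrable before the
    sharp inequality is attempted. *)
Lemma rmax_sqr_le_sum x n : rmax x n ^+ 2 <= \sum_(i < n.+1) x i ^+ 2.
Proof.
elim: n => [|n ih]; first by rewrite big_ord1/= real_normK ?num_real.
rewrite big_ord_recr/=; have [_|_] := leP (rmax x n) `|x n.+1|.
  by rewrite real_normK ?num_real// lerDr sumr_ge0// => i _; rewrite sqr_ge0.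
by rewrite (le_trans ih)// lerDl sqr_ge0.
Qed.

(* Pathwise form of Doob's inequality: summation by parts, using that the
   running maximum only increases when it is attained. *)
Lemma rmax_doob_pathwise x n : x 0%N = 0 ->
  rmax x n ^+ 2 <=
  4 * x n ^+ 2 - 4 * \sum_(i < n) rmax x i * (`|x i.+1| - `|x i|).
Proof.
move=> x0.
suff H : \sum_(i < n) rmax x i * (`|x i.+1| - `|x i|) <=
         rmax x n * `|x n| - rmax x n ^+ 2 / 2.
  have := sqr_ge0 (rmax x n - 2 * `|x n|).
  have e : `|x n| ^+ 2 = x n ^+ 2 by rewrite real_normK ?num_real.
  rewrite -e; nra.
elim: n => [|n ih]; first by rewrite big_ord0/= x0 normr0; lra.
rewrite big_ord_recr/=.
move: (rmax_ge0 x n) (normr_ge0 (x n)) (normr_ge0 (x n.+1)) ih.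
move: (\sum_(i < n) _) (rmax x n) `|x n| `|x n.+1| => S M b a M0 b0 a0 ih.
have [h|h] := leP M a; last by nra.
by have := sqr_ge0 (a - M); nra.
Qed.

(** Both the square [x n ^+ 2] and the sum in the pathwise inequality are expanded along the
    increments [h i * z i]. What remains is a sum of squares plus a sum in which [z i] has a
    coefficient known before it, hence of mean zero once expectations are taken. *)
Lemma rmax_transform_le x h z n : x 0%N = 0 ->
  (forall i, (i < n)%N -> x i.+1 = x i + h i * z i) ->
  rmax x n ^+ 2 <= \sum_(i < n) 4 * (h i ^+ 2 * z i ^+ 2) +
    \sum_(i < n) ((8 * x i - 4 * (rmax x i * Num.sg (x i))) * h i) * z i.
Proof.
move=> x0 xS; apply: (le_trans (rmax_doob_pathwise n x0)).
have -> : x n ^+ 2 = \sum_(i < n) (2 * x i * h i * z i + h i ^+ 2 * z i ^+ 2).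
  elim: n xS => [|n ih] xS; first by rewrite big_ord0 x0 expr0n.
  rewrite big_ord_recr/= -ih; last by move=> i lin; apply: xS; exact: ltnW.
  by rewrite xS//; ring.
rewrite !mulr_sumr -!big_split/= -sumrB; apply: ler_sum => i _.
rewrite (xS _ (ltn_ord i)).
(* The sign of [x i] is a subgradient of the absolute value at [x i], also when [x i = 0].
   Multiplying by the nonnegative running maximum keeps the direction of the inequality. *)
have hsg : Num.sg (x i) * (h i * z i) <= `|x i + h i * z i| - `|x i|.
  have [->|xi] := eqVneq (x i) 0; first by rewrite sgr0 mul0r add0r normr0 subr0.
  rewrite lerBrDr [X in _ + X]normrEsg -mulrDr addrC.
  by apply: (le_trans (ler_norm _)); rewrite normrM normr_sg xi mul1r.
have := rmax_ge0 x i; set M := rmax x i => M0.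
have := ler_wpM2l M0 hsg; set D := _ - `|x i|; set sg := Num.sg _; nra.
Qed.

End running_max.

(** Phrased through [g_sigma_algebraType] so that the closure lemmas for measurable functions apply
    to adapted variables. For a sigma-algebra [G] this is [sub_measurable G]. *)
Definition adapted_to (Om : pointedType) (R : realType) (G : set (set Om)) (X : Om -> R) :=
  measurable_fun [set: g_sigma_algebraType G] (X : g_sigma_algebraType G -> R).

Section doob.
Context d (Om : measurableType d) (R : realType) (P : probability Om R).
Local Notation E := (Ex P).

Lemma adapted_sub (G H : set (set Om)) (X : Om -> R) :
  G `<=` H -> adapted_to G X -> adapted_to H X.
Proof.
move=> GH GX _ B mB.
by have := GX measurableT B mB; apply: sub_sigma_algebra2.
Qed.

Lemma adapted_measurable (G : set (set Om)) (X : Om -> R) :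
  G `<=` measurable -> adapted_to G X -> measurable_fun setT X.
Proof.
move=> GH GX _ B mB.
have := GX measurableT B mB; apply: smallest_sub => //.
exact: sigma_algebra_measurable.
Qed.

Lemma adapted_preimage (G : set (set Om)) (X : Om -> R) (B : set R) :
  sigma_algebra setT G -> adapted_to G X -> measurable B -> G (X @^-1` B).
Proof.
move=> sG GX mB; rewrite -(sigma_algebra_id sG) -[X in _ X]setTI.
exact: (GX measurableT B mB).
Qed.

Lemma sub_measurable_adapted (G : set (set Om)) (X : Om -> R) :
  sub_measurable G X -> adapted_to G X.
Proof.
by move=> GX _ B mB; rewrite setTI; apply: sub_sigma_algebra; exact: GX.
Qed.

End doob.

Section doob.
Context d (Om : measurableType d) (R : realType) (P : probability Om R).
Local Notation E := (Ex P).

Lemma adapted_indep2 (G : set (set Om)) (X Z : Om -> R) :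
  sigma_algebra setT G -> adapted_to G X ->
  (forall A B, G A -> measurable B -> P (A `&` Z @^-1` B) = (P A * P (Z @^-1` B))%E) ->
  indep2 P X Z.
Proof.
by move=> sG GX GZ A B mA mB; apply: GZ => //; exact: adapted_preimage.
Qed.

Lemma Ex_sqr_integrable (X : Om -> R) : measurable_fun setT X ->
  (E (fun w => X w ^+ 2)%R < +oo)%E -> (E (fun w => `|X w|)%R < +oo)%E.
Proof.
move=> mX X2.
have le : (E (fun w => `|X w|)%R <= E (fun w => 1 + X w ^+ 2)%R)%E.
  apply: Ex_le => // w; have := sqr_ge0 (`|X w| - 1).
  by have := normr_ge0 (X w); rewrite -(@real_normK _ (X w)) ?num_real//; nra.
apply: (le_lt_trans le); rewrite (@Ex_D _ _ _ _ (fun=> 1))//.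
- by rewrite Ex_cst lte_add_pinfty// ltry.
- exact: measurable_funX.
- by move=> w; exact: sqr_ge0.
Qed.

Lemma Ex_prod_integrable (X Y : Om -> R) : measurable_fun setT X -> measurable_fun setT Y ->
  (E (fun w => X w ^+ 2)%R < +oo)%E -> (E (fun w => Y w ^+ 2)%R < +oo)%E ->
  (E (fun w => `|X w * Y w|)%R < +oo)%E.
Proof.
move=> mX mY X2 Y2.
have le : (E (fun w => `|X w * Y w|)%R <= E (fun w => X w ^+ 2 + Y w ^+ 2)%R)%E.
  apply: Ex_le => // w; rewrite normrM.
  rewrite -(@real_normK _ (X w)) ?num_real// -(@real_normK _ (Y w)) ?num_real//.
  have := sqr_ge0 (`|X w| - `|Y w|); have := mulr_ge0 (normr_ge0 (X w)) (normr_ge0 (Y w)).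
  by nra.
apply: (le_lt_trans le); rewrite Ex_D.
- exact: lte_add_pinfty.
- exact: measurable_funX.
- by move=> w; exact: sqr_ge0.
- exact: measurable_funX.
- by move=> w; exact: sqr_ge0.
Qed.

Lemma measurable_sgr (D : set R) : measurable_fun D (Num.sg : R -> R).
Proof.
have -> : (Num.sg : R -> R) = (\1_(`]0, +oo[%classic) \- \1_(`]-oo, 0[%classic)).
  apply/funext => x /=; rewrite !indicE !mem_setE !in_itv/= andbT.
  by have [x0|x0|->] := ltgtP x 0;
    rewrite ?sgr0 ?(ltr0_sg x0) ?(gtr0_sg x0) ?subrr ?subr0 ?sub0r.
apply: (@measurable_funB _ _ _ D (\1_(`]0, +oo[%classic)) (\1_(`]-oo, 0[%classic)));
  exact: measurable_indic.
Qed.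

Variables (G : nat -> set (set Om)) (h z : nat -> Om -> R) (n : nat).
Hypotheses (G_sig : forall i, (i <= n)%N -> sigma_algebra setT (G i))
  (G_mono : forall i, (i < n)%N -> G i `<=` G i.+1)
  (G_meas : forall i, (i <= n)%N -> G i `<=` measurable).
Hypotheses (h_adapted : forall i, (i < n)%N -> adapted_to (G i) (h i))
  (z_adapted : forall i, (i < n)%N -> adapted_to (G i.+1) (z i))
  (z_indep : forall i, (i < n)%N -> forall A B, G i A -> measurable B ->
     P (A `&` z i @^-1` B) = (P A * P (z i @^-1` B))%E)
  (z_mean : forall i, (i < n)%N -> E (z i) = 0%E)
  (z_sqr : forall i, (i < n)%N -> (E (fun w => z i w ^+ 2)%R < +oo)%E)
  (h_sqr : forall i, (i < n)%N -> (E (fun w => h i w ^+ 2)%R < +oo)%E).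

Let J (w : Om) (i : nat) : R := \sum_(j < i) h j w * z j w.

Let J_adapted i : (i <= n)%N -> adapted_to (G i) (J ^~ i).
Proof.
elim: i => [_|i ih lin].
  by rewrite /J; under eq_fun do rewrite big_ord0; exact: measurable_cst.
rewrite /J; under eq_fun do rewrite big_ord_recr/=.
apply: measurable_funD.
  by apply: (adapted_sub (G_mono lin)); apply: ih; exact: ltnW.
apply: measurable_funM; last exact: z_adapted.
by apply: (adapted_sub (G_mono lin)); exact: h_adapted.
Qed.

Let rmax_adapted i : (i <= n)%N -> adapted_to (G i) (fun w => rmax (J w) i).
Proof.
elim: i => [_|i ih lin] /=.
  apply: measurableT_comp => //; exact: J_adapted.
apply: measurable_maxr.
  by apply: (adapted_sub (G_mono lin)); apply: ih; exact: ltnW.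
apply: measurableT_comp => //; exact: J_adapted.
Qed.

Let mG i (X : Om -> R) : (i <= n)%N -> adapted_to (G i) X -> measurable_fun setT X.
Proof. by move=> lin; apply: adapted_measurable; exact: G_meas. Qed.

Let mh i : (i < n)%N -> measurable_fun setT (h i).
Proof. by move=> lin; apply: (mG (ltnW lin)); exact: h_adapted. Qed.

Let mz i : (i < n)%N -> measurable_fun setT (z i).
Proof. by move=> lin; apply: (mG lin); exact: z_adapted. Qed.

Let Ehz i : (i < n)%N -> E (fun w => h i w ^+ 2 * z i w ^+ 2) =
  (E (fun w => h i w ^+ 2)%R * E (fun w => z i w ^+ 2)%R)%E.
Proof.
move=> lin; apply: ge0_Ex_indepM.
- by apply: measurable_funX; exact: mh.
- by apply: measurable_funX; exact: mz.
- by move=> w; exact: sqr_ge0.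
- by move=> w; exact: sqr_ge0.
apply: (@indep2_comp _ _ _ _ (h i) (z i) (fun x => x ^+ 2) (fun x => x ^+ 2)) => //.
by apply: (adapted_indep2 (G_sig (ltnW lin))); [exact: h_adapted|exact: z_indep].
Qed.

(** Square integrability of the transform must be known before any mean can be declared zero. In the
    induction, independence factors the mean of [h ^+ 2 * z ^+ 2]. *)
Let J_sqr i : (i <= n)%N -> (E (fun w => J w i ^+ 2)%R < +oo)%E.
Proof.
elim: i => [_|i ih lin].
  rewrite /J; under eq_fun do rewrite big_ord0 expr0n/=.
  by rewrite Ex_cst ltry.
have mJ : measurable_fun setT (J^~ i) := mG (ltnW lin) (J_adapted (ltnW lin)).
have le : (E (fun w => J w i.+1 ^+ 2)%R <=
    E (fun w => 2 * J w i ^+ 2 + 2 * (h i w ^+ 2 * z i w ^+ 2))%R)%E.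
  apply: Ex_le => w; first exact: sqr_ge0.
  rewrite /J big_ord_recr/=; set a := \sum_(j < i) _; set b := h i w.
  by have := sqr_ge0 (a - b * z i w); nra.
have mhz : measurable_fun setT (fun w => h i w ^+ 2 * z i w ^+ 2).
  by apply: measurable_funM; apply: measurable_funX; [exact: mh|exact: mz].
have hz0 w : 0 <= h i w ^+ 2 * z i w ^+ 2 by rewrite mulr_ge0// sqr_ge0.
apply: (le_lt_trans le); rewrite Ex_D//.
- rewrite !Ex_Z//; last 2 first.
    exact: measurable_funX.
    by move=> w; exact: sqr_ge0.
  rewrite lte_add_pinfty//.
    by rewrite lte_mul_pinfty//; apply: ih; exact: ltnW.
  rewrite lte_mul_pinfty// Ehz// lte_mul_pinfty//.
  + by apply: Ex_ge0 => w; exact: sqr_ge0.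
  + rewrite ge0_fin_numE; [exact: h_sqr|by apply: Ex_ge0 => w; exact: sqr_ge0].
  + exact: z_sqr.
- by apply: measurable_funM => //; exact: measurable_funX.
- by move=> w; rewrite mulr_ge0// sqr_ge0.
- exact: measurable_funM.
- by move=> w; rewrite mulr_ge0.
Qed.

Let rmax_sqr i : (i <= n)%N -> (E (fun w => rmax (J w) i ^+ 2)%R < +oo)%E.
Proof.
move=> lin.
apply: (@le_lt_trans _ _ (E (fun w => \sum_(k < i.+1) J w k ^+ 2)%R)).
  apply: Ex_le => w; first exact: sqr_ge0.
  exact: rmax_sqr_le_sum.
have -> : (fun w => \sum_(k < i.+1) J w k ^+ 2) =
  (fun w => \sum_(k <- index_enum 'I_i.+1) J w (minn k n) ^+ 2).
  apply/funext => w; apply: eq_bigr => k _; rewrite (minn_idPl _)//.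
  by rewrite (leq_trans _ lin)// -ltnS.
rewrite (@Ex_sum _ _ _ P _ _ (fun (k : 'I_i.+1) w => J w (minn k n) ^+ 2)).
- by apply/lte_sum_pinfty => k _; apply: J_sqr; exact: geq_minr.
- move=> k; apply: measurable_funX; apply: (mG (geq_minr k n)); apply: J_adapted.
  exact: geq_minr.
- by move=> k w; exact: sqr_ge0.
Qed.

(** The expectation of the pathwise inequality. The coefficient [xi i] is known at stage [i] and
    [z i] is centered and independent of that stage, so the signed sum has mean zero; the factor 4
    is Doob's constant. *)
Lemma doob_transform :
  (E (fun w => rmax (fun i => \sum_(j < i) h j w * z j w)%R n ^+ 2)%R <=
   \sum_(i < n) 4%:E * (E (fun w => h i w ^+ 2)%R * E (fun w => z i w ^+ 2)%R))%E.
Proof.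
pose xi i w := (8 * J w i - 4 * (rmax (J w) i * Num.sg (J w i))) * h i w.
have xi_adapted i : (i < n)%N -> adapted_to (G i) (xi i).
  move=> lin; have li := ltnW lin.
  apply: measurable_funM; last exact: h_adapted.
  apply: measurable_funB; first by apply: measurable_funM => //; exact: J_adapted.
  apply: measurable_funM => //; apply: measurable_funM; first exact: rmax_adapted.
  by apply: measurableT_comp; [exact: measurable_sgr|exact: J_adapted].
have key i : (i < n)%N -> P.-integrable setT (EFin \o (fun w => xi i w * z i w)) /\
    E (fun w => xi i w * z i w) = 0%E.
  move=> lin; have li := ltnW lin; apply: Ex_indepM_eq0.
  - exact: mG (xi_adapted i lin).
  - exact: mz.
  (* [12 = 8 + 4]: the current value is at most the running maximum and a sign is at most 1. The
     bound is a product of two square integrable variables. *)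
  - have le : (E (fun w => `|xi i w|)%R <= E (fun w => 12 * `|rmax (J w) i * h i w|)%R)%E.
      apply: Ex_le => // w; rewrite /xi !normrM [leRHS]mulrA ler_wpM2r//.
      rewrite (ger0_norm (rmax_ge0 _ _)).
      have h1 := le_rmax (J w) (leqnn i); have M0 := rmax_ge0 (J w) i.
      apply: (le_trans (ler_normB _ _)); rewrite !normrM (ger0_norm M0) !normr_nat.
      have : `|Num.sg (J w i)| <= 1 by rewrite normr_sg; case: (J w i != 0).
      move: `|J w i| `|Num.sg _| (rmax _ _) (normr_ge0 (Num.sg (J w i))) M0 h1 => a b M.
      by nra.
    have mM := mG li (rmax_adapted li).
    apply: (le_lt_trans le); rewrite Ex_Z//.
      rewrite lte_mul_pinfty//; apply: Ex_prod_integrable => //.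
      + exact: mh.
      + exact: rmax_sqr.
      + exact: h_sqr.
    by apply: measurableT_comp => //; apply: measurable_funM => //; exact: mh.
  - by apply: Ex_sqr_integrable; [exact: mz|exact: z_sqr].
  - exact: z_mean.
  - by apply: (adapted_indep2 (G_sig li)); [exact: xi_adapted|exact: z_indep].
have iB : P.-integrable setT (EFin \o (fun w => \sum_(i < n) xi i w * z i w)).
  apply: (@eq_integrable _ _ _ P _ measurableT
    (fun w => \sum_(i < n) (xi i w * z i w)%:E)%E).
    by move=> w _; rewrite /= sumEFin.
  by apply: integrable_sum => // i _; have [] := key i (ltn_ord i).
have EB : E (fun w => \sum_(i < n) xi i w * z i w) = 0%E.
  rewrite /Ex; under eq_integral do rewrite -sumEFin.
  rewrite integral_sum//.
    by rewrite big1// => i _; have [] := key i (ltn_ord i).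
  by move=> i; have [] := key i (ltn_ord i).
have mhz (i : 'I_n) : measurable_fun setT (fun w => h i w ^+ 2 * z i w ^+ 2).
  by apply: measurable_funM; apply: measurable_funX; [exact: mh|exact: mz].
have hz0 i w : 0 <= h i w ^+ 2 * z i w ^+ 2 by rewrite mulr_ge0// sqr_ge0.
apply: (@le_trans _ _ (E (fun w => \sum_(i < n) 4 * (h i w ^+ 2 * z i w ^+ 2))%R)).
  apply: (Ex_le_addmean0 _ _ _ _ iB EB).
  - by apply: measurable_funX; exact: mG (rmax_adapted (leqnn n)).
  - by apply: measurable_sum => i; exact: measurable_funM.
  - by move=> w; exact: sqr_ge0.
  - by move=> w; apply: sumr_ge0 => i _; rewrite mulr_ge0.
  - move=> w; apply: (@rmax_transform_le _ (J w) (h ^~ w) (z ^~ w)).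
      by rewrite /J big_ord0.
    by move=> i _; rewrite /J big_ord_recr.
rewrite (@Ex_sum _ _ _ P _ _ (fun (i : 'I_n) w => 4 * (h i w ^+ 2 * z i w ^+ 2))).
- by apply: lee_sum => i _; rewrite Ex_Z// Ehz.
- by move=> i; exact: measurable_funM.
- by move=> i w; rewrite mulr_ge0.
Qed.

End doob.

(** * Brownian increments *)

Section brownian_increments.
Context d (Om : measurableType d) (R : realType) (P : probability Om R).
Variables (F : R -> set (set Om)) (W : R -> Om -> R).
Hypotheses (usual : usual_filtration P F) (bm : brownian_motion P F W).
Local Notation E := (Ex P).

Lemma bm_measurable t : 0 <= t -> measurable_fun setT (W t).
Proof.
move=> t0; apply: (@adapted_measurable _ _ _ (F t)); first exact: (filt_sub usual).
exact: sub_measurable_adapted (bm_adapted bm t0).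
Qed.

Lemma bm_increment_measurable (s t : R) : 0 <= s -> s <= t ->
  measurable_fun setT (fun w => W t w - W s w).
Proof.
move=> s0 st; apply: measurable_funB; apply: bm_measurable => //.
exact: le_trans st.
Qed.

Lemma Ex_bm_increment (s t : R) (phi : R -> R) : 0 <= s -> s < t ->
  measurable_fun setT phi -> (forall x, 0 <= phi x) ->
  E (fun w => phi (W t w - W s w)) =
  (\int[normal_prob 0 (Num.sqrt (t - s))]_x (phi x)%:E)%E.
Proof.
move=> s0 st mphi phi0.
have mW := bm_increment_measurable s0 (ltW st).
pose X : {mfun Om >-> measurableTypeR R} :=
  @mfun_Sub _ _ Om (measurableTypeR R) _ (mem_set mW).
transitivity (\int[distribution P X]_x (phi x)%:E)%E.
  by rewrite ge0_integral_distribution//; exact/measurable_EFinP.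
apply: eq_measure_integral => A mA _.
exact: (bm_gaussian bm s0 st).
Qed.

Let sqr_sqrt (s t : R) : s < t -> Num.sqrt (t - s) ^+ 2 = t - s.
Proof. by move=> st; rewrite sqr_sqrtr// subr_ge0 ltW. Qed.

Let sqrt_neq0 (s t : R) : s < t -> Num.sqrt (t - s) != 0.
Proof. by move=> st; rewrite gt_eqF// sqrtr_gt0 subr_gt0. Qed.

Lemma Ex_increment_sqr (s t : R) : 0 <= s -> s <= t ->
  E (fun w => (W t w - W s w) ^+ 2) = (t - s)%:E.
Proof.
move=> s0; rewrite le_eqVlt => /predU1P[->|st].
  by under eq_fun do rewrite subrr expr0n/=; rewrite Ex_cst subrr.
rewrite (@Ex_bm_increment s t (fun x => x ^+ 2))//; last by move=> x; exact: sqr_ge0.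
by rewrite normal_moment2 ?sqr_sqrt// sqrt_neq0.
Qed.

Lemma Ex_increment_pow4 (s t : R) : 0 <= s -> s <= t ->
  (E (fun w => (W t w - W s w) ^+ 4)%R <= (3 * (t - s) ^+ 2)%:E)%E.
Proof.
move=> s0; rewrite le_eqVlt => /predU1P[->|st].
  by under eq_fun do rewrite subrr expr0n/=; rewrite Ex_cst subrr expr0n/= mulr0.
rewrite (@Ex_bm_increment s t (fun x => x ^+ 4))//.
  apply: (le_trans (normal_moment4 (sqrt_neq0 st))).
  by rewrite (exprM _ 2 2) sqr_sqrt.
by move=> x; rewrite (exprM x 2 2) sqr_ge0.
Qed.

Lemma Ex_increment_pow6 (s t : R) : 0 <= s -> s <= t ->
  (E (fun w => (W t w - W s w) ^+ 6)%R <= (15 * (t - s) ^+ 3)%:E)%E.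
Proof.
move=> s0; rewrite le_eqVlt => /predU1P[->|st].
  by under eq_fun do rewrite subrr expr0n/=; rewrite Ex_cst subrr expr0n/= mulr0.
rewrite (@Ex_bm_increment s t (fun x => x ^+ 6))//.
  apply: (le_trans (normal_moment6 (sqrt_neq0 st))).
  by rewrite (exprM _ 2 3) sqr_sqrt.
by move=> x; rewrite (exprM x 2 3) exprn_ge0// sqr_ge0.
Qed.

Lemma Ex_increment_mean (s t : R) : 0 <= s -> s <= t ->
  E (fun w => W t w - W s w) = 0%E.
Proof.
move=> s0; rewrite le_eqVlt => /predU1P[->|st].
  by under eq_fun do rewrite subrr; rewrite Ex_cst.
have mW := bm_increment_measurable s0 (ltW st).
set X := fun w => W t w - W s w.
have iX : P.-integrable setT (EFin \o X).
  apply/Ex_lty_integrable => //; apply: Ex_sqr_integrable => //.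
  by rewrite (Ex_increment_sqr s0 (ltW st)) ltry.
have EP : E (X^\+)%R = E (X^\-)%R.
  rewrite /funrpos /funrneg /X.
  rewrite (@Ex_bm_increment s t (fun x => Num.max x 0))//.
  - rewrite (@Ex_bm_increment s t (fun x => Num.max (- x) 0))//.
    + exact: (normal_mean_posneg (sqrt_neq0 st)).
    + by apply: measurable_maxr => //; exact: oppr_measurable.
    + by move=> x; rewrite le_max lexx orbT.
  - exact: measurable_maxr.
  - by move=> x; rewrite le_max lexx orbT.
rewrite /Ex.
have -> : (fun w => (X w)%:E) = (fun w => ((X^\+)%R w)%:E - ((X^\-)%R w)%:E)%E.
  by apply/funext => w; rewrite -EFinB; have /(congr1 (fun f => f w)) <- := funrposBneg X.
have ip := integrable_funrpos measurableT iX.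
have iN := integrable_funrneg measurableT iX.
rewrite integralB_EFin//; move: EP; rewrite /Ex => ->.
by rewrite subee//; exact: integrable_fin_num.
Qed.

Lemma Ex_increment_sqr_centered (s t : R) : 0 <= s -> s <= t ->
  E (fun w => (W t w - W s w) ^+ 2 - (t - s)) = 0%E.
Proof.
move=> s0 st; rewrite /Ex.
have mW := bm_increment_measurable s0 st.
under eq_integral do rewrite EFinB.
rewrite integralB_EFin//; last 2 first.
- apply/Ex_lty_integrable; first exact: measurable_funX.
  under eq_fun do rewrite ger0_norm ?sqr_ge0//.
  by rewrite Ex_increment_sqr// ltry.
- exact: finite_measure_integrable_cst.
have := Ex_increment_sqr s0 st; rewrite /Ex => ->.
by have := Ex_cst P (t - s); rewrite /Ex => ->; rewrite subee.
Qed.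

Lemma Ex_increment_sqr_centered_sqr (s t : R) : 0 <= s -> s <= t ->
  (E (fun w => ((W t w - W s w) ^+ 2 - (t - s)) ^+ 2)%R <= (8 * (t - s) ^+ 2)%:E)%E.
Proof.
move=> s0 st; have mW := bm_increment_measurable s0 st.
(* With the fourth moment bound, [2 * 3 + 2] is the announced constant 8. *)
apply: (@le_trans _ _ (E (fun w => 2 * (W t w - W s w) ^+ 4 + 2 * (t - s) ^+ 2)%R)).
  apply: Ex_le => w; first exact: sqr_ge0.
  set a := W t w - W s w; have := sqr_ge0 (a ^+ 2 + (t - s)).
  by rewrite (exprM a 2 2); nra.
have p4 (x : R) : 0 <= x ^+ 4 by rewrite (exprM x 2 2) sqr_ge0.
rewrite Ex_D//; last 3 first.
- by apply: measurable_funM => //; exact: measurable_funX.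
- by move=> w; rewrite mulr_ge0.
- by move=> w; rewrite mulr_ge0 ?sqr_ge0.
rewrite Ex_Z//; last exact: measurable_funX.
rewrite Ex_cst.
apply: (@le_trans _ _ (2%:E * (3 * (t - s) ^+ 2)%:E + (2 * (t - s) ^+ 2)%:E)%E).
  by rewrite leeD2r// lee_wpmul2l//; exact: Ex_increment_pow4.
by rewrite -EFinM -EFinD lee_fin le_eqVlt; apply/orP; left; apply/eqP; ring.
Qed.

Lemma bm_increment_adapted (s t : R) : 0 <= s -> s <= t ->
  adapted_to (F t) (fun w => W t w - W s w).
Proof.
move=> s0 st; apply: measurable_funB.
  by apply: sub_measurable_adapted; apply: (bm_adapted bm); exact: le_trans st.
apply: (adapted_sub (filt_mono usual s0 st)); apply: sub_measurable_adapted.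
exact: (bm_adapted bm).
Qed.

End brownian_increments.

(** * Partitions and step functions *)

Section partitions.
Context {R : realType}.
Local Notation mu := (@lebesgue_measure R).
Implicit Types (t : R) (p : nat) (u x v tau : nat -> R).

(** Repeated points are allowed, so that a partition can be read off a sorted list without removing
    duplicates. The lemmas below therefore deal with cells of length zero. *)
Record is_partition t p u : Prop := {
  part_first : u 0%N = 0 ;
  part_last : u p = t ;
  part_mono : forall j, (j < p)%N -> u j <= u j.+1 }.

Definition part_point p u (c : R) := exists2 i, (i <= p)%N & c = u i.

Lemma part_le t p u i j : is_partition t p u -> (i <= j)%N -> (j <= p)%N ->
  u i <= u j.
Proof.
move=> pu; elim: j => [|j ih]; first by rewrite leqn0 => /eqP->.
rewrite leq_eqVlt => /predU1P[->//|ij] jp.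
by apply: le_trans (part_mono pu jp); apply: ih => //; exact: ltnW.
Qed.

Lemma part_itv t p u i : is_partition t p u -> (i <= p)%N -> 0 <= u i <= t.
Proof.
move=> pu ip; rewrite -(part_first pu) -(part_last pu) !(part_le pu)//.
Qed.

Lemma part_pointP t p u c j : is_partition t p u -> part_point p u c -> (j < p)%N ->
  c <= u j \/ u j.+1 <= c.
Proof.
move=> pu [i ip ->] jp; have [ij|ji] := leqP i j; [left|right].
  by apply: (part_le pu) => //; exact: ltnW.
exact: (part_le pu).
Qed.

(** Sorting the requested points gives a common refinement. It lets the grid of the scheme, the jump
    times of a simple process, a fine mesh and the times of observation live on one partition. *)
Lemma part_exists t (s : seq R) : 0 <= t -> exists p u, is_partition t p u /\
  (forall c, c \in s -> 0 <= c <= t -> part_point p u c).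
Proof.
move=> t0; pose l := sort <=%R (0 :: t :: [seq c <- s | 0 <= c <= t]).
have sl : sorted <=%R l by apply: sort_sorted; exact: le_total.
have ml c : (c \in l) = (c \in 0 :: t :: [seq c <- s | 0 <= c <= t]).
  by rewrite mem_sort.
have lt c : c \in l -> 0 <= c <= t.
  rewrite ml !inE mem_filter => /or3P[/eqP->|/eqP->|/andP[]//].
    by rewrite lexx.
  by rewrite t0 lexx.
have szl : (0 < size l)%N by rewrite size_sort.
have nl i : (i < size l)%N -> 0 <= nth 0 l i <= t by move=> il; apply: lt; exact: mem_nth.
have mono i j : (i <= j)%N -> (j < size l)%N -> nth 0 l i <= nth 0 l j.
  move=> ij jl; apply: (sorted_leq_nth le_trans) => //.
  by rewrite inE (leq_ltn_trans ij).
have pp c : c \in l -> part_point (size l).-1 (nth 0 l) c.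
  move=> cl; exists (index c l); last by rewrite nth_index.
  by rewrite -ltnS prednK// index_mem.
exists (size l).-1, (nth 0 l); split.
  split.
  - have [i il e] : part_point (size l).-1 (nth 0 l) 0 by apply: pp; rewrite ml inE eqxx.
    apply/eqP; rewrite eq_le; apply/andP; split; last by have /andP[] := nl _ szl.
    have il' : (i < size l)%N by rewrite -ltnS prednK in il.
    by apply: le_trans (mono 0%N i (leq0n _) il') _; rewrite -e.
  - have [i il e] : part_point (size l).-1 (nth 0 l) t by apply: pp; rewrite ml !inE eqxx orbT.
    have lp : ((size l).-1 < size l)%N by rewrite prednK.
    apply/eqP; rewrite eq_le; apply/andP; split; first by have /andP[] := nl _ lp.
    by rewrite [leLHS]e; apply: mono.
  - by move=> j jp; apply: mono => //; rewrite -ltn_predRL.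
by move=> c cs c0; apply: pp; rewrite ml !inE mem_filter cs c0 !orbT.
Qed.

(* Points of the grid of mesh [t / m.+1] bound the mesh of every refinement. *)
Lemma part_mesh t p u (m : nat) j : is_partition t p u -> (j < p)%N ->
  (forall k, (k <= m)%N -> part_point p u (t * k.+1%:R / m.+1%:R)) ->
  u j.+1 - u j <= t / m.+1%:R.
Proof.
move=> pu jp um; rewrite leNgt; apply/negP => lt.
have /andP[uj0 ujt] := part_itv pu (ltnW jp).
have /andP[_ uSt] := part_itv pu jp.
have t0 : 0 < t.
  rewrite lt_neqAle (le_trans uj0 ujt) andbT; apply/eqP => t0.
  by move: lt; rewrite -t0 mul0r subr_gt0 => lt; move: uSt uj0; rewrite -t0; lra.
have m0 : 0 < m.+1%:R :> R by [].
(* The index with [t * k / m.+1 <= u j < t * k.+1 / m.+1]. A cell longer than [t / m.+1] would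
   contain the next mesh point strictly inside, although that point belongs to the partition. *)
pose k := Num.trunc (u j * m.+1%:R / t).
have z0 : 0 <= u j * m.+1%:R / t by rewrite divr_ge0 ?mulr_ge0// ltW.
have /andP[k1 k2] := truncn_itv z0.
rewrite -/k in k1 k2.
have c1 : u j < t * k.+1%:R / m.+1%:R.
  by rewrite ltr_pdivlMr// [ltRHS]mulrC -ltr_pdivrMr.
have c2 : t * k.+1%:R / m.+1%:R < u j.+1.
  have : t * k%:R / m.+1%:R <= u j.
    by rewrite ler_pdivrMr// [leLHS]mulrC -ler_pdivlMr.
  have -> : t * k.+1%:R / m.+1%:R = t * k%:R / m.+1%:R + t / m.+1%:R.
    by rewrite -[k.+1%:R]natr1 mulrDr mulr1 mulrDl.
  by move: lt; set A := t / _; set B := t * _ / _; lra.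
have km : (k <= m)%N.
  rewrite leqNgt; apply/negP => mk.
  have : t <= t * k.+1%:R / m.+1%:R.
    by rewrite -mulrA ler_peMr ?(ltW t0)// ler_pdivlMr// mul1r ler_nat leqW.
  by move=> /(le_lt_trans)/(_ c2); rewrite ltNge uSt.
have [h|h] := part_pointP pu (um _ km) jp.
  by move: (lt_le_trans c1 h); rewrite ltxx.
by move: (le_lt_trans h c2); rewrite ltxx.
Qed.

Lemma part_telescope t p u (x : R -> R) i c : is_partition t p u ->
  (i <= p)%N -> part_point p u c -> c <= u i ->
  \sum_(j < i) (u j < c)%R%:R * (x (u j.+1) - x (u j)) = x c - x 0.
Proof.
move=> pu ip cp ci.
have H k : (k <= i)%N -> \sum_(j < k) (u j < c)%R%:R * (x (u j.+1) - x (u j)) =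
    x (Num.min c (u k)) - x 0.
  elim: k => [_|k ih ki].
    have c0 : 0 <= c by case: cp => l lp ->; have /andP[] := part_itv pu lp.
    by rewrite big_ord0 (part_first pu) (min_idPr c0) subrr.
  rewrite big_ord_recr/= ih; last exact: ltnW.
  have kp : (k < p)%N by exact: leq_trans ip.
  have kk := part_mono pu kp.
  have [h|h] := part_pointP pu cp kp.
    by rewrite ltNge h mul0r addr0 (min_idPl h) (min_idPl (le_trans h kk)).
  rewrite (min_idPr h) (min_idPr (le_trans kk h)).
  have [lt|ge] := ltP (u k) c; first by rewrite mul1r; ring.
  have -> : u k.+1 = u k by apply/eqP; rewrite eq_le kk (le_trans h ge).
  by rewrite mul0r addr0.
by rewrite H// (min_idPl ci).
Qed.

(** [simple_value] is this expression for the data of a simple process, and the coefficients of the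
    scheme are this expression on its grid, so both are handled by the same refinement lemmas. *)
Definition step_value n tau v (s : R) : R :=
  \sum_(k < n) v k * \1_(`[tau k, tau k.+1[%classic) s.

(** Each increment of [x] between jump times telescopes over the cells; after exchanging the sums,
    the coefficient on a cell is the value of the step function at its left end. Integrals of
    different step functions can then be subtracted cell by cell. *)
Lemma step_integral_refine t p u n tau v (x : R -> R) i : is_partition t p u ->
  (forall k, (k <= n)%N -> 0 <= tau k) ->
  (forall k, (k < n)%N -> tau k <= tau k.+1) ->
  (forall k, (k <= n)%N -> tau k <= t -> part_point p u (tau k)) ->
  (i <= p)%N ->
  step_integral n tau v x (u i) =
  \sum_(j < i) step_value n tau v (u j) * (x (u j.+1) - x (u j)).
Proof.
move=> pu tau0 taum taup ip.
have pp k : (k <= n)%N -> part_point p u (Num.min (u i) (tau k)).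
  move=> kn; have [h|h] := leP (u i) (tau k); first by exists i.
  apply: taup => //; apply: (le_trans (ltW h)).
  by have /andP[] := part_itv pu ip.
have mini k : Num.min (u i) (tau k) <= u i by rewrite ge_min lexx.
have tele k (kn : (k <= n)%N) := part_telescope x pu ip (pp k kn) (mini k).
rewrite /step_integral /step_value.
transitivity (\sum_(k < n) \sum_(j < i) v k *
   (((u j < Num.min (u i) (tau k.+1))%R%:R - (u j < Num.min (u i) (tau k))%R%:R) *
     (x (u j.+1) - x (u j)))).
  apply: eq_bigr => k _; rewrite -mulr_sumr; congr (_ * _).
  transitivity ((x (Num.min (u i) (tau k.+1)) - x 0) - (x (Num.min (u i) (tau k)) - x 0)).
    by ring.
  rewrite -!tele//; last exact: ltnW.
  by rewrite -sumrB; apply: eq_bigr => j _; rewrite mulrBl.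
rewrite exchange_big/=; apply: eq_bigr => j _; rewrite mulr_suml.
apply: eq_bigr => k _; rewrite -mulrA; congr (_ * _).
(* A cell of length zero contributes nothing. It is set aside because otherwise [u j] might equal
   [u i], and the comparison with [u i] would lose the cell. *)
have [<-|ne] := eqVneq (u j) (u j.+1); first by rewrite subrr !mulr0.
congr (_ * _).
have uji : u j < u i.
  have jp : (j < p)%N by exact: leq_trans ip.
  have h : u j < u j.+1 by rewrite lt_neqAle ne (part_mono pu jp).
  by apply: (lt_le_trans h); apply: (part_le pu).
rewrite !lt_min uji/= indicE mem_setE in_itv/=.
have km := taum k (ltn_ord k).
have [a|a] := ltP (u j) (tau k).
  by rewrite (lt_le_trans a km) subrr.
by rewrite subr0.
Qed.

Lemma step_value_const t p u n tau v j (s : R) : is_partition t p u ->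
  (forall k, (k <= n)%N -> tau k <= t -> part_point p u (tau k)) ->
  (j < p)%N -> u j <= s -> s < u j.+1 ->
  step_value n tau v s = step_value n tau v (u j).
Proof.
move=> pu taup jp js sj; apply: eq_bigr => k _; congr (_ * _).
have st : s < t by apply: (lt_le_trans sj); have /andP[] := part_itv pu jp.
have key l : (l <= n)%N -> (tau l <= s) = (tau l <= u j).
  move=> ln; apply/idP/idP => h; last exact: le_trans js.
  have [//|h'] := part_pointP pu (taup l ln (le_trans h (ltW st))) jp.
  by move: (lt_le_trans sj h'); rewrite ltNge h.
rewrite !indicE !mem_setE !in_itv/= key; last exact: ltnW.
by rewrite ![_ < tau k.+1]ltNge key.
Qed.

Lemma part_integral t p u (f : R -> \bar R) : is_partition t p u ->
  measurable_fun (`[0, t]) f -> (forall y : R, 0 <= y <= t -> (0 <= f y)%E) ->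
  (\sum_(j < p) \int[mu]_(x in `[u j, (u j.+1)[) f x = \int[mu]_(x in `[0%R, t]) f x)%E.
Proof.
move=> pu mf f0.
have sub i : (i <= p)%N -> `[0, u i[ `<=` `[0, t].
  move=> ip x /=; rewrite !in_itv/= => /andP[-> /ltW h] /=; apply: (le_trans h).
  by have /andP[] := part_itv pu ip.
have H i : (i <= p)%N ->
   (\sum_(j < i) \int[mu]_(x in `[u j, (u j.+1)[) f x = \int[mu]_(x in `[0%R, (u i)[) f x)%E.
  elim: i => [_|i ih ip].
    by rewrite big_ord0 (part_first pu) set_itvco0 integral_set0.
  rewrite big_ord_recr/= ih; last exact: ltnW.
  have /andP[ui0 uit] := part_itv pu (ltnW ip).
  have uu := part_mono pu ip.
  have e : `[0, (u i.+1)[%classic = `[0, (u i)[ `|` `[u i, (u i.+1)[ :> set R.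
    apply/seteqP; split => x /=; rewrite !in_itv/=.
      move=> /andP[x0 xi]; have [h|h] := ltP x (u i); [left|right];
      by rewrite ?x0 ?xi ?h.
    by move=> [] /andP[h1 h2]; rewrite ?h1 ?h2 ?(lt_le_trans h2 uu) ?(le_trans ui0 h1).
  rewrite e ge0_integral_setU//.
  - apply: measurable_funS mf; rewrite -?e//; exact: sub.
  - by move=> x; rewrite -e => /(sub _ ip)/=; rewrite in_itv/=; exact: f0.
  - apply/disj_setPS => x [] /=; rewrite !in_itv/= => /andP[_ h] /andP[h' _].
    by move: (lt_le_trans h h'); rewrite ltxx.
rewrite H// (part_last pu) integral_itv_bndo_bndc//.
by apply: measurable_funS mf => // x /=; rewrite !in_itv/= => /andP[-> /ltW].
Qed.

End partitions.

(** * Discrete stochastic integrals *)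

Section time_integral.
Context d (Om : measurableType d) (R : realType) (P : probability Om R).
Local Notation mu := (@lebesgue_measure R).
Variables (A : set R) (phi : R -> Om -> \bar R).
Hypotheses (mA : measurable A)
  (mphi : measurable_fun (A `*` setT) (fun z : R * Om => phi z.1 z.2))
  (phi0 : forall u w, A u -> (0 <= phi u w)%E).

(** Extension by zero: processes are jointly measurable on a time interval only, while the theorems
    of Fubini and Tonelli are used on the whole product. *)
Let psi (z : R * Om) : \bar R := ((fun z : R * Om => phi z.1 z.2) \_ (A `*` setT)) z.

Let mpsi : measurable_fun setT (psi : measurableTypeR R * Om -> \bar R).
Proof.
by apply/(measurable_restrictT _ _).1 => //; exact: measurableX.
Qed.

Let psi0 z : (0 <= psi z)%E.
Proof.
rewrite /psi patchE; case: ifPn => // /set_mem[/= Az _].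
exact: phi0.
Qed.

Let psiE u w : psi (u, w) = ((fun u => phi u w) \_ A) u.
Proof.
by rewrite /psi !patchE in_setX/= in_setT andbT.
Qed.

Lemma measurable_section w : measurable_fun A (phi ^~ w).
Proof.
apply/(measurable_restrictT (phi ^~ w) mA).
have h := measurableT_comp mpsi (@measurable_pair2 _ _ (measurableTypeR R) Om w).
have e : psi \o pair^~ w = (fun u => phi u w) \_ A.
  by apply/funext => u /=; rewrite psiE.
by rewrite e in h => mD Y mY; exact: (h mD Y mY).
Qed.

Lemma measurable_time_integral :
  measurable_fun setT (fun w => (\int[mu]_(u in A) phi u w)%E).
Proof.
have := @measurable_fun_fubini_tonelli_G _ _ (measurableTypeR R) Om R mu psi mpsi psi0.
apply: eq_measurable_fun => w _; rewrite [RHS]integral_mkcond /fubini_G.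
by apply: eq_integral => u _; rewrite psiE.
Qed.

Let slice u : (\int[P]_w psi (u, w) = ((fun u => \int[P]_w phi u w) \_ A) u)%E.
Proof.
under eq_integral do rewrite psiE patchE.
by rewrite patchE; case: ifPn => // _; rewrite integral0.
Qed.

Lemma measurable_space_integral :
  measurable_fun A (fun u => (\int[P]_w phi u w)%E).
Proof.
apply/(measurable_restrictT (fun u => \int[P]_w phi u w)%E mA).
have h := @measurable_fun_fubini_tonelli_F _ _ (measurableTypeR R) Om R P psi mpsi psi0.
have e : @fubini_F _ _ (measurableTypeR R) Om R P psi = (fun u => \int[P]_w phi u w)%E \_ A.
  by apply/funext => u; rewrite -slice.
by rewrite e in h => mD Y mY; exact: (h mD Y mY).
Qed.

Lemma time_space_tonelli : (\int[P]_w \int[mu]_(u in A) phi u w =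
  \int[mu]_(u in A) \int[P]_w phi u w)%E.
Proof.
have := @fubini_tonelli _ _ (measurableTypeR R) Om R mu P psi mpsi psi0.
move=> h; transitivity (\int[P]_w \int[mu]_u psi (u, w))%E.
  apply: eq_integral => w _; rewrite integral_mkcond.
  by apply: eq_integral => u _; rewrite psiE.
rewrite -h [RHS]integral_mkcond; apply: eq_integral => u _.
exact: slice.
Qed.

End time_integral.

Section ito_simple.
Context d (Om : measurableType d) (R : realType) (P : probability Om R).
Variables (F : R -> set (set Om)) (W : R -> Om -> R).
Hypotheses (usual : usual_filtration P F) (bm : brownian_motion P F W).
Local Notation E := (Ex P).
Variables (t : R) (p : nat) (u : nat -> R).
Hypothesis pu : is_partition t p u.

Let u0 j : (j <= p)%N -> 0 <= u j.
Proof. by move=> jp; have /andP[] := part_itv pu jp. Qed.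

Definition part_sum (a : nat -> Om -> R) (w : Om) (i : nat) : R :=
  \sum_(j < i) a j w * (W (u j.+1) w - W (u j) w).

(** The bracket of the discrete martingale [part_sum]. Its value at [i.+1] only involves
    coefficients with index at most [i], so it is known at time [u i]; Lenglart's argument rests on
    this. *)
Definition part_energy (a : nat -> Om -> R) (w : Om) (i : nat) : R :=
  \sum_(j < i) a j w ^+ 2 * (u j.+1 - u j).

Lemma part_energy_ge0 a w i : (i <= p)%N -> 0 <= part_energy a w i.
Proof.
move=> ip; apply: sumr_ge0 => j _; rewrite mulr_ge0 ?sqr_ge0// subr_ge0.
by apply: (part_mono pu); exact: leq_trans ip.
Qed.

Variable a : nat -> Om -> R.
Hypothesis a_adapted : forall j, (j < p)%N -> adapted_to (F (u j)) (a j).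

Let ma j : (j < p)%N -> measurable_fun setT (a j).
Proof.
move=> jp; apply: adapted_measurable (a_adapted jp).
by apply: (filt_sub usual); apply: u0; exact: ltnW.
Qed.

Lemma measurable_part_energy i : (i <= p)%N -> measurable_fun setT (part_energy a ^~ i).
Proof.
move=> ip; apply: measurable_sum => j; apply: measurable_funM => //.
by apply: measurable_funX; apply: ma; exact: leq_trans ip.
Qed.

Lemma part_sum_adapted i : (i <= p)%N -> adapted_to (F (u i)) (part_sum a ^~ i).
Proof.
elim: i => [_|i ih ip].
  by rewrite /part_sum; under eq_fun do rewrite big_ord0; exact: measurable_cst.
rewrite /part_sum; under eq_fun do rewrite big_ord_recr/=.
have Fi := filt_mono usual (u0 (ltnW ip)) (part_mono pu ip).
apply: measurable_funD; first by apply: (adapted_sub Fi); apply: ih; exact: ltnW.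
apply: measurable_funM; first by apply: (adapted_sub Fi); exact: a_adapted.
exact: (bm_increment_adapted usual bm) (u0 (ltnW ip)) (part_mono pu ip).
Qed.

Lemma measurable_rmax_part_sum : measurable_fun setT (fun w => rmax (part_sum a w) p).
Proof.
have H i : (i <= p)%N -> measurable_fun setT (fun w => rmax (part_sum a w) i).
  have mS k : (k <= p)%N -> measurable_fun setT (fun w => `|part_sum a w k|).
    move=> kp; apply: measurableT_comp => //.
    apply: adapted_measurable (part_sum_adapted kp).
    by apply: (filt_sub usual); exact: u0.
  elim: i => [_|i ih ip] /=; first exact: mS.
  by apply: measurable_maxr; [apply: ih; exact: ltnW|exact: mS].
exact: H.
Qed.

Hypothesis a_sqr : forall j, (j < p)%N -> (E (fun w => a j w ^+ 2)%R < +oo)%E.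

Lemma doob_partition :
  (E (fun w => rmax (part_sum a w) p ^+ 2)%R <=
   4%:E * E (fun w => part_energy a w p)%R)%E.
Proof.
have := @doob_transform _ _ _ P (fun i => F (u i)) a
  (fun j w => W (u j.+1) w - W (u j) w) p.
have uS i : (i < p)%N -> u i <= u i.+1 := part_mono pu (j := i).
have ui i : (i < p)%N -> 0 <= u i by move=> ip; apply: u0; exact: ltnW.
move=> h; apply: (le_trans (h _ _ _ _ _ _ _ _ _)) => {h}.
- by move=> i ip; apply: (filt_sigma_algebra usual); exact: u0.
- by move=> i ip; apply: (filt_mono usual); [exact: ui|exact: uS].
- by move=> i ip; apply: (filt_sub usual); exact: u0.
- exact: a_adapted.
- by move=> i ip; apply: (bm_increment_adapted usual bm); [exact: ui|exact: uS].
- by move=> i ip A B FA mB; apply: (bm_independent bm) => //; [exact: ui|exact: uS].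
- by move=> i ip; apply: (Ex_increment_mean usual bm); [exact: ui|exact: uS].
- move=> i ip; rewrite (Ex_increment_sqr usual bm) ?ltry//; [exact: ui|exact: uS].
- exact: a_sqr.
rewrite /part_energy (@Ex_sum _ _ _ P _ _ (fun (j : 'I_p) w => a j w ^+ 2 * (u j.+1 - u j))).
- rewrite ge0_sume_distrr; last first.
    move=> j _; apply: Ex_ge0 => w; rewrite mulr_ge0 ?sqr_ge0// subr_ge0.
    exact: uS.
  apply: lee_sum => i _; rewrite (Ex_increment_sqr usual bm); [|exact: ui|exact: uS].
  under [X in (_ <= _ * Ex _ X)%E]eq_fun do rewrite mulrC.
  rewrite Ex_Z ?subr_ge0 ?uS//.
  + by rewrite [X in (_ * X <= _)%E]muleC.
  + by apply: measurable_funX; exact: ma.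
  + by move=> w; exact: sqr_ge0.
- by move=> j; apply: measurable_funM => //; apply: measurable_funX; exact: ma.
- by move=> j w; rewrite mulr_ge0 ?sqr_ge0// subr_ge0 uS.
Qed.

End ito_simple.

Lemma sqr_sum_le (R : realType) n (x : nat -> R) :
  (\sum_(i < n) x i) ^+ 2 <= n%:R * \sum_(i < n) x i ^+ 2.
Proof.
elim: n => [|[_|n ih]]; first by rewrite !big_ord0 expr0n/= mulr0.
  by rewrite !big_ord1 mul1r.
rewrite big_ord_recr [in leRHS]big_ord_recr/=.
move: ih; move: (\sum_(i < n.+1) x i) (\sum_(i < n.+1) x i ^+ 2) (x n.+1) => S Q y ih.
have n0 : 0 < n.+1%:R :> R by [].
rewrite -[n.+2%:R]natr1; move: (n.+1%:R) n0 ih => N N0 ih.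
rewrite -(ler_pM2l N0); have := sqr_ge0 (S - N * y).
by have := ler_wpM2l (ltW N0) ih; nra.
Qed.

(** Projection onto [[- K, K]]. The simple processes that approximate the Ito integrand need not
    respect its local bound; clipping restores that bound without increasing the distance to the
    integrand. *)
Definition clip (R : realType) (K x : R) : R := Num.max (- K) (Num.min K x).

Section clip.
Context {R : realType} (K : R) (K0 : 0 <= K).

Lemma clip_le x : `|clip K x| <= K.
Proof.
rewrite ler_norml /clip le_max lexx/= ge_max ge_min lexx/= andbT.
by apply: le_trans K0; rewrite oppr_le0.
Qed.

Lemma clip_dist x y : `|y| <= K -> `|y - clip K x| <= `|y - x|.
Proof.
rewrite ler_norml /clip => /andP[y1 y2].
have [h|h] := leP K x.
  rewrite (max_idPr _); last by lra.
  by rewrite !ler0_norm ?subr_le0//; lra.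
have [h'|h'] := leP (- K) x; first by [].
by rewrite !ger0_norm ?subr_ge0; lra.
Qed.

Lemma measurable_clip : measurable_fun setT (clip K).
Proof. by apply: measurable_maxr => //; apply: measurable_minr. Qed.

(** What clipping removes from [x] is its distance to the interval, hence at most its distance to
    any [y] inside. So the removed part is controlled by the approximation error. *)
Lemma clip_defect_le x y : `|y| <= K -> (x - clip K x) ^+ 2 <= (y - x) ^+ 2.
Proof.
rewrite ler_norml /clip => /andP[y1 y2].
have [h|h] := leP K x.
  rewrite (max_idPr _); last by lra.
  by nra.
have [h'|h'] := leP (- K) x; first by rewrite subrr expr0n/= sqr_ge0.
by nra.
Qed.

End clip.

(** * Energy of a step process compared with a time integral *)

Section path_energy.
Context {R : realType}.
Local Notation mu := (@lebesgue_measure R).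

Lemma step_sum_le_integral (t : R) (p : nat) (u c : nat -> R) (Phi : R -> \bar R) :
  is_partition t p u -> (forall j, (j < p)%N -> 0 <= c j) ->
  measurable_fun (`[0, t]) Phi -> (forall s, (0 <= Phi s)%E) ->
  (forall j s, (j < p)%N -> u j <= s -> s < u j.+1 -> ((c j)%:E <= Phi s)%E) ->
  ((\sum_(j < p) c j * (u j.+1 - u j))%:E <= \int[mu]_(s in `[0%R, t]) Phi s)%E.
Proof.
move=> pu c0 mPhi Phi0 cPhi.
rewrite -(part_integral pu mPhi)// -sumEFin; apply: lee_sum => -[j jp] _ /=.
have -> : ((c j * (u j.+1 - u j))%:E =
  \int[mu]_(s in `[u j, (u j.+1)[) (c j)%:E)%E.
  rewrite integral_cst//= lebesgue_measure_itv/= lte_fin.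
  have [_|ge] := ltP (u j) (u j.+1); first by rewrite -EFinB -EFinM.
  have -> : u j.+1 = u j by apply/eqP; rewrite eq_le ge (part_mono pu jp).
  by rewrite subrr mulr0 mule0.
have sub : `[u j, (u j.+1)[ `<=` `[0, t].
  move=> s /=; rewrite !in_itv/= => /andP[h1 h2].
  have /andP[a _] := part_itv pu (ltnW jp); have /andP[_ b] := part_itv pu jp.
  by rewrite (le_trans a h1) (le_trans (ltW h2) b).
apply: ge0_le_integral => //.
- by move=> s _; rewrite lee_fin c0.
- exact: measurable_funS mPhi.
by move=> s; rewrite /= in_itv/= => /andP[]; exact: cPhi.
Qed.

(* The only loss in passing from the left endpoints to the running time comes
   from the interval on which [g] switches off, whence the mesh term. *)
Lemma path_energy_le (t : R) (p : nat) (u : nat -> R) (psi eta H : R -> R)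
    (g : R -> bool) (B mesh : R) :
  is_partition t p u ->
  (forall j s, (j < p)%N -> u j <= s -> s < u j.+1 -> psi s = psi (u j)) ->
  (forall j s, (j < p)%N -> u j <= s -> s < u j.+1 -> eta s = eta (u j)) ->
  (forall s s', 0 <= s -> s <= s' -> s' <= t -> g s' -> g s) ->
  (forall j, (j < p)%N -> (psi (u j) - eta (u j)) ^+ 2 <= B) ->
  (forall j, (j < p)%N -> u j.+1 - u j <= mesh) ->
  0 <= B -> 0 <= mesh ->
  measurable_fun (`[0, t]) (fun s => ((psi s - H s) ^+ 2 * (g s)%:R)%:E) ->
  measurable_fun (`[0, t]) (fun s => ((H s - eta s) ^+ 2 * (g s)%:R)%:E) ->
  ((\sum_(j < p) (psi (u j) - eta (u j)) ^+ 2 * (g (u j))%:R * (u j.+1 - u j))%R%:E <=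
   2%:E * \int[mu]_(s in `[0%R, t]) ((psi s - H s) ^+ 2 * (g s)%:R)%R%:E +
   2%:E * \int[mu]_(s in `[0%R, t]) ((H s - eta s) ^+ 2 * (g s)%:R)%R%:E +
   (mesh * B)%R%:E)%E.
Proof.
move=> pu psiu etau gdec cB umesh B0 mesh0 mq mr.
set q := fun s => ((psi s - H s) ^+ 2 * (g s)%:R)%:E.
set r := fun s => ((H s - eta s) ^+ 2 * (g s)%:R)%:E.
have q0 s : (0 <= q s)%E by rewrite lee_fin mulr_ge0// sqr_ge0.
have r0 s : (0 <= r s)%E by rewrite lee_fin mulr_ge0// sqr_ge0.
pose c j := (psi (u j) - eta (u j)) ^+ 2.
have c0 j : 0 <= c j by exact: sqr_ge0.
have uS j : (j < p)%N -> 0 <= u j.+1 - u j by move=> jp; rewrite subr_ge0 (part_mono pu).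
have ut j : (j <= p)%N -> 0 <= u j <= t by exact: part_itv.
have gS j : (j < p)%N -> (g (u j.+1))%:R <= (g (u j))%:R :> R.
  move=> jp; rewrite ler_nat; case: (boolP (g (u j.+1))) => // h.
  have /andP[a _] := ut _ (ltnW jp); have /andP[_ b] := ut _ jp.
  by rewrite (gdec _ _ a (part_mono pu jp) b h).
pose Phi s := (2%:E * q s + 2%:E * r s)%E.
have mPhi : measurable_fun `[0, t] Phi.
  by apply: emeasurable_funD; apply: emeasurable_funM.
have Phi0 s : (0 <= Phi s)%E by rewrite adde_ge0// mule_ge0.
have intPhi : (2%:E * \int[mu]_(s in `[0%R, t]) q s + 2%:E * \int[mu]_(s in `[0%R, t]) r s =
    \int[mu]_(s in `[0%R, t]) Phi s)%E.
  rewrite ge0_integralD//; last 4 first.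
  - by move=> s _; rewrite mule_ge0.
  - exact: emeasurable_funM.
  - by move=> s _; rewrite mule_ge0.
  - exact: emeasurable_funM.
  by rewrite !ge0_integralZl.
(* With the switch read at the right end, it is on throughout the cell, and the difference of two
   step values is split through [H s] at every time of the cell. *)
have first : ((\sum_(j < p) c j * (g (u j.+1))%:R * (u j.+1 - u j))%:E <=
    \int[mu]_(s in `[0%R, t]) Phi s)%E.
  apply: (@step_sum_le_integral t p u (fun j => c j * (g (u j.+1))%:R)) => //.
    by move=> j jp; rewrite mulr_ge0.
  move=> j s jp js sj; have /andP[a _] := ut _ (ltnW jp); have /andP[_ b] := ut _ jp.
  rewrite /Phi /q /r -!EFinM -EFinD lee_fin /c (psiu _ _ jp js sj) (etau _ _ jp js sj).
  case: (boolP (g (u j.+1))) => [h|_]; last first.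
    by rewrite mulr0; apply: addr_ge0; rewrite mulr_ge0// mulr_ge0// sqr_ge0.
  rewrite (gdec _ _ (le_trans a js) (ltW sj) b h) !mulr1.
  set x := psi _; set y := eta _; set z := H s.
  by have := sqr_ge0 ((x - z) - (z - y)); nra.
(* The switch is monotone, so its decrements telescope to at most 1. The replacement of the right
   end by the left end thus costs a single cell. *)
have second : \sum_(j < p) c j * ((g (u j))%:R - (g (u j.+1))%:R) * (u j.+1 - u j) <= mesh * B.
  apply: (@le_trans _ _ (\sum_(j < p) (mesh * B) * ((g (u j))%:R - (g (u j.+1))%:R))).
    apply: ler_sum => j _; rewrite mulrAC ler_wpM2r ?subr_ge0 ?gS//.
    by rewrite mulrC ler_pM ?uS ?umesh ?cB.
  rewrite -mulr_sumr ler_piMr ?mulr_ge0//.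
  have -> : \sum_(j < p) ((g (u j))%:R - (g (u j.+1))%:R) = (g (u 0%N))%:R - (g (u p))%:R :> R.
    elim: (p) => [|k ih]; first by rewrite big_ord0 subrr.
    by rewrite big_ord_recr/= ih; ring.
  by case: (g (u 0%N)); case: (g (u p)) => /=; lra.
have -> : \sum_(j < p) (psi (u j) - eta (u j)) ^+ 2 * (g (u j))%:R * (u j.+1 - u j) =
    \sum_(j < p) c j * (g (u j.+1))%:R * (u j.+1 - u j) +
    \sum_(j < p) c j * ((g (u j))%:R - (g (u j.+1))%:R) * (u j.+1 - u j).
  by rewrite -big_split/=; apply: eq_bigr => j _; rewrite -/(c j); ring.
by rewrite intPhi EFinD leeD.
Qed.

End path_energy.

Section step_processes.
Context d (Om : measurableType d) (R : realType) (P : probability Om R).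
Variables (F : R -> set (set Om)).
Hypothesis usual : usual_filtration P F.
Variables (n : nat) (tau : nat -> R) (v : nat -> Om -> R).

Lemma step_value_adapted s : 0 <= s ->
  (forall k, (k < n)%N -> 0 <= tau k) ->
  (forall k, (k < n)%N -> adapted_to (F (tau k)) (v k)) ->
  adapted_to (F s) (fun w => step_value n tau (v ^~ w) s).
Proof.
move=> s0 tau0 vF; apply: measurable_sum => k.
have [h|h] := leP (tau k) s.
  apply: measurable_funM => //; apply: (adapted_sub (filt_mono usual (tau0 _ _) h)) => //.
  exact: vF.
rewrite indicE mem_setE in_itv/= leNgt h/=.
by under eq_fun do rewrite mulr0; exact: measurable_cst.
Qed.

Lemma measurable_step_value : (forall k, (k < n)%N -> measurable_fun setT (v k)) ->
  measurable_fun setT (fun z : R * Om => step_value n tau (v ^~ z.2) z.1).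
Proof.
move=> mv; apply: measurable_sum => k; apply: measurable_funM.
  by apply: measurableT_comp => //; exact: mv.
have mI : measurable_fun setT (\1_(`[tau k, tau k.+1[%classic) : R -> R).
  exact: measurable_indic.
exact: (measurableT_comp mI measurable_fst).
Qed.

Lemma step_value_sqr_le s w :
  step_value n tau (v ^~ w) s ^+ 2 <= n%:R * \sum_(k < n) v k w ^+ 2.
Proof.
apply: (le_trans (sqr_sum_le _ (fun k => v k w * \1_(`[tau k, tau k.+1[%classic) s))).
apply: ler_wpM2l => //; apply: ler_sum => k _; rewrite exprMn.
by rewrite ler_piMr ?sqr_ge0// indicE; case: (_ \in _); rewrite ?expr1n ?expr0n.
Qed.

End step_processes.

Lemma eq_rmax (R : realType) (x y : nat -> R) n :
  (forall k, (k <= n)%N -> x k = y k) -> rmax x n = rmax y n.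
Proof.
elim: n => [|n ih] xy /=; first by rewrite xy.
by rewrite xy// ih// => k kn; apply: xy; exact: leqW.
Qed.

(** * Lenglart's domination argument *)

Section lenglart.
Context d (Om : measurableType d) (R : realType) (P : probability Om R).
Variables (F : R -> set (set Om)) (W : R -> Om -> R).
Hypotheses (usual : usual_filtration P F) (bm : brownian_motion P F W).
Local Notation E := (Ex P).
Variables (t : R) (p : nat) (u : nat -> R).
Hypothesis pu : is_partition t p u.

(** The test on the term [x j] already includes [x j], so the retained partial sum never overshoots
    [delta]. *)
Lemma truncated_sum_le (x : nat -> R) (delta : R) k : 0 <= delta ->
  (forall j, (j < k)%N -> 0 <= x j) ->
  \sum_(j < k) x j * (\sum_(i < j.+1) x i <= delta)%R%:R <= delta.
Proof.
move=> d0 x0.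
suff : \sum_(j < k) x j * (\sum_(i < j.+1) x i <= delta)%R%:R <=
  Num.min delta (\sum_(j < k) x j) by rewrite le_min => /andP[].
elim: k x0 => [|k ih] x0; first by rewrite !big_ord0 le_min d0 lexx.
have {ih} := ih (fun j jk => x0 j (ltnW jk)).
have xk := x0 k (ltnSn k).
rewrite !le_min big_ord_recr/= big_ord_recr/= => /andP[h1 h2].
have [h|h] := leP (\sum_(i < k) x i + x k) delta.
  by rewrite mulr1 lerD2r h2 andbT; apply: le_trans h; rewrite lerD2r.
by rewrite mulr0 addr0 h1/= (le_trans h2)// lerDl.
Qed.

Variable b : nat -> Om -> R.
Hypothesis b_adapted : forall j, (j < p)%N -> adapted_to (F (u j)) (b j).
Hypothesis b_sqr : forall j, (j < p)%N -> (E (fun w => b j w ^+ 2)%R < +oo)%E.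

(** The coefficients are killed as soon as the energy, current step included, exceeds [delta]. The
    killed process [b'] is still adapted because the energy is predictable, its total energy is at
    most [delta], and Doob's and Markov's inequalities apply to it. Where the energy stays below
    [delta] nothing has been killed. *)
Lemma lenglart (A : set Om) (eps delta : R) : measurable A -> 0 < eps -> 0 <= delta ->
  (P (A `&` [set w | (eps < rmax (part_sum W u b w) p)%R]) <=
   (4 * delta / eps ^+ 2)%:E + P (A `&` [set w | (delta < part_energy u b w p)%R]))%E.
Proof.
move=> mA e0 d0.
pose b' j w := b j w * (part_energy u b w j.+1 <= delta)%R%:R.
have uj j : (j < p)%N -> 0 <= u j by move=> jp; have /andP[] := part_itv pu (ltnW jp).
have b'_adapted j : (j < p)%N -> adapted_to (F (u j)) (b' j).
  move=> jp; apply: measurable_funM; first exact: b_adapted.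
  have -> : (fun w => (part_energy u b w j.+1 <= delta)%R%:R) =
      \1_(`]-oo, delta]%classic) \o (part_energy u b ^~ j.+1) :> (Om -> R).
    by apply/funext => w /=; rewrite indicE mem_setE in_itv.
  apply: (@measurableT_comp _ _ _ _ _ _ (\1_(`]-oo, delta]%classic) : R -> R)).
    exact: measurable_indic.
  apply: measurable_sum => -[i ij]; apply: measurable_funM => //.
  apply: measurable_funX; have ip : (i < p)%N by exact: leq_trans jp.
  have uij : u i <= u j by apply: (part_le pu) => //; exact: ltnW.
  by apply: (adapted_sub (filt_mono usual (uj i ip) uij)); exact: b_adapted.
have b'_sqr j : (j < p)%N -> (E (fun w => b' j w ^+ 2)%R < +oo)%E.
  move=> jp; apply: le_lt_trans (b_sqr jp); apply: Ex_le => w; first exact: sqr_ge0.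
  by rewrite /b' exprMn ler_piMr ?sqr_ge0//;
    case: (part_energy _ _ _ _ <= _); rewrite ?expr1n ?expr0n.
have D0 j : (j < p)%N -> 0 <= u j.+1 - u j by move=> jp; rewrite subr_ge0 (part_mono pu).
have energy' w : part_energy u b' w p <= delta.
  apply: le_trans (@truncated_sum_le (fun j => b j w ^+ 2 * (u j.+1 - u j)) delta p d0 _).
    apply: ler_sum => j _; rewrite -/(part_energy u b w j.+1) /b' exprMn mulrAC.
    by case: (part_energy _ _ _ _ <= _); rewrite ?expr1n ?expr0n/=.
  by move=> j jp; rewrite mulr_ge0 ?sqr_ge0 ?D0.
have mr := measurable_rmax_part_sum usual bm pu b_adapted.
have mr' := measurable_rmax_part_sum usual bm pu b'_adapted.
have me := measurable_part_energy usual pu b_adapted (leqnn p).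
have lt_set (f : Om -> R) (c : R) : measurable_fun setT f -> measurable [set w | c < f w].
  move=> mf; rewrite -[X in measurable X]setTI.
  have := mf measurableT `]c, +oo[%classic (measurable_itv _).
  by congr (measurable (_ `&` _)); apply/seteqP; split => w /=; rewrite in_itv/= andbT.
have m1 := lt_set _ eps mr'; have m2 := lt_set _ delta me; have m3 := lt_set _ eps mr.
apply: (@le_trans _ _ (P ([set w | (eps < rmax (part_sum W u b' w) p)%R] `|`
    (A `&` [set w | (delta < part_energy u b w p)%R])))).
  apply: le_measure; rewrite ?inE.
  - exact: measurableI.
  - by apply: measurableU => //; exact: measurableI.
  move=> w [Aw lew]; have [h|h] := ltP delta (part_energy u b w p); first by right.
  left; move: lew => /=; suff -> : rmax (part_sum W u b' w) p = rmax (part_sum W u b w) p by [].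
  apply: eq_rmax => k kp; apply: eq_bigr => -[j jk] _ /=; rewrite /b'.
  suff -> : part_energy u b w j.+1 <= delta by rewrite mulr1.
  apply: le_trans h; have jp : (j.+1 <= p)%N by exact: leq_trans kp.
  rewrite /part_energy -!(big_mkord xpredT (fun j => b j w ^+ 2 * (u j.+1 - u j))).
  rewrite (big_cat_nat (n := j.+1) (p := p))//= lerDl big_nat_cond sumr_ge0// => i.
  by rewrite andbT => /andP[_ ip]; rewrite mulr_ge0 ?sqr_ge0 ?D0.
apply: (le_trans (measureU2 _ _ _)) => //; first exact: measurableI.
rewrite leeD2r//.
have doob := doob_partition usual bm pu b'_adapted b'_sqr.
apply: (@le_trans _ _ (E (\1_[set w | (eps < rmax (part_sum W u b' w) p)%R]))).
  by rewrite Ex_indic.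
apply: (@le_trans _ _ (E (fun w => eps ^- 2 * rmax (part_sum W u b' w) p ^+ 2)%R)).
  apply: Ex_le => w; first by rewrite indicE.
  rewrite indicE; case: (boolP (w \in _)) => [|_]; last first.
    by rewrite mulr_ge0 ?sqr_ge0// invr_ge0 exprn_ge0// ltW.
  rewrite inE/= => /ltW h; rewrite ler_pdivlMl ?exprn_gt0// mulr1.
  by rewrite lerXn2r// nnegrE ltW// (lt_le_trans e0).
have e2 : 0 <= eps ^- 2 by rewrite invr_ge0 exprn_ge0// ltW.
rewrite Ex_Z//; last 2 first.
- exact: measurable_funX.
- by move=> w; exact: sqr_ge0.
have -> : (4 * delta / eps ^+ 2)%:E = ((eps ^- 2)%:E * (4 * delta)%:E)%E.
  by rewrite -EFinM mulrC.
rewrite lee_wpmul2l ?lee_fin//.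
apply: (le_trans doob); rewrite EFinM lee_wpmul2l//.
rewrite -(Ex_cst P delta); apply: Ex_le => // w.
exact: (part_energy_ge0 pu).
Qed.

End lenglart.

(** * Localized bounds for the Ito integral *)

Lemma measurable_ltr_set d (Om : measurableType d) (R : realType) (f : Om -> R) (c : R) :
  measurable_fun setT f -> measurable [set w | c < f w].
Proof.
move=> mf; rewrite -[X in measurable X]setTI.
have := mf measurableT `]c, +oo[%classic (measurable_itv _).
by congr (measurable (_ `&` _)); apply/seteqP; split => w /=; rewrite in_itv/= andbT.
Qed.

Lemma measurable_lte_set d (Om : measurableType d) (R : realType) (f : Om -> \bar R)
    (c : \bar R) : measurable_fun setT f -> measurable [set w | (c < f w)%E].
Proof.
move=> mf; rewrite -[X in measurable X]setTI.
by apply: measurable_lte.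
Qed.

Lemma adapted_indic d (Om : measurableType d) (R : realType) (G : set (set Om)) (A : set Om) :
  G A -> adapted_to G (fun w => (w \in A)%:R : R).
Proof.
move=> GA; apply: (eq_measurable_fun (\1_A : g_sigma_algebraType G -> R)).
  by move=> w _; rewrite indicE.
by apply: measurable_indic; exact: sub_sigma_algebra.
Qed.

Lemma measurable_bigmaxr d (Om : measurableType d) (R : realType) (I : Type) (S : seq I)
    (f : I -> Om -> R) : (forall i, measurable_fun setT (f i)) ->
  measurable_fun setT (fun w => \big[Num.max/0]_(i <- S) f i w).
Proof.
move=> mf; elim: S => [|i S ih].
  by under eq_fun do rewrite big_nil; exact: measurable_cst.
by under eq_fun do rewrite big_cons; exact: measurable_maxr.
Qed.

Lemma cvg0_lt (R : realType) (x : nat -> \bar R) (e : R) : 0 < e ->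
  x @ \oo --> 0%E -> \forall m \near \oo, (x m < e%:E)%E.
Proof.
move=> e0 h; have : nbhs (0%E : \bar R) [set y | (y < e%:E)%E].
  by apply: open_nbhs_nbhs; split; [exact: open_ereal_lt_ereal|rewrite /= lte_fin].
by move/h.
Qed.

Lemma cvge_sum0 (R : realType) (I : eqType) (S : seq I) (x : nat -> I -> \bar R) :
  (forall m i, (0 <= x m i)%E) ->
  (forall i, i \in S -> x m i @[m --> \oo] --> 0%E) ->
  (\sum_(i <- S) x m i)%E @[m --> \oo] --> 0%E.
Proof.
move=> x0; elim: S => [|i S ih] xS.
  by under eq_fun do rewrite big_nil; exact: cvg_cst.
under eq_fun do rewrite big_cons.
have h1 : x m i @[m --> \oo] --> 0%E by apply: xS; rewrite mem_head.
have h2 := ih (fun k (kS : k \in S) => xS k (mem_behead (s := i :: S) kS)).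
by have := cvgeD _ h1 h2; rewrite adde0; apply.
Qed.

Section ito_localized.
Context d (Om : measurableType d) (R : realType) (P : probability Om R).
Variables (F : R -> set (set Om)) (W : R -> Om -> R).
Hypotheses (usual : usual_filtration P F) (bm : brownian_motion P F W).
Local Notation E := (Ex P).
Local Notation mu := (@lebesgue_measure R).
Variables (T : R) (H I : R -> Om -> R).
Hypothesis ito : is_ito_integral P F W T H I.
Variables (n : nat) (tau : nat -> R) (v : nat -> Om -> R).
Hypotheses (tau0 : forall k, (k <= n)%N -> 0 <= tau k)
  (taum : forall k, (k < n)%N -> tau k <= tau k.+1)
  (v_adapted : forall k, (k < n)%N -> adapted_to (F (tau k)) (v k))
  (v_sqr : forall k, (k < n)%N -> (E (fun w => v k w ^+ 2)%R < +oo)%E).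
Variables (K : R) (G : R -> set Om).
Hypotheses (K0 : 0 <= K)
  (G_adapted : forall s : R, 0 <= s <= T -> F s (G s))
  (G_dec : forall s s' : R, 0 <= s -> s <= s' -> s' <= T -> G s' `<=` G s)
  (G_meas : measurable [set z : R * Om | 0 <= z.1 <= T /\ G z.1 z.2])
  (HK : forall (s : R) w, 0 <= s <= T -> G s w -> `|H s w| <= K).
Variables (t : R) (S : seq R).
Hypotheses (tT : 0 <= t <= T) (St : forall s, s \in S -> 0 <= s <= t).

Let t0 : 0 <= t. Proof. by have /andP[] := tT. Qed.
Let tleT : t <= T. Proof. by have /andP[] := tT. Qed.

Let psi s w : R := step_value n tau (v ^~ w) s.
Let gap s w : R := step_integral n tau (v ^~ w) (W ^~ w) s - I s w.
(** Times are clamped to [[0, t]] so that every term is measurable, whatever the list [S]; clamping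
    does nothing to the members of [S] themselves. *)
Let X w : R := \big[Num.max/0]_(s <- S) `|gap (Num.max 0 (Num.min s t)) w|.

Let Q w := (\int[mu]_(s in `[0%R, t]) ((psi s w - H s w) ^+ 2 * (w \in G s)%:R)%R%:E)%E.

Let B w := 2 * (n%:R * \sum_(k < n) v k w ^+ 2) + 2 * K ^+ 2.

Let mv k : (k < n)%N -> measurable_fun setT (v k).
Proof.
move=> kn; apply: adapted_measurable (v_adapted kn).
by apply: (filt_sub usual); apply: tau0; exact: ltnW.
Qed.

Let m0t : measurable (`[0, t]%classic `*` [set: Om]).
Proof. exact: measurableX. Qed.

Let mpsi : measurable_fun (`[0, t] `*` setT) (fun z : R * Om => psi z.1 z.2).
Proof. by apply: measurable_funTS; apply: measurable_step_value. Qed.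

Let sub0t : `[0, t] `*` [set: Om] `<=` `[0, T] `*` setT.
Proof.
move=> z [] /=; rewrite !in_itv/= => /andP[-> zt] _; split => //.
by rewrite (le_trans zt).
Qed.

Let m0T : measurable (`[0, T]%classic `*` [set: Om]).
Proof. exact: measurableX. Qed.

Let mH : measurable_fun (`[0, t] `*` setT) (fun z : R * Om => H z.1 z.2).
Proof. exact: measurable_funS m0T sub0t (cl_measurable (ito_integrand ito)). Qed.

Let mG : measurable_fun (`[0, t] `*` setT) (fun z : R * Om => (z.2 \in G z.1)%:R : R).
Proof.
apply: (@eq_measurable_fun _ _ _ _ _
  (\1_[set z : R * Om | 0 <= z.1 <= T /\ G z.1 z.2] : R * Om -> R)).
  move=> z /set_mem/sub0t[/=]; rewrite in_itv/= => zT _; rewrite indicE.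
  suff -> : (z \in [set z : R * Om | 0 <= z.1 <= T /\ G z.1 z.2]) = (z.2 \in G z.1) by [].
  by apply/idP/idP; rewrite !inE/= => // -[].
by apply: measurable_funTS; exact: measurable_indic.
Qed.

Let mqphi : measurable_fun (`[0, t] `*` setT)
  (fun z : R * Om => ((psi z.1 z.2 - H z.1 z.2) ^+ 2 * (z.2 \in G z.1)%:R)%:E).
Proof.
apply/measurable_EFinP; apply: measurable_funM => //; apply: measurable_funX.
exact: measurable_funB.
Qed.

Let Q0 w : (0 <= Q w)%E.
Proof. by apply: integral_ge0 => s _; rewrite lee_fin mulr_ge0// sqr_ge0. Qed.

Let mQ : measurable_fun setT Q.
Proof.
apply: (@measurable_time_integral _ _ _ _ (fun s w =>
  ((psi s w - H s w) ^+ 2 * (w \in G s)%:R)%:E)) => //.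
by move=> s w _; rewrite lee_fin mulr_ge0// sqr_ge0.
Qed.

Let Bsum_ge0 w : 0 <= n%:R * \sum_(k < n) v k w ^+ 2.
Proof. by rewrite mulr_ge0// sumr_ge0// => k _; rewrite sqr_ge0. Qed.

Let mBsum : measurable_fun setT (fun w => n%:R * \sum_(k < n) v k w ^+ 2).
Proof.
apply: measurable_funM => //; apply: measurable_sum => k.
by apply: measurable_funX; exact: mv.
Qed.

Let B0 w : 0 <= B w.
Proof. by rewrite addr_ge0// mulr_ge0// sqr_ge0. Qed.

Let mB : measurable_fun setT B.
Proof. by apply: measurable_funD => //; apply: measurable_funM. Qed.

Let EB : (E B < +oo)%E.
Proof.
rewrite /B Ex_D//; last 3 first.
- exact: measurable_funM.
- by move=> w; rewrite mulr_ge0.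
- by move=> w; rewrite mulr_ge0// sqr_ge0.
rewrite Ex_cst lte_add_pinfty ?ltry// Ex_Z// lte_mul_pinfty//.
have mk (k : 'I_n) : measurable_fun setT (fun w => v k w ^+ 2).
  by apply: measurable_funX; exact: mv.
rewrite Ex_Z//; last 2 first.
- by apply: measurable_sum.
- by move=> w; apply: sumr_ge0 => k _; rewrite sqr_ge0.
rewrite lte_mul_pinfty// (@Ex_sum _ _ _ P _ _ (fun (k : 'I_n) w => v k w ^+ 2))//.
  by apply: lte_sum_pinfty => k _; exact: v_sqr.
by move=> k w; rewrite sqr_ge0.
Qed.

Let mI (s : R) : 0 <= s <= t -> measurable_fun setT (I s).
Proof.
move=> /andP[s0 st]; apply: (@adapted_measurable _ _ _ (F s)).
  exact: (filt_sub usual).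
by apply: sub_measurable_adapted; apply: (ito_adapted ito); rewrite s0 (le_trans st).
Qed.

Let mX : measurable_fun setT X.
Proof.
apply: measurable_bigmaxr => s; apply: measurableT_comp => //.
have st : 0 <= Num.max 0 (Num.min s t) <= t.
  by rewrite le_max lexx/= ge_max t0/= ge_min lexx orbT.
apply: measurable_funB; last exact: mI.
have /andP[s0 _] := st.
have mW k : (k <= n)%N ->
    measurable_fun setT (fun w => W (Num.min (Num.max 0 (Num.min s t)) (tau k)) w).
  by move=> kn; apply: (bm_measurable usual bm); rewrite le_min s0/= tau0.
apply: measurable_sum => k; apply: measurable_funM; first exact: mv.
by apply: measurable_funB; apply: mW => //; exact: ltnW.
Qed.

Section approximation.
Variable h : @simple_process R d Om.
Hypothesis h_simple : is_simple F T h.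

Let hv s w := step_value (sp_size h) (sp_time h) (sp_coef h ^~ w) s.

Let D w := (\int[mu]_(s in `[0%R, T]) (`|H s w - simple_value h s w| ^+ 2)%R%:E)%E.

Let sp_time_ge0 k : (k <= sp_size h)%N -> 0 <= sp_time h k.
Proof.
elim: k => [_|k ih kn]; first by rewrite (sp_time_first h_simple).
by apply: (le_trans _ (sp_time_mono h_simple kn)); apply: ih; exact: ltnW.
Qed.

Let coef_adapted k : (k < sp_size h)%N -> adapted_to (F (sp_time h k)) (sp_coef h k).
Proof. by move=> kn; apply: sub_measurable_adapted; exact: (sp_adapted h_simple). Qed.

Let mcoef k : (k < sp_size h)%N -> measurable_fun setT (sp_coef h k).
Proof.
move=> kn; apply: adapted_measurable (coef_adapted kn).
by apply: (filt_sub usual); apply: sp_time_ge0; exact: ltnW.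
Qed.

Let hv_adapted (s : R) : 0 <= s -> adapted_to (F s) (hv s).
Proof.
move=> s0; apply: (step_value_adapted usual) => // k kn.
by apply: sp_time_ge0; exact: ltnW.
Qed.

Let mD : measurable_fun setT D.
Proof.
apply: (@measurable_time_integral _ _ _ _ (fun s w =>
  (`|H s w - simple_value h s w| ^+ 2)%:E)) => //.
  apply/measurable_EFinP; apply: measurable_funX; apply: measurableT_comp => //.
  apply: measurable_funB; first exact: (cl_measurable (ito_integrand ito)).
  by apply: measurable_funTS; apply: measurable_step_value.
Qed.

Lemma measurable_simple_dist : measurable_fun setT D.
Proof. exact: mD. Qed.

Lemma measurable_simple_gap (s : R) : 0 <= s <= t ->
  measurable_fun setT (fun w => simple_integral W h s w - I s w).
Proof.
move=> st; have /andP[s0 _] := st; apply: measurable_funB; last exact: mI.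
have mW k : (k <= sp_size h)%N ->
    measurable_fun setT (fun w => W (Num.min s (sp_time h k)) w).
  move=> kn; apply: (bm_measurable usual bm); rewrite le_min s0/=.
  exact: sp_time_ge0.
apply: measurable_sum => k; apply: measurable_funM; first exact: mcoef.
by apply: measurable_funB; apply: mW => //; exact: ltnW.
Qed.

Variables (m : nat) (L eps delta : R).
Hypotheses (L0 : 0 <= L) (eps0 : 0 < eps) (delta0 : 0 <= delta).

(** With [h] the value of the approximating simple process,
    [psi - h = (psi - clip h) - (h - clip h)]. The first part is localized by the indicators of [G]
    and is bounded in mean by Doob's inequality. The second is small by Lenglart's inequality, and
    the discrepancy between the integral of [h] and [I] is small at the times of [S]. These last two
    are controlled in probability only, whence the truncation at [L]. *)
Lemma ito_localized_step :
  (E (fun w => Num.min (X w ^+ 2) L * (w \in G t)%:R)%R <=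
   2%:E * (4%:E * (2%:E * \int[P]_w Q w +
     2%:E * \int[P]_w Order.min (D w) (4 * K ^+ 2 * T)%:E + (t / m.+1%:R)%:E * E B)) +
   (8 * eps ^+ 2)%:E + L%:E * ((4 * delta / eps ^+ 2)%:E +
     P [set w | (delta%:E < D w)%E]) +
   L%:E * \sum_(s <- S) P [set w | (eps%:E < `|simple_integral W h s w - I s w|%:E)%E])%E.
Proof.
(* All times at which something happens: the observation times, the jumps of both step processes,
   and mesh points that keep each cell shorter than [t / m.+1]. *)
pose pts := S ++ [seq tau k | k <- iota 0 n.+1] ++
  [seq sp_time h k | k <- iota 0 (sp_size h).+1] ++
  [seq t * k.+1%:R / m.+1%:R | k <- iota 0 m.+1].
have [p [u [pu ptsu]]] := part_exists pts t0.
have up j : (j <= p)%N -> 0 <= u j <= t by exact: part_itv.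
have u0 j : (j <= p)%N -> 0 <= u j by move=> /up /andP[].
have upT j : (j <= p)%N -> 0 <= u j <= T.
  by move=> /up /andP[-> /=]; move=> /le_trans; exact.
have up_tau k : (k <= n)%N -> tau k <= t -> part_point p u (tau k).
  move=> kn kt; apply: ptsu; last by rewrite tau0.
  by rewrite !mem_cat map_f ?orbT// mem_iota.
have up_sp k : (k <= sp_size h)%N -> sp_time h k <= t -> part_point p u (sp_time h k).
  move=> kn kt; apply: ptsu; last by rewrite sp_time_ge0.
  by rewrite !mem_cat (@map_f _ _ (sp_time h)) ?orbT// mem_iota.
have umesh j : (j < p)%N -> u j.+1 - u j <= t / m.+1%:R.
  move=> jp; apply: (part_mesh pu jp) => k km; apply: ptsu.
    by rewrite !mem_cat (@map_f _ _ (fun k => t * k.+1%:R / m.+1%:R)) ?orbT// mem_iota.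
  rewrite divr_ge0 ?mulr_ge0//= ler_pdivrMr// ler_wpM2l// ler_nat.
  by rewrite ltnS.
have uSp s : s \in S -> exists2 i, (i <= p)%N & s = u i.
  by move=> sS; apply: ptsu; [rewrite mem_cat sS|exact: St].
pose c j w := psi (u j) w - clip K (hv (u j) w).
pose a j w := c j w * (w \in G (u j))%:R.
pose b j w := hv (u j) w - clip K (hv (u j) w).
have mclip := measurable_clip K.
have clip_adapted j : (j < p)%N -> adapted_to (F (u j)) (fun w => clip K (hv (u j) w)).
  move=> jp; have := hv_adapted (u0 j (ltnW jp)).
  exact: (measurableT_comp mclip).
have c_adapted j : (j < p)%N -> adapted_to (F (u j)) (c j).
  move=> jp; apply: measurable_funB; last exact: clip_adapted.
  apply: (step_value_adapted usual) => //; first by apply: u0; exact: ltnW.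
  by move=> k kn; apply: tau0; exact: ltnW.
have G_ind j : (j < p)%N -> adapted_to (F (u j)) (fun w => (w \in G (u j))%:R).
  by move=> jp; apply: adapted_indic; apply: G_adapted; apply: upT; exact: ltnW.
have a_adapted j : (j < p)%N -> adapted_to (F (u j)) (a j).
  by move=> jp; apply: measurable_funM; [exact: c_adapted|exact: G_ind].
have b_adapted j : (j < p)%N -> adapted_to (F (u j)) (b j).
  move=> jp; apply: measurable_funB; last exact: clip_adapted.
  by apply: hv_adapted; apply: u0; exact: ltnW.
have cB j w : c j w ^+ 2 <= B w.
  have h1 := @step_value_sqr_le _ _ _ n tau v (u j) w.
  have h2 := clip_le K0 (hv (u j) w).
  have h3 : clip K (hv (u j) w) ^+ 2 <= K ^+ 2.
    by rewrite -(@real_normK _ (clip _ _)) ?num_real// lerXn2r// nnegrE.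
  rewrite /c /B; move: h1 h3; rewrite -/(psi (u j) w).
  set x := psi _ _; set y := clip _ _; set z := n%:R * _ => h1 h3.
  by have := sqr_ge0 (x + y); nra.
have a_sqr j : (j < p)%N -> (E (fun w => a j w ^+ 2)%R < +oo)%E.
  move=> jp; apply: le_lt_trans EB; apply: Ex_le => w; first exact: sqr_ge0.
  rewrite /a exprMn; apply: le_trans (cB j w); rewrite ler_piMr ?sqr_ge0//.
  by case: (_ \in _); rewrite ?expr1n ?expr0n.
have b_sqr j : (j < p)%N -> (E (fun w => b j w ^+ 2)%R < +oo)%E.
  have [M hM] := sp_bounded h_simple.
  move=> jp; pose M' := 2 * ((sp_size h)%:R * \sum_(k < sp_size h) M ^+ 2) + 2 * K ^+ 2.
  apply: (@le_lt_trans _ _ (E (fun=> M'))); last by rewrite Ex_cst ltry.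
  apply: Ex_le => w; first exact: sqr_ge0.
  have h1 := @step_value_sqr_le _ _ _ (sp_size h) (sp_time h) (sp_coef h) (u j) w.
  have h3 : clip K (hv (u j) w) ^+ 2 <= K ^+ 2.
    by rewrite -(@real_normK _ (clip _ _)) ?num_real// lerXn2r// ?nnegrE// clip_le.
  have h4 : (sp_size h)%:R * \sum_(k < sp_size h) sp_coef h k w ^+ 2 <=
      (sp_size h)%:R * \sum_(k < sp_size h) M ^+ 2.
    apply: ler_wpM2l => //; apply: ler_sum => k _.
    rewrite -(@real_normK _ (sp_coef _ _ _)) ?num_real//.
    have h5 := hM k w (ltn_ord k).
    by rewrite lerXn2r// nnegrE (le_trans _ h5).
  rewrite /b /M'; move: (le_trans h1 h4) h3; rewrite -/(hv (u j) w).
  set x := hv _ _; set y := clip _ _; set z := (sp_size h)%:R * _ => h1' h3.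
  by have := sqr_ge0 (x + y); nra.
have hvm : measurable_fun (`[0, t] `*` setT) (fun z : R * Om => hv z.1 z.2).
  by apply: measurable_funTS; apply: measurable_step_value.
have mrphi : measurable_fun (`[0, t] `*` setT) (fun z : R * Om =>
    ((H z.1 z.2 - clip K (hv z.1 z.2)) ^+ 2 * (z.2 \in G z.1)%:R)%:E).
  apply/measurable_EFinP; apply: measurable_funM => //; apply: measurable_funX.
  by apply: measurable_funB => //; exact: (measurableT_comp mclip).
have mdphi : measurable_fun (`[0, T] `*` setT) (fun z : R * Om =>
    (`|H z.1 z.2 - simple_value h z.1 z.2| ^+ 2)%:E).
  apply/measurable_EFinP; apply: measurable_funX; apply: measurableT_comp => //.
  apply: measurable_funB; first exact: (cl_measurable (ito_integrand ito)).
  by apply: measurable_funTS; apply: measurable_step_value.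
have mdsec w : measurable_fun `[0, T] (fun s => (`|H s w - simple_value h s w| ^+ 2)%:E).
  exact: (measurable_section (phi := fun s w => (`|H s w - simple_value h s w| ^+ 2)%:E)).
have sub_itv : `[0, t]%classic `<=` `[0, T]%classic.
  by move=> s; rewrite /= !in_itv/= => /andP[-> st]; exact: le_trans tleT.
have D0T w : (\int[mu]_(s in `[0%R, t]) (`|H s w - simple_value h s w| ^+ 2)%R%:E <= D w)%E.
  by apply: ge0_subset_integral => // mDD Y mY; exact: mdsec.
(* On [G s] both the integrand and the clipped value are at most [K], so their squared distance is
   also at most [4 * K ^+ 2]. The resulting minimum is bounded, so its mean will tend to 0 although
   [D] only does so in probability. *)
have energy_a w : ((part_energy u a w p)%:E <= 2%:E * Q w +
    2%:E * Order.min (D w) (4 * K ^+ 2 * T)%:E + (t / m.+1%:R * B w)%:E)%E.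
  have -> : part_energy u a w p = \sum_(j < p) (psi (u j) w - clip K (hv (u j) w)) ^+ 2 *
      (w \in G (u j))%:R * (u j.+1 - u j).
    apply: eq_bigr => j _; rewrite /a exprMn.
    by case: (w \in _); rewrite ?expr1n ?expr0n.
  apply: le_trans (@path_energy_le _ t p u (psi ^~ w) (fun s => clip K (hv s w)) (H ^~ w)
    (fun s => w \in G s) (B w) (t / m.+1%:R) pu _ _ _ _ umesh (B0 w) _ _ _) _.
  - by move=> j s jp js sj; apply: (step_value_const _ pu up_tau).
  - by move=> j s jp js sj; rewrite /hv (step_value_const _ pu up_sp jp js sj).
  - move=> s s' s0 ss' st'; rewrite !inE; apply: G_dec => //.
    exact: le_trans tleT.
  - by move=> j jp; exact: cB.
  - by rewrite divr_ge0.
  - exact: (measurable_section (phi := fun s w =>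
      ((psi s w - H s w) ^+ 2 * (w \in G s)%:R)%:E)).
  - exact: (measurable_section (phi := fun s w =>
      ((H s w - clip K (hv s w)) ^+ 2 * (w \in G s)%:R)%:E)).
  rewrite leeD2r// leeD2l// lee_wpmul2l// le_min; apply/andP; split.
    apply: le_trans (D0T w); apply: ge0_le_integral => //.
    - by move=> s _; rewrite lee_fin mulr_ge0// sqr_ge0.
    - exact: (measurable_section (phi := fun s w =>
        ((H s w - clip K (hv s w)) ^+ 2 * (w \in G s)%:R)%:E)).
    - exact: measurable_funS (mdsec w).
    move=> s; rewrite /= in_itv/= => /andP[s0 st]; rewrite lee_fin.
    case: (boolP (w \in G s)) => [|_]; last by rewrite mulr0.
    rewrite inE mulr1 => Gs; rewrite -(@real_normK _ (H s w - clip _ _)) ?num_real//.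
    rewrite lerXn2r ?nnegrE//; apply: clip_dist => //; apply: HK => //.
    by rewrite s0 (le_trans st).
  apply: (@le_trans _ _ (\int[mu]_(s in `[0%R, t]) (4 * K ^+ 2)%:E)%E).
    apply: ge0_le_integral => //.
    - by move=> s _; rewrite lee_fin mulr_ge0// sqr_ge0.
    - exact: (measurable_section (phi := fun s w =>
        ((H s w - clip K (hv s w)) ^+ 2 * (w \in G s)%:R)%:E)).
    move=> s; rewrite /= in_itv/= => /andP[s0 st]; rewrite lee_fin.
    case: (boolP (w \in G s)) => [|_]; last by rewrite mulr0 mulr_ge0// sqr_ge0.
    rewrite inE mulr1 => Gs.
    have h1 : `|H s w| <= K by apply: HK => //; rewrite s0 (le_trans st).
    have h2 := clip_le K0 (hv s w).
    have h3 : `|H s w - clip K (hv s w)| <= 2 * K.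
      by rewrite (le_trans (ler_normB _ _))// mulr_natl mulr2n lerD.
    rewrite -(@real_normK _ (H s w - clip _ _)) ?num_real//.
    have -> : 4 * K ^+ 2 = (2 * K) ^+ 2 by ring.
    by rewrite lerXn2r ?nnegrE// mulr_ge0.
  rewrite integral_cst//= lebesgue_measure_itv/= lte_fin.
  have K4 : 0 <= 4 * K ^+ 2 by rewrite mulr_ge0// sqr_ge0.
  case: ifP => _; last by rewrite mule0 lee_fin mulr_ge0// (le_trans t0).
  by rewrite oppr0 adde0 -EFinM lee_fin ler_wpM2l.
(* On [G t] the integrand is at most [K] up to time [t], so the part cut off by clipping is
   dominated by the distance to the integrand. *)
have energy_b w : G t w -> ((part_energy u b w p)%:E <= D w)%E.
  move=> Gt; apply: le_trans (D0T w).
  apply: (@step_sum_le_integral _ t p u (fun j => b j w ^+ 2)) => //.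
  - by move=> j jp; exact: sqr_ge0.
  - exact: measurable_funS (mdsec w).
  move=> j s jp js sj; rewrite lee_fin /b.
  have s0 : 0 <= s by apply: le_trans js; apply: u0; exact: ltnW.
  have st : s <= t by apply: (le_trans (ltW sj)); have /andP[] := up _ jp.
  rewrite -[hv (u j) w](step_value_const _ pu up_sp jp js sj).
  rewrite real_normK ?num_real//; apply: clip_defect_le => //.
  apply: HK; first by rewrite s0 (le_trans st).
  by apply: G_dec Gt.
have mra := measurable_rmax_part_sum usual bm pu a_adapted.
have mrb := measurable_rmax_part_sum usual bm pu b_adapted.
pose A := G t `&` [set w | (eps < rmax (part_sum W u b w) p)%R].
pose cl s := Num.max 0 (Num.min s t).
have cl_itv s : 0 <= cl s <= t.
  by rewrite le_max lexx/= ge_max t0/= ge_min lexx orbT.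
have cl_id s : s \in S -> cl s = s.
  by move=> /St /andP[s0 st]; rewrite /cl (min_idPl st) (max_idPr s0).
pose Bs s := [set w | (eps < `|simple_integral W h (cl s) w - I (cl s) w|)%R].
have mGt : measurable (G t).
  by apply: (filt_sub usual t0); exact: G_adapted.
have mA : measurable A by apply: measurableI => //; exact: measurable_ltr_set.
have mBs s : measurable (Bs s).
  apply: measurable_ltr_set; apply: measurableT_comp => //.
  exact: measurable_simple_gap.
have gapE w s : G t w -> s \in S -> exists2 i, (i <= p)%N &
    gap (cl s) w = part_sum W u a w i - part_sum W u b w i +
      (simple_integral W h (cl s) w - I (cl s) w).
  move=> Gt sS; have [i ip si] := uSp s sS; exists i => //.
  rewrite (cl_id s sS) /gap addrA; congr (_ - _); rewrite si /simple_integral.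
  rewrite (step_integral_refine _ _ pu)// (step_integral_refine _ _ pu)//; last 1 first.
  - exact: (sp_time_mono h_simple).
  rewrite -sumrB -big_split/=; apply: eq_bigr => -[j ji] _ /=.
  have jp : (j < p)%N by exact: leq_trans ip.
  rewrite /a /c /b mem_set ?mulr1; first by rewrite /psi /hv; ring.
  have /andP[j0 jt] := up _ (ltnW jp).
  by apply: G_dec Gt.
(* On the two exceptional kinds of event the truncation level [L] is paid. Elsewhere the last two
   contributions are at most [eps] each, and [(x + 2 * eps) ^+ 2 <= 2 * x ^+ 2 + 8 * eps ^+ 2]. *)
have main w : Num.min (X w ^+ 2) L * (w \in G t)%:R <=
    2 * rmax (part_sum W u a w) p ^+ 2 + (8 * eps ^+ 2 +
      (L * \1_A w + L * \sum_(s <- S) \1_(Bs s) w)).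
  have sum0 : 0 <= \sum_(s <- S) (\1_(Bs s) w : R) by apply: sumr_ge0.
  have r0 := sqr_ge0 (rmax (part_sum W u a w) p).
  have e0 := sqr_ge0 eps.
  have A0 : 0 <= (\1_A w : R) by [].
  have LA := mulr_ge0 L0 A0; have LS := mulr_ge0 L0 sum0.
  case: (boolP (w \in G t)) => [|_]; last by rewrite mulr0; lra.
  rewrite inE mulr1 => Gt.
  have minL : Num.min (X w ^+ 2) L <= L by rewrite ge_min lexx orbT.
  have minX : Num.min (X w ^+ 2) L <= X w ^+ 2 by rewrite ge_min lexx.
  have [wA|wA] := boolP (w \in A).
    have A1 : \1_A w = 1 :> R by rewrite indicE wA.
    by rewrite A1 in LA *; lra.
  have [/hasP[s sS wB]|/hasPn noB] := boolP (has (fun s => w \in Bs s) S).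
    have S1 : 1 <= \sum_(s <- S) (\1_(Bs s) w : R).
      rewrite (big_rem s)//= indicE wB lerDl; exact: sumr_ge0.
    by have := ler_wpM2l L0 S1; lra.
  have rb : rmax (part_sum W u b w) p <= eps.
    by rewrite leNgt; apply/negP => lt; move/negP: wA; apply; rewrite inE.
  have ra0 := rmax_ge0 (part_sum W u a w) p.
  have XM : X w <= rmax (part_sum W u a w) p + 2 * eps.
    rewrite /X big_seq; apply: bigmax_le => [|s sS]; first by have := ltW eps0; lra.
    have [i ip ->] := gapE w s Gt sS.
    have h1 := le_rmax (part_sum W u a w) ip.
    have h2 := le_trans (le_rmax (part_sum W u b w) ip) rb.
    have h3 : `|simple_integral W h (cl s) w - I (cl s) w| <= eps.
      by rewrite leNgt; apply/negP => lt; move/negP: (noB s sS); apply; rewrite inE.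
    apply: (le_trans (ler_normD _ _)); apply: (le_trans (lerD (ler_normB _ _) (lexx _))).
    by move: h1 h2 h3; lra.
  have X0 : 0 <= X w by rewrite /X; elim/big_rec: _ => // s x _ x0; rewrite le_max x0 orbT.
  have : X w ^+ 2 <= (rmax (part_sum W u a w) p + 2 * eps) ^+ 2.
    by rewrite lerXn2r// nnegrE// (le_trans X0).
  move: minX; set r := rmax _ _ => minX XX.
  have := sqr_ge0 (r - 2 * eps); nra.
have ind0 (C : set Om) (w : Om) : 0 <= (\1_C w : R) by [].
have sum0 w : 0 <= \sum_(s <- S) (\1_(Bs s) w : R) by apply: sumr_ge0.
have mind C : measurable C -> measurable_fun setT (\1_C : Om -> R).
  by move=> mC; exact: measurable_indic.
have msum : measurable_fun setT (fun w => \sum_(s <- S) (\1_(Bs s) w : R)).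
  by apply: measurable_sum => s; apply: mind.
apply: (le_trans (Ex_le P _ main)).
  by move=> w; rewrite mulr_ge0// le_min sqr_ge0.
rewrite Ex_D; last 4 first.
- by apply: measurable_funM => //; exact: measurable_funX.
- by move=> w; rewrite mulr_ge0// sqr_ge0.
- by apply: measurable_funD => //; apply: measurable_funD; apply: measurable_funM => //; exact: mind.
- by move=> w; have := mulr_ge0 L0 (ind0 A w); have := mulr_ge0 L0 (sum0 w);
  have := sqr_ge0 eps; lra.
rewrite Ex_D; last 4 first.
- exact: measurable_cst.
- by move=> w; rewrite mulr_ge0// sqr_ge0.
- by apply: measurable_funD; apply: measurable_funM => //; exact: mind.
- by move=> w; have := mulr_ge0 L0 (ind0 A w); have := mulr_ge0 L0 (sum0 w); lra.
rewrite Ex_D; last 4 first.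
- by apply: measurable_funM => //; exact: mind.
- by move=> w; rewrite mulr_ge0.
- exact: measurable_funM.
- by move=> w; rewrite mulr_ge0.
rewrite Ex_cst !Ex_Z//; last 2 first.
- exact: measurable_funX.
- by move=> w; exact: sqr_ge0.
rewrite Ex_indic// (@Ex_sum _ _ _ P _ _ (fun s => \1_(Bs s)))//.
rewrite !addeA; apply: leeD; last first.
  rewrite lee_wpmul2l// [leLHS]big_seq [leRHS]big_seq; apply: lee_sum => s sS.
  by rewrite Ex_indic// /Bs cl_id.
apply: leeD; last first.
  rewrite lee_wpmul2l//.
  apply: (le_trans (lenglart usual bm pu b_adapted b_sqr mGt eps0 delta0)).
  rewrite leeD2l//; apply: le_measure; rewrite ?inE.
  - apply: measurableI => //; apply: measurable_ltr_set.
    exact: (measurable_part_energy usual pu b_adapted (leqnn p)).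
  - exact: measurable_lte_set.
  - move=> w [Gt /= lt]; apply: (@lt_le_trans _ _ (part_energy u b w p)%:E).
      by rewrite lte_fin.
    exact: energy_b.
apply: leeD => //; rewrite lee_wpmul2l//.
apply: (le_trans (doob_partition usual bm pu a_adapted a_sqr)); rewrite lee_wpmul2l//.
have mmin : measurable_fun setT (fun w => Order.min (D w) (4 * K ^+ 2 * T)%:E).
  by apply: measurable_mine => //.
have min0 w : (0 <= Order.min (D w) (4 * K ^+ 2 * T)%:E)%E.
  rewrite le_min; apply/andP; split.
    by apply: integral_ge0 => s _; rewrite lee_fin sqr_ge0.
  by rewrite lee_fin mulr_ge0 ?mulr_ge0 ?sqr_ge0// (le_trans t0).
have tm0 : 0 <= t / m.+1%:R by rewrite divr_ge0.
apply: (@le_trans _ _ (\int[P]_w (2%:E * Q w + 2%:E * Order.min (D w) (4 * K ^+ 2 * T)%:E +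
    (t / m.+1%:R * B w)%:E))%E).
  apply: ge0_le_integralT => // w.
  by rewrite lee_fin; exact: (part_energy_ge0 pu).
rewrite ge0_integralD//; last 4 first.
- by move=> w _; rewrite adde_ge0// mule_ge0.
- by apply: emeasurable_funD; exact: emeasurable_funM.
- by move=> w _; rewrite lee_fin mulr_ge0.
- by apply/measurable_EFinP; exact: measurable_funM.
rewrite ge0_integralD//; last 4 first.
- by move=> w _; rewrite mule_ge0.
- exact: emeasurable_funM.
- by move=> w _; rewrite mule_ge0.
- exact: emeasurable_funM.
rewrite !ge0_integralZl//.
have := Ex_Z P tm0 mB B0; rewrite {1}/Ex => ->.
by [].
Qed.

End approximation.

Let XG0 w : 0 <= X w ^+ 2 * (w \in G t)%:R.
Proof. by rewrite mulr_ge0// sqr_ge0. Qed.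

(** The constant is [16 = 2 * 4 * 2]: the square of a sum, Doob's inequality, and the splitting of
    the energy through [H]. Everything else in the one-step bound can be made smaller than a given
    [e]. *)
Let ito_localized_min L : 0 <= L ->
  (E (fun w => Num.min (X w ^+ 2) L * (w \in G t)%:R)%R <= 16%:E * \int[P]_w Q w)%E.
Proof.
move=> L0; apply/lee_addgt0Pr => e e0.
(* The order of choice matters: [eps] depends on [e], then [delta] on [e], [eps] and [L], and only
   then the index of the simple process, so that [L * (4 * delta / eps ^+ 2)] is still small. *)
pose eps := Num.min 1 (e / 32).
have eps0 : 0 < eps by rewrite lt_min ltr01 divr_gt0.
have eps8 : 8 * eps ^+ 2 <= e / 4.
  have h1 : eps <= 1 by rewrite ge_min lexx.
  have h2 : eps <= e / 32 by rewrite ge_min lexx orbT.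
  by have := ler_wpM2l (ltW eps0) h1; rewrite -expr2 mulr1; lra.
pose delta := Num.min (e / 128) (e * eps ^+ 2 / (32 * (L + 1))).
have L1 : 0 < L + 1 by lra.
have delta0 : 0 < delta.
  by rewrite lt_min divr_gt0//= divr_gt0 ?mulr_gt0// exprn_gt0.
have d1 : 16 * delta <= e / 8.
  have : delta <= e / 128 by rewrite ge_min lexx.
  by lra.
have d2 : L * (4 * delta / eps ^+ 2) <= e / 8.
  have : delta <= e * eps ^+ 2 / (32 * (L + 1)) by rewrite ge_min lexx orbT.
  rewrite ler_pdivlMr ?mulr_gt0// => h.
  rewrite mulrA ler_pdivrMr ?exprn_gt0//; have := exprn_gt0 2 eps0.
  by have := mulr_ge0 L0 (ltW delta0); nra.
have [h [h_simple hD hI]] := ito_limit ito.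
pose c := 4 * K ^+ 2 * T.
have c0 : 0 <= c by rewrite !mulr_ge0 ?sqr_ge0// (le_trans t0).
pose D m w := (\int[mu]_(s in `[0%R, T]) (`|H s w - simple_value (h m) s w| ^+ 2)%R%:E)%E.
pose pD m := P [set w | (delta%:E < D m w)%E].
pose pS m s := P [set w | (eps%:E < `|simple_integral W (h m) s w - I s w|%:E)%E].
have EBf : E B \is a fin_num by rewrite ge0_fin_numE ?EB ?Ex_ge0.
have r1 : ((16 * c + L)%:E * pD m)%E @[m --> \oo] --> 0%E.
  by rewrite -(mule0 (16 * c + L)%:E); apply: cvgeZl => //; exact: hD.
have r2 : (8 * (t * fine (E B)) * m.+1%:R^-1)%:E @[m --> \oo] --> 0%E.
  apply: cvg_EFin; first exact: nearW.
  rewrite -(mulr0 (8 * (t * fine (E B)))); apply: cvgM; first exact: cvg_cst.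
  exact: cvg_harmonic.
have r3 : (L%:E * \sum_(s <- S) pS m s)%E @[m --> \oo] --> 0%E.
  have h1 : (\sum_(s <- S) pS m s)%E @[m --> \oo] --> 0%E.
    by apply: cvge_sum0 => [m s|s sS]; [exact: measure_ge0|apply: hI => //;
      have /andP[-> st] := St sS; exact: le_trans tleT].
  have Lf : L%:E \is a fin_num by [].
  by have := cvgeZl Lf h1; rewrite mule0; apply.
(* One index serves both as the number of the approximating simple process and as the fineness of
   the mesh. *)
near \oo => m.
have b1 : ((16 * c + L)%:E * pD m < (e / 16)%:E)%E by near: m; apply: cvg0_lt => //; lra.
have b2 : ((8 * (t * fine (E B)) * m.+1%:R^-1)%:E < (e / 16)%:E)%E.
  by near: m; apply: cvg0_lt => //; lra.
have b3 : (L%:E * \sum_(s <- S) pS m s < (e / 16)%:E)%E.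
  by near: m; apply: cvg0_lt => //; lra.
have step : (E (fun w => Num.min (X w ^+ 2) L * (w \in G t)%:R)%R <=
   2%:E * (4%:E * (2%:E * \int[P]_w Q w + 2%:E * \int[P]_w Order.min (D m w) c%:E +
     (t / m.+1%:R)%:E * E B)) + (8 * eps ^+ 2)%:E +
   L%:E * ((4 * delta / eps ^+ 2)%:E + pD m) + L%:E * \sum_(s <- S) pS m s)%E.
  exact: (@ito_localized_step (h m) (h_simple m) m L eps delta L0 eps0 (ltW delta0)).
apply: (le_trans step) => {step}.
have mDm : measurable [set w | (delta%:E < D m w)%E].
  by apply: measurable_lte_set; exact: measurable_simple_dist.
(* The minimum is at most [delta] where [D] is, and at most [c] on the remaining event, whose
   probability tends to 0. *)
have Emin : (\int[P]_w Order.min (D m w) c%:E <= delta%:E + c%:E * pD m)%E.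
  have D0 w : (0 <= D m w)%E.
    by apply: integral_ge0 => s _; rewrite lee_fin sqr_ge0.
  apply: (@le_trans _ _ (E (fun w => delta + c * \1_[set w | (delta%:E < D m w)%E] w))).
    apply: ge0_le_integralT => w; first by rewrite le_min D0 lee_fin.
    rewrite indicE; case: (boolP (w \in _)) => [_|].
      by rewrite ge_min lee_fin mulr1 lerDr (ltW delta0) orbT.
    by rewrite notin_setE/= => /negP; rewrite -leNgt mulr0 addr0 ge_min => ->.
  rewrite (@Ex_D _ _ _ _ (fun=> delta))//.
  - by rewrite Ex_cst Ex_Z// Ex_indic.
  - by move=> w; exact: ltW.
  - exact: measurable_funM.
  - by move=> w; rewrite mulr_ge0.
have Em0 : (0 <= \int[P]_w Order.min (D m w) c%:E)%E.
  apply: integral_ge0 => w _; rewrite le_min lee_fin c0 andbT.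
  by apply: integral_ge0 => s _; rewrite lee_fin sqr_ge0.
have pDf : pD m \is a fin_num by exact: fin_num_measure.
have pSf : (\sum_(s <- S) pS m s)%E \is a fin_num.
  apply/sum_fin_numP => s sS _; apply: fin_num_measure; apply: measurable_lte_set.
  apply/measurable_EFinP; apply: measurableT_comp => //.
  by apply: measurable_simple_gap => //; exact: St.
have Emf : (\int[P]_w Order.min (D m w) c%:E)%E \is a fin_num.
  rewrite ge0_fin_numE//; apply: (le_lt_trans Emin).
  by rewrite -(fineK pDf) -EFinM -EFinD ltry.
have QI0 : (0 <= \int[P]_w Q w)%E by exact: integral_ge0.
have [->|Qf] := eqVneq (\int[P]_w Q w)%E +oo%E.
  by rewrite [leRHS](_ : _ = +oo%E) ?leey// gt0_muley ?lte_fin// addye.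
have {}Qf : (\int[P]_w Q w)%E \is a fin_num by rewrite ge0_fin_numE// ltey.
move: Emin b1 b2 b3.
rewrite -(fineK Qf) -(fineK Emf) -(fineK EBf) -(fineK pDf) -(fineK pSf).
set em := fine (\int[P]_w Order.min _ _)%E; set pd := fine (pD m).
set ps := fine (\sum_(s <- S) _)%E; set eb := fine (E B); set q := fine (\int[P]_w Q w)%E.
rewrite -?EFinM -?EFinD -?EFinM -?EFinD -?EFinM ?lee_fin ?lte_fin.
have -> : t / m.+1%:R * eb = 8 * (t * eb) / m.+1%:R / 8 by field.
rewrite [L * (_ + _)]mulrDr [(_ + L) * _]mulrDl -[16 * c * pd]mulrA.
move: (8 * (t * eb) / m.+1%:R) (c * pd) (L * pd) (L * ps) (L * (4 * delta / eps ^+ 2)) (d2) (d1) (eps8).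
by move=> x1 x2 x3 x4 x5; lra.
Unshelve. all: by end_near.
Qed.

(** The bound just obtained is independent of [L], so monotone convergence removes the truncation.
    What results is a maximal Ito isometry inequality for the difference of a step integral and [I],
    restricted to [G t]. *)
Lemma ito_localized_sup :
  (E (fun w => X w ^+ 2 * (w \in G t)%:R)%R <= 16%:E * \int[P]_w Q w)%E.
Proof.
have mGt : measurable_fun setT (fun w => (w \in G t)%:R : R).
  apply: adapted_measurable (filt_sub usual t0) _.
  by apply: adapted_indic; exact: G_adapted.
pose f L w := (Num.min (X w ^+ 2) L%:R * (w \in G t)%:R)%:E.
have f0 L w : (0 <= f L w)%E by rewrite lee_fin mulr_ge0// le_min sqr_ge0/=.
have mf L : measurable_fun setT (f L).
  apply/measurable_EFinP; apply: measurable_funM => //.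
  by apply: measurable_minr => //; exact: measurable_funX.
have ndf w : nondecreasing_seq (f^~ w).
  move=> L L' LL; rewrite lee_fin ler_wpM2r//.
  by rewrite le_min ge_min lexx/= ge_min ler_nat LL orbT.
have flim w : f L w @[L --> \oo] --> (X w ^+ 2 * (w \in G t)%:R)%:E.
  apply: cvg_near_cst; exists (Num.trunc (X w ^+ 2)).+1 => // L /= hL.
  rewrite /f (min_idPl _)//; apply: ltW; apply: (lt_le_trans (truncnS_gt _)).
  by rewrite ler_nat.
have cvgI := cvg_monotone_convergence (@measurableT _ Om) mf (fun L w _ => f0 L w) (fun w _ => ndf w).
have -> : E (fun w => X w ^+ 2 * (w \in G t)%:R) = (\int[P]_w limn (f^~ w))%E.
  by apply: eq_integral => w _; apply/esym/cvg_lim.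
rewrite -(cvg_lim _ (cvgI P))//; apply: lime_le; first by apply/cvg_ex; eexists; exact: cvgI.
by apply: nearW => L; exact: ito_localized_min.
Qed.

End ito_localized.

(** * Envelopes of suprema *)

Section envelopes.
Context d (Om : measurableType d) (R : realType) (P : probability Om R).

(** The increasing limit of finite maxima is measurable and keeps their common bound. It stands in
    for a supremum over a continuum of times, which path continuity then compares with it. *)
Lemma monotone_envelope (x : nat -> Om -> R) (b : \bar R) :
  (forall N, measurable_fun setT (x N)) -> (forall N w, 0 <= x N w) ->
  (forall N w, x N w <= x N.+1 w) -> (forall N, (Ex P (x N) <= b)%E) ->
  exists V : Om -> \bar R, [/\ measurable_fun setT V, forall w, (0 <= V w)%E,
    forall N w, ((x N w)%:E <= V w)%E & (\int[P]_w V w <= b)%E].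
Proof.
move=> mx x0 xS xb; pose f N w := (x N w)%:E.
have ndf w : nondecreasing_seq (f^~ w).
  by apply/nondecreasing_seqP => N; rewrite lee_fin.
have cf w : cvgn (f^~ w) by exact: ereal_nondecreasing_is_cvgn.
have mf N : measurable_fun setT (f N) by exact/measurable_EFinP.
have f0 N w : (0 <= f N w)%E by rewrite lee_fin.
have fV N w : (f N w <= limn (f^~ w))%E by rewrite (cvg_lim _ (ereal_nondecreasing_cvgn (ndf w)))//; apply: ereal_sup_ubound; exists N.
exists (fun w => limn (f^~ w)); split => //.
- apply: (emeasurable_fun_cvg f) => // w _; exact: cf.
- by move=> w; apply: le_trans (f0 0%N w) (fV 0%N w).
have cvgI := cvg_monotone_convergence (@measurableT _ Om) mf
  (fun N w _ => f0 N w) (fun w _ => ndf w).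
rewrite -(cvg_lim _ (cvgI P))//; apply: lime_le; first by apply/cvg_ex; eexists; exact: cvgI.
by apply: nearW => N; exact: xb.
Qed.

End envelopes.

Section dense_times.
Context {R : realType}.

Lemma dense_times (a b : R) : a <= b -> exists q : nat -> R,
  (forall i, a <= q i <= b) /\
  (forall s, a <= s <= b -> forall e : R, 0 < e -> exists i, `|s - q i| < e).
Proof.
move=> ab.
(* Equidistant points of every fineness, indexed by pairs of naturals. Capping at [b] makes every
   pair admissible, so no side condition is needed in the enumeration. *)
pose pr (z : nat * nat) : R := Num.min b (a + (b - a) * (z.1%:R / z.2.+1%:R)).
pose q i := if unpickle i is Some z then pr z else a.
have prab z : a <= pr z <= b.
  have z0 : 0 <= (b - a) * (z.1%:R / z.2.+1%:R) by rewrite mulr_ge0 ?subr_ge0// divr_ge0.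
  by rewrite /pr ge_min lexx/= le_min ab/= lerDl z0.
exists q; split=> [i|s /andP[as_ sb] e e0].
  by rewrite /q; case: unpickle => // ; rewrite lexx.
have [ltab|] := ltP a b; last first.
  move=> ba; exists 0%N; have /andP[q1 q2] : a <= q 0%N <= b.
    by rewrite /q; case: unpickle => // ; rewrite lexx.
  by rewrite (_ : s - q 0%N = 0) ?normr0//; lra.
have ba0 : 0 < b - a by rewrite subr_gt0.
pose m := Num.trunc ((b - a) / e).
have m1 : (b - a) / e < m.+1%:R by rewrite truncnS_gt.
pose k := Num.trunc ((s - a) * m.+1%:R / (b - a)).
have z0 : 0 <= (s - a) * m.+1%:R / (b - a).
  by rewrite divr_ge0 ?mulr_ge0 ?subr_ge0// ltW.
have /andP[k1 k2] := truncn_itv z0; rewrite -/k in k1 k2.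
exists (pickle (k, m)); rewrite /q pickleK /pr/=.
have m0 : 0 < m.+1%:R :> R by [].
have c1 : (b - a) * (k%:R / m.+1%:R) <= s - a.
  by rewrite mulrA ler_pdivrMr// mulrC -ler_pdivlMr.
have c2 : s - a < (b - a) * (k%:R / m.+1%:R) + e.
  have h1 : (s - a) * m.+1%:R < (k%:R + 1) * (b - a) by rewrite -ltr_pdivrMr// natr1.
  have h2 : b - a < m.+1%:R * e by rewrite -ltr_pdivrMr.
  have e1 : (b - a) * (k%:R / m.+1%:R) * m.+1%:R = (b - a) * k%:R by field.
  by rewrite -(ltr_pM2r m0) [ltRHS]mulrDl e1; move: h1 h2; lra.
move: c1 c2; move: ((b - a) * _) => x c1 c2.
have xb : a + x <= b by lra.
by rewrite (min_idPr xb) ger0_norm; lra.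
Qed.

Lemma continuous_dense_le (a b : R) (q : nat -> R) (g : R -> R) (c : \bar R) :
  (forall s, a <= s <= b -> forall e : R, 0 < e -> exists i, `|s - q i| < e) ->
  (forall i, a <= q i <= b) ->
  {within `[a, b], continuous g} -> (forall i, ((g (q i))%:E <= c)%E) ->
  forall s, a <= s <= b -> ((g s)%:E <= c)%E.
Proof.
move=> qd qab cg gq s sab; rewrite leNgt; apply/negP => lt.
move: c gq lt => [c| |]//; last by move=> /(_ 0%N).
move=> gq; rewrite lte_fin => lt.
have /subspace_continuousP/(_ s) := cg; rewrite /= in_itv/= => /(_ sab) cs.
have /cs : nbhs (g s) [set y | c < y] by exact: lt_nbhsr.
rewrite /= /within/= => /nbhs_ballP[e /= e0 he].
have [i qi] := qd s sab e e0.
have := he (q i) qi; rewrite in_itv/= => /(_ (qab i)) => h.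
by have := gq i; rewrite lee_fin leNgt h.
Qed.

Lemma within_comp_minr (W : R -> R) (c t : R) : 0 <= c ->
  {within `[0, +oo[, continuous W} ->
  {within `[0, t], continuous (fun s => W (Num.min s c))}.
Proof.
move=> c0 cW; apply/subspace_continuousP => s /=; rewrite in_itv/= => /andP[s0 st].
have /subspace_continuousP/(_ (Num.min s c)) := cW.
rewrite /= in_itv/= andbT le_min s0 c0 => /(_ isT) h.
apply: (cvg_comp _ W _ h) => U /nbhs_ballP[e /= e0 eU].
apply/nbhs_ballP; exists e => //= s' ss' /=; rewrite in_itv/= => /andP[s'0 _].
apply: eU; last by rewrite /= in_itv/= andbT le_min s'0.
move: ss'; rewrite /ball/= !ltr_norml => /andP[h1 h2].
by have [a|a] := leP s c; have [b|b] := leP s' c; apply/andP; split; lra.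
Qed.

End dense_times.

Lemma measurable_rmax d (Om : measurableType d) (R : realType) (x : nat -> Om -> R) n :
  (forall k, (k <= n)%N -> measurable_fun setT (x k)) ->
  measurable_fun setT (fun w => rmax (x ^~ w) n).
Proof.
elim: n => [|n ih] mx /=; first by apply: measurableT_comp => //; exact: mx.
apply: measurable_maxr; first by apply: ih => k kn; apply: mx; exact: leqW.
by apply: measurableT_comp => //; exact: mx.
Qed.

Lemma rmax_le (R : realType) (x : nat -> R) n b :
  (forall i, (i <= n)%N -> `|x i| <= b) -> rmax x n <= b.
Proof.
elim: n => [|n ih] xb /=; first exact: xb.
by rewrite ge_max xb// ih// => i lin; apply: xb; exact: leqW.
Qed.

(** * Fourth powers of Brownian increments, uniformly over an interval *)

Section brownian_sup.
Context d (Om : measurableType d) (R : realType) (P : probability Om R).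
Variables (F : R -> set (set Om)) (W : R -> Om -> R).
Hypotheses (usual : usual_filtration P F) (bm : brownian_motion P F W).
Local Notation E := (Ex P).

Lemma Ex_adapted_increment (s t : R) (xi : Om -> R) (phi : R -> R) :
  0 <= s -> s <= t -> adapted_to (F s) xi -> (forall w, 0 <= xi w) ->
  measurable_fun setT phi -> (forall x, 0 <= phi x) ->
  E (fun w => xi w * phi (W t w - W s w)) =
  (E xi * E (fun w => phi (W t w - W s w))%R)%E.
Proof.
move=> s0 st axi xi0 mphi phi0.
have mW := bm_increment_measurable usual bm s0 st.
apply: ge0_Ex_indepM => //.
- by apply: adapted_measurable axi; exact: (filt_sub usual).
- exact: (measurableT_comp mphi).
apply: (@indep2_comp _ _ _ _ xi (fun w => W t w - W s w) id phi) => //.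
exact: (adapted_indep2 (filt_sigma_algebra usual s0) axi (bm_independent bm s0 st)).
Qed.

(** The square of the increment from [a] is the sum of two discrete martingales, with increments
    [2 * X j * dl j] and [dl j ^+ 2 - (u j.+1 - u j)], and of the elapsed time. Doob's inequality in
    mean square for each of them bounds a fourth power without any inequality of higher order. The
    factor [xi], known at time [a], is carried along because the local errors are multiplied by the
    size of the state. *)
Lemma brownian_sup4 (a b : R) (xi : Om -> R) : 0 <= a -> a <= b ->
  adapted_to (F a) xi -> (E (fun w => xi w ^+ 2)%R < +oo)%E ->
  exists V : Om -> \bar R, [/\ measurable_fun setT V, forall w, (0 <= V w)%E,
    forall w, {within `[0, +oo[, continuous (W ^~ w)} -> forall s, a <= s <= b ->
      ((xi w ^+ 2 * (W s w - W a w) ^+ 4)%:E <= V w)%E &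
    (\int[P]_w V w <= (147 * (b - a) ^+ 2)%:E * E (fun w => xi w ^+ 2)%R)%E].
Proof.
move=> a0 ab axi xi2.
have mxi : measurable_fun setT xi by apply: adapted_measurable axi; exact: (filt_sub usual).
have [q [qab qd]] := dense_times ab.
pose c w s := xi w ^+ 2 * (W s w - W a w) ^+ 4.
have c0 w s : 0 <= c w s by rewrite mulr_ge0 ?sqr_ge0// (exprM _ 2 2) sqr_ge0.
pose x N w := rmax (fun i => c w (q i)) N.
have mW s : a <= s <= b -> measurable_fun setT (fun w => W s w - W a w).
  by move=> /andP[as_ _]; exact: (bm_increment_measurable usual bm).
have mx N : measurable_fun setT (x N).
  apply: measurable_rmax => i _; apply: measurable_funM; first exact: measurable_funX.
  by apply: measurable_funX; exact: mW.
have x0 N w : 0 <= x N w by exact: rmax_ge0.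
have xS N w : x N w <= x N.+1 w by rewrite /x/= le_max lexx.
have xb N : (E (x N) <= (147 * (b - a) ^+ 2)%:E * E (fun w => xi w ^+ 2)%R)%E.
  have ba0 : 0 <= b - a by rewrite subr_ge0.
  have [p [u [pu ptsu]]] := part_exists [seq q i - a | i <- iota 0 N.+1] ba0.
  have up j : (j <= p)%N -> 0 <= u j <= b - a by exact: part_itv.
  have u0 j : (j <= p)%N -> 0 <= u j by move=> /up /andP[].
  have au0 j : (j <= p)%N -> 0 <= a + u j by move=> /u0 h; lra.
  have uS j : (j < p)%N -> u j <= u j.+1 by exact: (part_mono pu).
  have auS j : (j < p)%N -> a + u j <= a + u j.+1 by move=> /uS; lra.
  have aau j : (j <= p)%N -> a <= a + u j by move=> /u0; lra.
  pose dl j w := W (a + u j.+1) w - W (a + u j) w.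
  pose X j w := W (a + u j) w - W a w.
  pose G j := F (a + u j).
  have axiG j : (j <= p)%N -> adapted_to (G j) xi.
    by move=> jp; apply: (adapted_sub (filt_mono usual a0 (aau j jp))).
  have aX j : (j <= p)%N -> adapted_to (G j) (X j).
    by move=> jp; apply: (bm_increment_adapted usual bm) => //; exact: aau.
  have adl j : (j < p)%N -> adapted_to (G j.+1) (dl j).
    by move=> jp; apply: (bm_increment_adapted usual bm); [apply: au0; exact: ltnW|exact: auS].
  have mX j : (j <= p)%N -> measurable_fun setT (X j).
    by move=> jp; apply: (bm_increment_measurable usual bm) => //; exact: aau.
  have Gs j : (j <= p)%N -> sigma_algebra setT (G j).
    by move=> jp; apply: (filt_sigma_algebra usual); exact: au0.
  have Gm j : (j < p)%N -> G j `<=` G j.+1.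
    by move=> jp; apply: (filt_mono usual); [apply: au0; exact: ltnW|exact: auS].
  have GM j : (j <= p)%N -> G j `<=` measurable.
    by move=> jp; apply: (filt_sub usual); exact: au0.
  pose h1 j w := xi w * (2 * X j w); pose z2 j w := dl j w ^+ 2 - (u j.+1 - u j).
  have Eh1 j : (j <= p)%N -> E (fun w => h1 j w ^+ 2) =
      ((4 * u j)%:E * E (fun w => xi w ^+ 2)%R)%E.
    move=> jp; rewrite /h1; under eq_fun do rewrite exprMn.
    rewrite (@Ex_adapted_increment a (a + u j) (fun w => xi w ^+ 2) (fun y => (2 * y) ^+ 2))//.
    + rewrite muleC; congr (_ * _)%E; under eq_fun do rewrite exprMn.
      rewrite Ex_Z//.
      * rewrite (Ex_increment_sqr usual bm)//; last exact: aau.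
        by rewrite -EFinM; congr EFin; ring.
      * by apply: measurable_funX; exact: mX.
      * by move=> w; exact: sqr_ge0.
    + exact: aau.
    + exact: measurable_funX.
    + by move=> w; exact: sqr_ge0.
    + by apply: measurable_funX; exact: measurable_funM.
    + by move=> y; exact: sqr_ge0.
  have Exi0 : (0 <= E (fun w => xi w ^+ 2)%R)%E by apply: Ex_ge0 => w; exact: sqr_ge0.
  have indep j : (j < p)%N -> forall A B, G j A -> measurable B ->
      P (A `&` dl j @^-1` B) = (P A * P (dl j @^-1` B))%E.
    move=> jp A B GA mB; apply: (bm_independent bm) => //; last exact: auS.
    by apply: au0; exact: ltnW.
  have dE j : a + u j.+1 - (a + u j) = u j.+1 - u j by ring.
  have D1 := @doob_transform _ _ _ P G h1 dl p Gs Gm GM.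
  (* The coefficient has second moment [4 * u j] times that of [xi]; with Doob's 4 and
     [u j <= b - a] this sums to [16 * (b - a) ^+ 2]. *)
  have {}D1 : (E (fun w => rmax (fun i => \sum_(j < i) h1 j w * dl j w)%R p ^+ 2)%R <=
      (16 * (b - a) ^+ 2)%:E * E (fun w => xi w ^+ 2)%R)%E.
    apply: (le_trans (D1 _ _ _ _ _ _)) => {D1}.
    - move=> j jp; apply: measurable_funM; first by apply: axiG; exact: ltnW.
      by apply: measurable_funM => //; apply: aX; exact: ltnW.
    - exact: adl.
    - exact: indep.
    - move=> j jp; apply: (Ex_increment_mean usual bm); last exact: auS.
      by apply: au0; exact: ltnW.
    - move=> j jp; rewrite (Ex_increment_sqr usual bm) ?ltry//; last exact: auS.
      by apply: au0; exact: ltnW.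
    - move=> j jp; rewrite (Eh1 j (ltnW jp)); apply: lte_mul_pinfty => //.
      by rewrite lee_fin; have := u0 j (ltnW jp); lra.
    apply: (@le_trans _ _ (\sum_(j < p) (16 * (b - a) * (u j.+1 - u j))%:E *
        E (fun w => xi w ^+ 2)%R)%E).
      apply: lee_sum => -[j jp] _ /=; rewrite (Eh1 j (ltnW jp)).
      rewrite (Ex_increment_sqr usual bm (au0 j (ltnW jp)) (auS j jp)) dE.
      rewrite muleAC -EFinM muleA -EFinM lee_wpmul2r// lee_fin.
      have /andP[h2 h3] := up j (ltnW jp); have h4 := uS j jp.
      have -> : 4 * (4 * u j * (u j.+1 - u j)) = 16 * u j * (u j.+1 - u j) by ring.
      by rewrite ler_wpM2r ?subr_ge0// ler_wpM2l.
    rewrite -ge0_sume_distrl; last first.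
      by move=> j _; rewrite lee_fin !mulr_ge0// subr_ge0 uS.
    rewrite lee_wpmul2r// sumEFin lee_fin -mulr_sumr.
    rewrite -(big_mkord xpredT (fun j => u j.+1 - u j)) telescope_sumr//.
    by rewrite (part_first pu) (part_last pu) subr0 -mulrA.
  have D2 := @doob_transform _ _ _ P G (fun=> xi) z2 p Gs Gm GM.
  (* Doob's 4 times the second moment [8 * (u j.+1 - u j) ^+ 2] of the centered square; one factor
     of the length is bounded by [b - a]. *)
  have {}D2 : (E (fun w => rmax (fun i => \sum_(j < i) xi w * z2 j w)%R p ^+ 2)%R <=
      (32 * (b - a) ^+ 2)%:E * E (fun w => xi w ^+ 2)%R)%E.
    have Ez2 j : (j < p)%N -> (E (fun w => z2 j w ^+ 2)%R <= (8 * (u j.+1 - u j) ^+ 2)%:E)%E.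
      move=> jp; have := Ex_increment_sqr_centered_sqr usual bm (au0 j (ltnW jp)) (auS j jp).
      by rewrite dE.
    apply: (le_trans (D2 _ _ _ _ _ _)) => {D2}.
    - by move=> j jp; apply: axiG; exact: ltnW.
    - by move=> j jp; apply: measurable_funB => //; apply: measurable_funX; exact: adl.
    - move=> j jp A B GA mB.
      have mB' : measurable ((fun y : R => y ^+ 2 - (u j.+1 - u j)) @^-1` B).
        rewrite -[X in measurable X]setTI.
        have mf : measurable_fun setT (fun y : R => y ^+ 2 - (u j.+1 - u j)).
          by apply: measurable_funB => //; exact: measurable_funX.
        exact: mf.
      exact: (indep j jp A _ GA mB').
    - move=> j jp; have := Ex_increment_sqr_centered usual bm (au0 j (ltnW jp)) (auS j jp).
      by rewrite dE.
    - by move=> j jp; apply: (le_lt_trans (Ez2 j jp)); rewrite ltry.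
    - by [].
    apply: (@le_trans _ _ (\sum_(j < p) (32 * (b - a) * (u j.+1 - u j))%:E *
        E (fun w => xi w ^+ 2)%R)%E).
      apply: lee_sum => -[j jp] _ /=; rewrite muleC -muleA muleC; apply: lee_wpmul2r => //.
      apply: (@le_trans _ _ ((8 * (u j.+1 - u j) ^+ 2)%:E * 4%:E)%E).
        by rewrite lee_wpmul2r// Ez2.
      rewrite -EFinM lee_fin.
      have /andP[h2 h3] := up j (ltnW jp); have /andP[h4 h5] := up j.+1 jp.
      have -> : 8 * (u j.+1 - u j) ^+ 2 * 4 = 32 * (u j.+1 - u j) * (u j.+1 - u j) by ring.
      have h6 := uS j jp; rewrite ler_wpM2r ?subr_ge0// ler_wpM2l//; lra.
    rewrite -ge0_sume_distrl; last first.
      by move=> j _; rewrite lee_fin !mulr_ge0// subr_ge0 uS.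
    rewrite lee_wpmul2r// sumEFin lee_fin -mulr_sumr.
    rewrite -(big_mkord xpredT (fun j => u j.+1 - u j)) telescope_sumr//.
    by rewrite (part_first pu) (part_last pu) subr0 -mulrA.
  pose A w := rmax (fun i => \sum_(j < i) h1 j w * dl j w)%R p.
  pose B w := rmax (fun i => \sum_(j < i) xi w * z2 j w)%R p.
  have XE j w : (j <= p)%N -> xi w * X j w ^+ 2 = \sum_(i < j) h1 i w * dl i w +
      \sum_(i < j) xi w * z2 i w + xi w * u j.
    elim: j => [_|j ih jp].
      by rewrite !big_ord0 /X (part_first pu) addr0 subrr expr0n/= !mulr0 !addr0.
    rewrite !big_ord_recr/=; have := ih (ltnW jp).
    have -> : X j.+1 w = X j w + dl j w by rewrite /X /dl; ring.
    rewrite /h1 /z2 => h; transitivity (xi w * X j w ^+ 2 +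
      (xi w * (2 * X j w) * dl j w + xi w * dl j w ^+ 2)); first by ring.
    by rewrite h; ring.
  (* The square of a sum of three terms costs a factor 3, so the final constant is
     [147 = 3 * 16 + 3 * 32 + 3]. *)
  have xle w : x N w <= 3 * A w ^+ 2 + (3 * B w ^+ 2 + 3 * (b - a) ^+ 2 * xi w ^+ 2).
    apply: rmax_le => i iN; rewrite ger0_norm//.
    have [j jp qj] : part_point p u (q i - a).
      apply: ptsu; first by apply/mapP; exists i; rewrite ?mem_iota.
      by have /andP[h2 h3] := qab i; apply/andP; split; lra.
    have -> : c w (q i) = (xi w * X j w ^+ 2) ^+ 2.
      by rewrite /c /X -qj [a + _]addrC subrK exprMn -exprM.
    rewrite XE//.
    have hA := le_rmax (fun i => \sum_(j < i) h1 j w * dl j w)%R jp.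
    have hB := le_rmax (fun i => \sum_(j < i) xi w * z2 j w)%R jp.
    have A2 : (\sum_(i < j) h1 i w * dl i w) ^+ 2 <= A w ^+ 2.
      by rewrite -(@real_normK _ (\sum_(i < j) _)) ?num_real// lerXn2r// nnegrE// (le_trans _ hA).
    have B2 : (\sum_(i < j) xi w * z2 i w) ^+ 2 <= B w ^+ 2.
      by rewrite -(@real_normK _ (\sum_(i < j) _)) ?num_real// lerXn2r// nnegrE// (le_trans _ hB).
    have u2 : u j ^+ 2 <= (b - a) ^+ 2.
      by have /andP[h2 h3] := up j jp; rewrite lerXn2r// nnegrE.
    have xu := ler_wpM2l (sqr_ge0 (xi w)) u2.
    move: A2 B2 xu; set S1 := \sum_(i < j) h1 i w * _; set S2 := \sum_(i < j) xi w * _.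
    rewrite -exprMn; set yv := xi w * u j => A2 B2 xu.
    have h1' := sqr_ge0 (S1 - S2); have h2 := sqr_ge0 (S1 - yv); have h3 := sqr_ge0 (S2 - yv).
    have -> : (S1 + S2 + yv) ^+ 2 = 3 * S1 ^+ 2 + 3 * S2 ^+ 2 + 3 * yv ^+ 2 -
      (S1 - S2) ^+ 2 - (S1 - yv) ^+ 2 - (S2 - yv) ^+ 2 by ring.
    rewrite -[3 * (b - a) ^+ 2 * _]mulrA [(b - a) ^+ 2 * _]mulrC.
    lra.
  have mdl j : (j < p)%N -> measurable_fun setT (dl j).
    by move=> jp; apply: (adapted_measurable (GM _ jp)); exact: adl.
  have mA : measurable_fun setT A.
    apply: measurable_rmax => k kp; apply: measurable_sum => -[j jk].
    have jp : (j < p)%N by exact: leq_trans kp.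
    apply: measurable_funM; last exact: mdl.
    by apply: measurable_funM => //; apply: measurable_funM => //; apply: mX; exact: ltnW.
  have mB : measurable_fun setT B.
    apply: measurable_rmax => k kp; apply: measurable_sum => -[j jk].
    apply: measurable_funM => //; apply: measurable_funB => //; apply: measurable_funX.
    by apply: mdl; exact: leq_trans kp.
  apply: (le_trans (Ex_le P _ xle)).
    exact: x0.
  have sq0 (Z : Om -> R) w : 0 <= 3 * Z w ^+ 2 by rewrite mulr_ge0// sqr_ge0.
  have sq1 w : 0 <= 3 * (b - a) ^+ 2 * xi w ^+ 2.
    by apply: mulr_ge0; [apply: mulr_ge0 => //; exact: sqr_ge0|exact: sqr_ge0].
  have msq (Z : Om -> R) k : measurable_fun setT Z -> measurable_fun setT (fun w => k * Z w ^+ 2).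
    by move=> mZ; apply: measurable_funM; [exact: measurable_cst|exact: measurable_funX].
  have mS : measurable_fun setT (fun w => 3 * B w ^+ 2 + 3 * (b - a) ^+ 2 * xi w ^+ 2).
    by apply: measurable_funD; exact: msq.
  have S0 w : 0 <= 3 * B w ^+ 2 + 3 * (b - a) ^+ 2 * xi w ^+ 2 by rewrite addr_ge0 ?sq0.
  rewrite (Ex_D _ (msq A 3 mA) (sq0 A) mS S0).
  rewrite (Ex_D _ (msq B 3 mB) (sq0 B) (msq xi _ mxi) sq1).
  have Z2 (Z : Om -> R) w : 0 <= Z w ^+ 2 by exact: sqr_ge0.
  have mZ2 (Z : Om -> R) : measurable_fun setT Z -> measurable_fun setT (fun w => Z w ^+ 2).
    by move=> mZ; exact: measurable_funX.
  rewrite !Ex_Z ?mulr_ge0 ?sqr_ge0//; do ?[exact: mZ2|exact: Z2].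
  apply: (@le_trans _ _ (3%:E * ((16 * (b - a) ^+ 2)%:E * E (fun w => xi w ^+ 2)%R) +
     (3%:E * ((32 * (b - a) ^+ 2)%:E * E (fun w => xi w ^+ 2)%R) +
      (3 * (b - a) ^+ 2)%:E * E (fun w => xi w ^+ 2)%R))%E).
    by apply: leeD; [|apply: leeD => //]; rewrite lee_wpmul2l.
  have /fineK <- : E (fun w => xi w ^+ 2) \is a fin_num by rewrite ge0_fin_numE.
  by rewrite -!EFinM -!EFinD lee_fin; lra.
have [V [mV V0 xV VE]] := monotone_envelope mx x0 xS xb.
exists V; split => // w cW s sab.
apply: (@continuous_dense_le _ a b q (c w)) => //.
  have cab : {within `[a, b], continuous (W ^~ w)}.
    apply: continuous_subspaceW cW => u /=.
    by rewrite !in_itv/= andbT => /andP[/(le_trans a0)].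
  move=> u; apply: cvgM; first exact: cvg_cst.
  apply: (cvg_comp _ (fun z => z ^+ 4)); last exact: exprn_continuous.
  by apply: cvgB; [exact: cab|exact: cvg_cst].
move=> i; apply: le_trans (xV i w); rewrite lee_fin.
by apply: le_trans (le_rmax (fun i => c w (q i)) (leqnn i)); rewrite ger0_norm.
Qed.

End brownian_sup.

(** * One step of the scheme *)

Section one_step.
Context {R : realType}.
Variables (f g : R -> R) (theta eta K : R).
Let h x := eta * g x * derive1 g x.
Hypotheses (K1 : 1 <= K) (theta01 : 0 <= theta <= 1) (eta01 : 0 <= eta <= 1)
  (dg : forall x, derivable g x 1)
  (f_lip : forall x z, `|f x - f z| <= K * `|x - z|)
  (g_lip : forall x z, `|g x - g z| <= K * `|x - z|)
  (h_lip : forall x z, `|h x - h z| <= K * `|x - z|)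
  (f_lin : forall x, `|f x| <= K * (1 + `|x|))
  (g_lin : forall x, `|g x| <= K * (1 + `|x|))
  (h_lin : forall x, `|h x| <= K * (1 + `|x|)).

Let K0 : 0 <= K. Proof. exact: le_trans K1. Qed.

(* Apply the mean value theorem to [eta * g ^ 2 / 2], whose derivative [h] is
   Lipschitz whereas [g'] need not be. *)
Lemma taylor_defect_le x s :
  `|eta * (g (x + g x * s) - g x) - h x * s| <= 2 * K ^+ 2 * `|g x| * s ^+ 2.
Proof.
set b := g x; set a := g (x + b * s).
have ab : `|a - b| <= K * (`|b| * `|s|).
  by rewrite -normrM; apply: le_trans (g_lip _ _) _; rewrite addrAC subrr add0r.
have [b0|b0] := eqVneq b 0.
  move: ab; rewrite b0 normr0 mul0r mulr0 normr_le0 subr_eq0 => /eqP ->.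
  by rewrite /h -/b b0 (_ : _ - _ = 0) ?normr0 ?mulr0 ?mul0r//; ring.
pose G y := eta / 2 * (g y ^+ 2).
have dG (y : R) : is_derive y 1 G (h y).
  have dgy : is_derive (y : R) 1 g (derive1 g y).
    by rewrite derive1E; exact: derivableP.
  have -> : G = eta / 2 \*: (g * g : R -> R).
    by apply/funext => z; rewrite /G /= expr2.
  have -> : h y = eta / 2 *: (g y *: derive1 g y + g y *: derive1 g y).
    by rewrite /h /GRing.scale/=; field.
  exact: is_deriveZ.
have cG : continuous (G : R -> R) by move=> y; apply/differentiable_continuous/derivable1_diffP; case: (dG y).
have mvt : `|G (x + b * s) - G x - h x * (b * s)| <= K * (b * s) ^+ 2.
  have key u v : u <= v -> exists2 c, c \in `[u, v]%R & G v - G u = h c * (v - u).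
    move=> uv; apply: (@MVT_segment _ G h u v uv).
    by apply: continuous_subspaceT => y; exact: cG.
  have [p|p] := leP 0 (b * s).
    have [|c] := key x (x + b * s); first by rewrite lerDl.
    rewrite in_itv/= => /andP[c1 c2] ->.
    rewrite [x + _ - x]addrAC subrr add0r -mulrBl normrM expr2 mulrA ler_pM//; last by rewrite ger0_norm.
    apply: le_trans (h_lip _ _) _; rewrite ler_wpM2l// ger0_norm ?subr_ge0//.
    by rewrite lerBlDl.
  have [|c] := key (x + b * s) x; first by rewrite gerDl ltW.
  rewrite in_itv/= => /andP[c1 c2] e.
  have -> : G (x + b * s) - G x - h x * (b * s) = (h c - h x) * (b * s).
    by rewrite -[G (x + _) - _]opprB e; ring.
  have -> : K * (b * s) ^+ 2 = K * - (b * s) * - (b * s) by ring.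
  rewrite normrM ler_pM//; last by rewrite ltr0_norm.
  apply: le_trans (h_lip _ _) _; rewrite ler_wpM2l// ler0_norm ?subr_le0//; lra.
have bn0 : 0 < `|b| by rewrite normr_gt0.
(* After multiplication by [b = g x] the difference of [g] becomes a difference of squares:
   [b * eta * (a - b)] is the increment of [G] minus [eta / 2 * (a - b) ^+ 2]. This is where [b]
   must be nonzero; for [b = 0] both sides vanish. *)
rewrite -(ler_pM2l bn0) -normrM.
have -> : b * (eta * (a - b) - h x * s) =
    (G (x + b * s) - G x - h x * (b * s)) - eta / 2 * (a - b) ^+ 2.
  by rewrite /G -/b -/a; field.
apply: le_trans (ler_normB _ _) _.
have ab2 : (a - b) ^+ 2 <= K ^+ 2 * (`|b| ^+ 2 * s ^+ 2).
  rewrite -(real_normK (num_real s)) -!exprMn -(real_normK (num_real (a - b))).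
  by rewrite lerXn2r// nnegrE// !mulr_ge0.
have e2 : `|eta / 2 * (a - b) ^+ 2| <= (a - b) ^+ 2.
  case/andP: eta01 => e0 e1.
  have e3 : 0 <= eta / 2 by rewrite divr_ge0.
  rewrite normrM (ger0_norm e3) (ger0_norm (sqr_ge0 _)).
  by rewrite ler_piMl ?sqr_ge0//; lra.
have KK : K <= K ^+ 2 by rewrite expr2 ler_peMl.
have m2 : K * (b * s) ^+ 2 <= K ^+ 2 * (`|b| ^+ 2 * s ^+ 2).
  by rewrite real_normK ?num_real// exprMn ler_wpM2r// mulr_ge0 ?sqr_ge0.
have -> : `|b| * (2 * K ^+ 2 * `|b| * s ^+ 2) = 2 * (K ^+ 2 * (`|b| ^+ 2 * s ^+ 2)) by ring.
lra.
Qed.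

Variables (x dl s : R).
Hypotheses (dl0 : 0 <= dl) (dl1 : dl <= 1).
Let q := 1 + `|x|.
Let xt := x + f x * dl + g x * s.
Let q1 : 1 <= q. Proof. by rewrite /q lerDl. Qed.
Let q0 : 0 <= q. Proof. exact: le_trans q1. Qed.
Let theta_le z : `|theta * z| <= `|z|.
Proof. by case/andP: theta01 => t0 t1; rewrite normrM ger0_norm// ler_piMl. Qed.
Let eta_le z : `|eta * z| <= `|z|.
Proof. by case/andP: eta01 => t0 t1; rewrite normrM ger0_norm// ler_piMl. Qed.

Let xt_le : `|xt - x| <= K * q * (dl + `|s|).
Proof.
have -> : xt - x = f x * dl + g x * s by rewrite /xt; ring.
apply: le_trans (ler_normD _ _) _; rewrite !normrM (ger0_norm dl0) mulrDr.
by rewrite lerD// ler_wpM2r.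
Qed.

Let lip_le (phi : R -> R) : (forall x z, `|phi x - phi z| <= K * `|x - z|) ->
  `|phi xt - phi x| <= K ^+ 2 * q * (dl + `|s|).
Proof.
move=> H; apply: le_trans (H _ _) _.
by rewrite expr2 -!mulrA ler_wpM2l// mulrA.
Qed.

Lemma rem1_le : `|theta * (f xt - f x)| <= K ^+ 2 * q * (dl + `|s|).
Proof. by apply: le_trans (theta_le _) _; exact: lip_le. Qed.

Lemma rem2_le : `|theta * (h xt - h x)| <= K ^+ 2 * q * (dl + `|s|).
Proof. by apply: le_trans (theta_le _) _; exact: lip_le. Qed.

Lemma rem4_le : `|eta * (g xt - g x)| <= K ^+ 2 * q * (dl + `|s|).
Proof. by apply: le_trans (eta_le _) _; exact: lip_le. Qed.

(** The expression is the whole remainder of a step minus [h x * (s ^+ 2 - dl)]. With [s] of order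
    [sqrt dl] it has order [3 / 2] in [dl], so adding up about [1 / dl] such terms leaves order
    [1 / 2] with no cancellation required. *)
Lemma rem_defect_le :
  `|(theta * (f xt - f x) - theta * (h xt - h x)) * dl +
    (eta * (g xt - g x) * s - h x * s ^+ 2)| <=
  3 * K ^+ 3 * q * (dl ^+ 2 + dl * `|s| + `|s| ^+ 3).
Proof.
(* The predictor is compared with [x + g x * s] first, since the Taylor estimate concerns the
   diffusive part of the step only; the neglected drift costs [dl * |s|]. *)
have -> : eta * (g xt - g x) * s - h x * s ^+ 2 =
    eta * (g xt - g (x + g x * s)) * s +
    (eta * (g (x + g x * s) - g x) - h x * s) * s by ring.
have a1 : `|(theta * (f xt - f x) - theta * (h xt - h x)) * dl| <=
    2 * (K ^+ 2 * q * (dl + `|s|)) * dl.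
  rewrite normrM (ger0_norm dl0) ler_wpM2r//.
  by apply: le_trans (ler_normB _ _) _; have := rem1_le; have := rem2_le; lra.
have a2 : `|eta * (g xt - g (x + g x * s)) * s| <= K ^+ 2 * q * dl * `|s|.
  rewrite normrM ler_wpM2r//; apply: le_trans (eta_le _) _.
  apply: le_trans (g_lip _ _) _.
  have -> : xt - (x + g x * s) = f x * dl by rewrite /xt; ring.
  by rewrite normrM (ger0_norm dl0) expr2 -!mulrA ler_wpM2l// mulrA ler_wpM2r.
have a3 : `|(eta * (g (x + g x * s) - g x) - h x * s) * s| <= 2 * K ^+ 3 * q * `|s| ^+ 3.
  rewrite normrM.
  have -> : 2 * K ^+ 3 * q * `|s| ^+ 3 = 2 * K ^+ 2 * (K * q) * s ^+ 2 * `|s|.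
    by rewrite -(real_normK (num_real s)); ring.
  rewrite ler_wpM2r//; apply: le_trans (taylor_defect_le _ _) _.
  by rewrite ler_wpM2r ?sqr_ge0// ler_wpM2l ?mulr_ge0 ?sqr_ge0.
apply: le_trans (ler_normD _ _) _; apply: le_trans (lerD a1 (ler_normD _ _)) _.
have KK : K ^+ 2 * q <= K ^+ 3 * q by rewrite ler_wpM2r// exprS ler_peMl ?sqr_ge0.
have c1 := ler_wpM2r (sqr_ge0 dl) KK.
have c2 : K ^+ 2 * q * (dl * `|s|) <= K ^+ 3 * q * (dl * `|s|).
  by rewrite ler_wpM2r// mulr_ge0.
have c3 : 0 <= K ^+ 3 * q * `|s| ^+ 3 by rewrite !mulr_ge0 ?exprn_ge0.
have c4 : 0 <= K ^+ 2 * q * dl ^+ 2 by rewrite !mulr_ge0 ?sqr_ge0.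
have c5 : 0 <= K ^+ 2 * q * (dl * `|s|) by rewrite !mulr_ge0 ?sqr_ge0.
lra.
Qed.

Let drift := theta * (f xt - f x) - theta * (h xt - h x) - h x.
Let diff := eta * (g xt - g x).

Let KK2 : K <= K ^+ 2. Proof. by rewrite expr2 ler_peMl. Qed.
Let Kq_ge0 : 0 <= K ^+ 2 * q. Proof. by rewrite mulr_ge0 ?sqr_ge0. Qed.
Let dls : dl * `|s| <= dl ^+ 2 / 2 + s ^+ 2 / 2.
Proof.
have := sqr_ge0 (dl - `|s|); rewrite sqrrB real_normK ?num_real//; lra.
Qed.
Let dl2 : dl ^+ 2 <= dl. Proof. by rewrite expr2 ler_piMl. Qed.

Lemma rem_drift_le : `|drift| <= 3 * K ^+ 2 * q * (1 + `|s|).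
Proof.
have h1 := rem1_le; have h2 := rem2_le; have h3 := h_lin x.
have h4 : K * (1 + `|x|) <= K ^+ 2 * q by rewrite ler_wpM2r.
have h5 : K ^+ 2 * q * (dl + `|s|) <= K ^+ 2 * q * (1 + `|s|) by rewrite ler_wpM2l// lerD2r.
have h6 : 0 <= K ^+ 2 * q * `|s| by rewrite mulr_ge0.
rewrite /drift; apply: le_trans (ler_normB _ _) _.
apply: le_trans (lerD (ler_normB _ _) (lexx _)) _.
lra.
Qed.

Lemma rem_within_sqr_le u v : 0 <= u <= dl ->
  (drift * u + diff * v) ^+ 2 <= 56 * K ^+ 4 * (q ^+ 2 * (dl ^+ 2 + s ^+ 4 + v ^+ 4)).
Proof.
case/andP=> u0 ud.
have b1 : `|drift * u| <= 3 * K ^+ 2 * q * (dl + dl * `|s|).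
  rewrite normrM (ger0_norm u0) (_ : dl + dl * `|s| = (1 + `|s|) * dl); last by ring.
  by rewrite mulrA ler_pM// rem_drift_le.
have b2 : `|diff * v| <= K ^+ 2 * q * (dl * `|v| + `|s| * `|v|).
  by rewrite normrM -mulrDl mulrA ler_wpM2r// rem4_le.
have b : `|drift * u + diff * v| <= K ^+ 2 * q *
    (3 * dl + 3 * (dl * `|s|) + dl * `|v| + `|s| * `|v|).
  by apply: le_trans (ler_normD _ _) _; apply: le_trans (lerD b1 b2) _; lra.
set a := `|s|; set b' := `|v|.
have sa : s ^+ 4 = a ^+ 4 by rewrite /a -normrX ger0_norm// (exprM _ 2 2) sqr_ge0.
have vb : v ^+ 4 = b' ^+ 4 by rewrite /b' -normrX ger0_norm// (exprM _ 2 2) sqr_ge0.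
rewrite sa vb -(real_normK (num_real (_ + _))).
apply: (@le_trans _ _ ((K ^+ 2 * q * (3 * dl + 3 * (dl * a) + dl * b' + a * b')) ^+ 2)).
  by rewrite lerXn2r// nnegrE// (le_trans _ b).
have -> : 56 * K ^+ 4 * (q ^+ 2 * (dl ^+ 2 + a ^+ 4 + b' ^+ 4)) =
  (K ^+ 2 * q) ^+ 2 * (56 * (dl ^+ 2 + a ^+ 4 + b' ^+ 4)) by ring.
rewrite exprMn ler_wpM2l ?sqr_ge0//.
(* After the Cauchy-Schwarz inequality for four terms, [dl ^+ 2] collects
   [4 * (9 + 9 / 2 + 1 / 2) = 56], the largest of the three coefficients. *)
pose e i := nth 0 [:: 3 * dl; 3 * (dl * a); dl * b'; a * b'] i.
have := sqr_sum_le 4 e; rewrite !big_ord_recr !big_ord0/= /e/= !add0r => h4.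
apply: le_trans h4 _; rewrite !exprMn.
have d4 : dl ^+ 4 <= dl ^+ 2 by rewrite (exprD _ 2 2) ler_piMl ?sqr_ge0// exprn_ile1.
have c1 := sqr_ge0 (dl ^+ 2 - a ^+ 2); have c2 := sqr_ge0 (dl ^+ 2 - b' ^+ 2).
have c3 := sqr_ge0 (a ^+ 2 - b' ^+ 2); have c4 := sqr_ge0 (b' ^+ 2); have c5 := sqr_ge0 (a ^+ 2).
have c6 := sqr_ge0 dl.
lra.
Qed.

(** Displacement inside a step: [v] is the increment up to the current time, [s] the one over the
    full step, which enters through the predictor. The constant is [171 = 3 + 3 * 56]. *)
Lemma within_sqr_le u v : 0 <= u <= dl ->
  ((f x + drift) * u + (g x + diff) * v) ^+ 2 <=
  171 * K ^+ 4 * (q ^+ 2 * (dl + v ^+ 2 + s ^+ 4 + v ^+ 4)).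
Proof.
move=> ud; have h1 := rem_within_sqr_le v ud.
have /andP[u0 ud'] := ud.
have sq3 (a b c : R) : (a + b + c) ^+ 2 <= 3 * a ^+ 2 + 3 * b ^+ 2 + 3 * c ^+ 2.
  by have := sqr_ge0 (a - b); have := sqr_ge0 (a - c); have := sqr_ge0 (b - c); lra.
have -> : (f x + drift) * u + (g x + diff) * v =
  f x * u + g x * v + (drift * u + diff * v) by ring.
apply: le_trans (sq3 _ _ _) _.
have p1 (phi : R -> R) : (forall x, `|phi x| <= K * (1 + `|x|)) ->
    phi x ^+ 2 <= K ^+ 4 * q ^+ 2.
  move=> H; rewrite -(real_normK (num_real (phi x))) (exprM _ 2 2) -exprMn.
  by rewrite lerXn2r// ?nnegrE//; apply: le_trans (H x) _; rewrite ler_wpM2r.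
have Kq : 0 <= K ^+ 4 * q ^+ 2 by rewrite mulr_ge0 ?sqr_ge0// exprn_ge0.
have f2 : (f x * u) ^+ 2 <= K ^+ 4 * q ^+ 2 * dl.
  rewrite exprMn ler_pM ?sqr_ge0// ?p1//; apply: le_trans dl2.
  by rewrite lerXn2r.
have g2 : (g x * v) ^+ 2 <= K ^+ 4 * q ^+ 2 * v ^+ 2.
  by rewrite exprMn ler_wpM2r ?sqr_ge0// p1.
have d2 := ler_wpM2l Kq dl2.
have s4 : 0 <= K ^+ 4 * q ^+ 2 * s ^+ 4 by rewrite mulr_ge0// (exprM _ 2 2) sqr_ge0.
have v4 : 0 <= K ^+ 4 * q ^+ 2 * v ^+ 4 by rewrite mulr_ge0// (exprM _ 2 2) sqr_ge0.
have v2 := mulr_ge0 Kq (sqr_ge0 v).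
lra.
Qed.

(** The only term of order [sqrt dl] is the one linear in [s] with coefficient [x * g x]. It is kept
    with its sign, because its mean vanishes; everything else is of order [dl]. The constant comes
    from [14 + 196 = 210], doubled by [q ^+ 2 <= 2 * (1 + x ^+ 2)]. *)
Lemma step_sqr_le :
  1 + (x + f x * dl + g x * s + (drift * dl + diff * s)) ^+ 2 <=
  (1 + x ^+ 2) + 420 * K ^+ 4 * ((1 + x ^+ 2) * (dl + s ^+ 2 + s ^+ 4)) + 2 * (x * g x) * s.
Proof.
pose e := f x * dl + (drift * dl + diff * s).
have e_le : `|e| <= 7 * K ^+ 2 * q * (dl + s ^+ 2).
  have h1 := rem_drift_le; have h2 := rem4_le; have h3 := f_lin x.
  have h4 : K * (1 + `|x|) * dl <= K ^+ 2 * q * dl by rewrite !ler_wpM2r.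
  have h5 : `|f x * dl| <= K ^+ 2 * q * dl.
    by rewrite normrM (ger0_norm dl0); apply: le_trans h4; rewrite ler_wpM2r.
  have h6 : `|drift * dl| <= 3 * K ^+ 2 * q * (1 + `|s|) * dl.
    by rewrite normrM (ger0_norm dl0) ler_wpM2r.
  have h7 : `|diff * s| <= K ^+ 2 * q * (dl + `|s|) * `|s| by rewrite normrM ler_wpM2r.
  rewrite /e; apply: le_trans (ler_normD _ _) _.
  apply: le_trans (lerD h5 (ler_normD _ _)) _.
  have h8 := ler_wpM2l Kq_ge0 dls; have h9 := ler_wpM2l Kq_ge0 dl2.
  have h10 := mulr_ge0 Kq_ge0 (sqr_ge0 s); have h11 := mulr_ge0 Kq_ge0 dl0.
  have h12 : K ^+ 2 * q * (dl + `|s|) * `|s| = K ^+ 2 * q * (dl * `|s|) + K ^+ 2 * q * s ^+ 2.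
    by rewrite -(real_normK (num_real s)); ring.
  rewrite h12 in h7; lra.
have -> : x + f x * dl + g x * s + (drift * dl + diff * s) = x + g x * s + e.
  by rewrite /e; ring.
have xe : x * e <= q * (7 * K ^+ 2 * q * (dl + s ^+ 2)).
  apply: le_trans (ler_norm _) _; rewrite normrM ler_pM//.
  by rewrite /q lerDr.
have g2 : (g x * s) ^+ 2 <= K ^+ 2 * q ^+ 2 * s ^+ 2.
  rewrite exprMn ler_wpM2r ?sqr_ge0// -(real_normK (num_real (g x))) -exprMn.
  by rewrite lerXn2r ?nnegrE// mulr_ge0.
have e2 : e ^+ 2 <= (7 * K ^+ 2 * q * (dl + s ^+ 2)) ^+ 2.
  rewrite -(real_normK (num_real e)) lerXn2r ?nnegrE//.
  by rewrite (le_trans _ e_le).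
have q2 : q ^+ 2 <= 2 * (1 + x ^+ 2).
  by rewrite -(real_normK (num_real x)) /q; have := sqr_ge0 (1 - `|x|); lra.
have KK4 : K ^+ 2 <= K ^+ 4 by rewrite (exprD _ 2 2) ler_peMl ?sqr_ge0// exprn_ege1.
have qs0 : 0 <= q ^+ 2 by exact: sqr_ge0.
have s2 := sqr_ge0 s; have s4 : 0 <= s ^+ 4 by rewrite (exprM _ 2 2) sqr_ge0.
have KK4q := ler_wpM2r qs0 KK4.
have K4 : 0 <= K ^+ 4 by rewrite exprn_ge0.
have a1 := ler_wpM2r dl0 KK4q; have a2 := ler_wpM2r s2 KK4q.
have t0 : 0 <= dl + s ^+ 2 + s ^+ 4 by rewrite !addr_ge0.
have a3 := ler_wpM2l K4 (ler_wpM2r t0 q2).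
have a4 : K ^+ 4 * q ^+ 2 * (dl * s ^+ 2) <= K ^+ 4 * q ^+ 2 * (dl / 2 + s ^+ 4 / 2).
  rewrite ler_wpM2l ?mulr_ge0//; have := sqr_ge0 (dl - s ^+ 2); have := dl2; lra.
have a5 : K ^+ 4 * q ^+ 2 * dl ^+ 2 <= K ^+ 4 * q ^+ 2 * dl by rewrite ler_wpM2l ?mulr_ge0.
have Kq4 : 0 <= K ^+ 4 * q ^+ 2 by rewrite mulr_ge0.
have a6 := mulr_ge0 Kq4 dl0; have a7 := mulr_ge0 Kq4 s2; have a8 := mulr_ge0 Kq4 s4.
have sq2 := sqr_ge0 (g x * s - e).
have -> : (x + g x * s + e) ^+ 2 = x ^+ 2 + 2 * (x * g x) * s + 2 * (x * e) +
  (2 * (g x * s) ^+ 2 + 2 * e ^+ 2 - (g x * s - e) ^+ 2) by ring.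
lra.
Qed.

End one_step.

(** * The grid and the scheme along a path *)

Section grid.
Context {R : realType}.
Local Notation mu := (@lebesgue_measure R).
Variables (T Delta : R).
Hypotheses (T0 : 0 < T) (D0 : 0 < Delta).
Local Notation tau := (grid T Delta).

(** Enough cells to reach [T]. When [T / Delta] is an integer the last cell is empty, since the grid
    then stays at [T]. *)
Definition grid_size : nat := (Num.truncn (T / Delta)).+1.

Lemma grid_ge0 k : 0 <= tau k.
Proof. by rewrite /grid le_min mulr_ge0// ltW. Qed.

Lemma grid_le k : tau k <= T.
Proof. by rewrite /grid ge_min lexx orbT. Qed.

Lemma grid_homo j k : (j <= k)%N -> tau j <= tau k.
Proof.
move=> jk; rewrite /grid le_min !ge_min lexx orbT andbT.
by rewrite ler_wpM2r ?ler_nat// ltW.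
Qed.

Lemma grid_step k : 0 <= tau k.+1 - tau k <= Delta.
Proof.
rewrite subr_ge0 grid_homo//= lerBlDl.
have e : k.+1%:R * Delta = k%:R * Delta + Delta by rewrite -natr1 mulrDl mul1r.
rewrite /grid e; have [h|h] := leP (k%:R * Delta) T; rewrite ge_min.
  by rewrite lexx.
by rewrite lerDl (ltW D0) orbT.
Qed.

Lemma grid0 : tau 0 = 0.
Proof. by rewrite /grid mul0r; apply/min_idPl; exact: ltW. Qed.

Lemma grid_eq k : (k < grid_size)%N -> tau k = k%:R * Delta.
Proof.
rewrite ltnS => kn; apply/min_idPl; rewrite -ler_pdivlMr//.
apply: (@le_trans _ _ (Num.truncn (T / Delta))%:R); first by rewrite ler_nat.
by have /andP[] := truncn_itv (divr_ge0 (ltW T0) (ltW D0)).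
Qed.

Lemma grid_size_le : grid_size%:R * Delta <= T + Delta.
Proof.
rewrite /grid_size -natr1 mulrDl mul1r lerD2r -ler_pdivlMr//.
by have /andP[] := truncn_itv (divr_ge0 (ltW T0) (ltW D0)).
Qed.

Lemma grid_index_itv t : 0 <= t ->
  (grid_index Delta t)%:R * Delta <= t < (grid_index Delta t).+1%:R * Delta.
Proof.
by move=> t0; rewrite -ler_pdivlMr// -ltr_pdivrMr// truncn_itv// divr_ge0// ltW.
Qed.

Lemma grid_indexP t k : k%:R * Delta <= t < k.+1%:R * Delta -> grid_index Delta t = k.
Proof.
by move=> h; apply: truncn_def; rewrite ler_pdivlMr// ltr_pdivrMr.
Qed.

Lemma grid_index_size t : t <= T -> (grid_index Delta t < grid_size)%N.
Proof. by move=> tT; rewrite ltnS le_truncn// ler_pM2r ?invr_gt0. Qed.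

Lemma grid_index_eq t : 0 <= t <= T -> tau (grid_index Delta t) = (grid_index Delta t)%:R * Delta.
Proof. by move=> /andP[_ tT]; rewrite grid_eq// grid_index_size. Qed.

Lemma grid_index_le t : 0 <= t <= T -> tau (grid_index Delta t) <= t.
Proof.
by move=> tT; rewrite grid_index_eq//; case/andP: tT => /grid_index_itv/andP[].
Qed.

Lemma grid_index_ge t : 0 <= t <= T -> t <= tau (grid_index Delta t).+1.
Proof.
by case/andP=> /grid_index_itv/andP[_ h] tT; rewrite /grid le_min tT ltW.
Qed.

Lemma grid_index_gt t : 0 <= t -> t < T -> t < tau (grid_index Delta t).+1.
Proof. by move=> /grid_index_itv/andP[_ h] tT; rewrite /grid lt_min tT h. Qed.

(** At [t = T] every indicator vanishes, as all cells are open on the right and end by [T]. This is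
    why the later pointwise estimates are made for times before [T]; the end point is negligible for
    time integrals. *)
Lemma grid_indicator t k : 0 <= t < T ->
  \1_(`[tau k, tau k.+1[%classic) t = (k == grid_index Delta t)%:R :> R.
Proof.
move=> /andP[t0 tT]; rewrite indicE; congr (_ %:R); congr nat_of_bool.
apply/idP/idP => [|/eqP ->]; last first.
  by rewrite inE/= in_itv/= grid_index_le ?t0 ?(ltW tT)// grid_index_gt.
rewrite inE/= in_itv/= => /andP[h1 h2].
have {}h1 : k%:R * Delta <= t.
  by move: h1; rewrite /grid ge_min => /orP[//|]; rewrite leNgt tT.
have {}h2 : t < k.+1%:R * Delta by move: h2; rewrite /grid lt_min => /andP[].
by rewrite (@grid_indexP t k) ?h1.
Qed.

Lemma step_value_grid v t : 0 <= t < T ->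
  step_value grid_size tau v t = v (grid_index Delta t).
Proof.
move=> tT; rewrite /step_value; under eq_bigr do rewrite grid_indicator//.
have k : (grid_index Delta t < grid_size)%N by apply: grid_index_size; case/andP: tT => _ /ltW.
rewrite (bigD1 (Ordinal k))//= eqxx mulr1 big1 ?addr0// => i ik.
case: eqP => [e|]; last by rewrite mulr0.
by case/eqP: ik; apply: val_inj.
Qed.

(** Increments over cells that begin after [t] are zero, so any number of terms beyond the current
    cell gives the same value. This reconciles the time-dependent number of terms in the scheme with
    a fixed one. *)
Lemma step_integral_grid v (x : R -> R) t n : 0 <= t <= T ->
  (grid_index Delta t < n)%N ->
  step_integral n tau v x t =
  \sum_(k < grid_index Delta t) v k * (x (tau k.+1) - x (tau k)) +
  v (grid_index Delta t) * (x t - x (tau (grid_index Delta t))).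
Proof.
move=> tT; set ka := grid_index Delta t => kn.
have lo k : (k <= ka)%N -> Num.min t (tau k) = tau k.
  by move=> kka; apply/min_idPr; apply: le_trans (grid_index_le tT); exact: grid_homo.
have hi k : (ka < k)%N -> Num.min t (tau k) = t.
  by move=> kka; apply/min_idPl; apply: (le_trans (grid_index_ge tT)); exact: grid_homo.
elim: n kn => // n ih; rewrite ltnS leq_eqVlt => /orP[/eqP <-|kn].
  rewrite /step_integral big_ord_recr/= hi// lo//; congr (_ + _).
  by apply: eq_bigr => -[k kk] _ /=; rewrite !lo// ltnW.
rewrite -ih// /step_integral big_ord_recr/= !hi ?subrr ?mulr0 ?addr0//.
exact: leqW.
Qed.

Lemma grid_step_function v t s : 0 <= s <= t ->
  v (grid_index Delta s) = \sum_(k < (grid_index Delta t).+1)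
    v k * \1_(`[k%:R * Delta, k.+1%:R * Delta[%classic) s :> R.
Proof.
move=> /andP[s0 st].
have k : (grid_index Delta s < (grid_index Delta t).+1)%N.
  by rewrite ltnS le_truncn// ler_pM2r ?invr_gt0.
rewrite (bigD1 (Ordinal k))//= indicE mem_set/=; last by rewrite in_itv/= grid_index_itv.
rewrite mulr1 big1 ?addr0// => i ik; rewrite indicE memNset ?mulr0//=.
rewrite in_itv/= => /grid_indexP h; case/eqP: ik; exact: val_inj.
Qed.

Let indic_integrable t c k : mu.-integrable `[0, t]%classic
  (EFin \o (fun s => c * \1_(`[k%:R * Delta, k.+1%:R * Delta[%classic) s)).
Proof.
apply: (@integrableS _ _ _ _ setT) => //.
have -> : EFin \o (fun s => c * \1_(`[k%:R * Delta, k.+1%:R * Delta[%classic) s) =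
  (fun s => c%:E * (\1_(`[k%:R * Delta, k.+1%:R * Delta[%classic) s)%:E)%E.
  by apply/funext => s /=; rewrite EFinM.
apply: integrableZl => //; exact: integrable_indic_itv.
Qed.

Lemma grid_step_integrable v t : mu.-integrable `[0, t]%classic
  (EFin \o (fun s => v (grid_index Delta s))).
Proof.
have h : mu.-integrable `[0, t]%classic (fun s => \sum_(k < (grid_index Delta t).+1)
    (v k * \1_(`[k%:R * Delta, k.+1%:R * Delta[%classic) s)%:E)%E.
  by apply: integrable_sum => // k _; exact: indic_integrable.
apply: eq_integrable h => // s; rewrite inE/= in_itv/= => st.
by rewrite sumEFin -grid_step_function.
Qed.

(** Time integrals become step integrals against the identity path, so that [dt] and [dW] terms can
    be expanded by the same formula. *)
Lemma grid_step_Rintegral v t : 0 <= t <= T ->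
  \int[mu]_(s in `[0, t]) v (grid_index Delta s) =
  step_integral (grid_index Delta t).+1 tau v id t.
Proof.
move=> tT; have /andP[t0 tleT] := tT; rewrite /Rintegral.
under eq_integral => s.
  rewrite inE/= in_itv/= => st; rewrite (grid_step_function v st) -sumEFin; over.
rewrite integral_sum//=; last by move=> k; exact: indic_integrable.
have key k : (\int[mu]_(s in `[0%R, t]) (v k * \1_(`[k%:R * Delta, k.+1%:R * Delta[%classic) s)%R%:E)%E =
    (v k * (Num.min t (tau k.+1) - Num.min t (tau k)))%:E.
  under eq_integral do rewrite EFinM.
  rewrite integralZl//; last first.
    by have := indic_integrable t 1 k; congr (_.-integrable _ _); apply/funext => s /=; rewrite mul1r.
  rewrite integral_indic//.
  have mn j : Num.min t (tau j) = Num.min t (j%:R * Delta).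
    by rewrite /grid minCA (min_idPl tleT) minC.
  have jj : k%:R * Delta <= k.+1%:R * Delta by rewrite ler_wpM2r ?ler_nat// ltW.
  have k0 : 0 <= k%:R * Delta by rewrite mulr_ge0// ltW.
  rewrite !mn; have [h|h] := leP (k%:R * Delta) t; last first.
    rewrite (min_idPl _); last by rewrite (le_trans (ltW h)).
    rewrite subrr mulr0 (_ : _ `&` _ = set0) ?measure0 ?mule0//.
    rewrite -subset0 => s [] /=; rewrite !in_itv/= => /andP[h1 _] /andP[_ h2].
    by move: (le_trans h1 h2); rewrite leNgt h.

  have [h'|h'] := ltP t (k.+1%:R * Delta).
    have -> : `[k%:R * Delta, k.+1%:R * Delta[%classic `&` `[0, t]%classic =
        `[k%:R * Delta, t]%classic.
      apply/seteqP; split => s /=; rewrite !in_itv/=.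
        by move=> [/andP[-> _] /andP[_ ->]].
      move=> /andP[h1 h2]; rewrite h1 h2 (le_trans k0)//; split => //.
      by rewrite (le_lt_trans h2).
        rewrite [X in (_ * X)%E]lebesgue_measure_itv/= lte_fin; case: ltP => h2; first by rewrite -EFinB -EFinM.
    by rewrite (_ : t - _ = 0) ?mulr0 ?mule0//; lra.
  have -> : `[k%:R * Delta, k.+1%:R * Delta[%classic `&` `[0, t]%classic =
      `[k%:R * Delta, k.+1%:R * Delta[%classic.
    apply/seteqP; split => s /=; rewrite !in_itv/=; first by move=> [].
    move=> /andP[h1 h2]; rewrite h1 h2 (le_trans k0 h1); split => //=.
    by rewrite (le_trans (ltW h2)).
  rewrite [X in (_ * X)%E]lebesgue_measure_itv/= lte_fin; case: ltP => h2; first by rewrite -EFinB -EFinM.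
  by rewrite (_ : _ - _ = 0) ?mulr0 ?mule0//; lra.
by under eq_bigr do rewrite key; rewrite sumEFin.
Qed.

End grid.

(* Here [f x i - corrected_drift f g eta x i = eta * g x i * g_x x i]. *)
Record coefficient_bounds (R : realType) N (f g : R -> 'I_N -> R) (eta K : R) : Prop := {
  cb_ge1 : 1 <= K ;
  cb_eta : 0 <= eta <= 1 ;
  cb_derivable : forall (x : R) i, derivable (g ^~ i) x 1 ;
  cb_f_lip : forall x z i, `|f x i - f z i| <= K * `|x - z| ;
  cb_g_lip : forall x z i, `|g x i - g z i| <= K * `|x - z| ;
  cb_h_lip : forall x z i, `|(f x i - corrected_drift f g eta x i) -
     (f z i - corrected_drift f g eta z i)| <= K * `|x - z| ;
  cb_f_lin : forall x i, `|f x i| <= K * (1 + `|x|) ;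
  cb_g_lin : forall x i, `|g x i| <= K * (1 + `|x|) ;
  cb_h_lin : forall x i, `|f x i - corrected_drift f g eta x i| <= K * (1 + `|x|) }.

Section scheme_path.
Context {R : realType} {N : nat}.
Local Notation mu := (@lebesgue_measure R).
Variables (f g : R -> 'I_N -> R) (theta eta K T y0 Delta : R).
Variables (W : R -> R) (r : R -> 'I_N).
Hypotheses (T0 : 0 < T) (D0 : 0 < Delta) (D1 : Delta <= 1).
Let tau := grid T Delta.
Let n := grid_size T Delta.
Let Y := pc_em f g theta eta T y0 W r Delta.
Let dt k := tau k.+1 - tau k.
Let dW k := W (tau k.+1) - W (tau k).
Let fY k := f (Y k) (r (tau k)).
Let gY k := g (Y k) (r (tau k)).
Let hY k := f (Y k) (r (tau k)) - corrected_drift f g eta (Y k) (r (tau k)).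
Let dr k := rem1 f g theta eta T y0 W r Delta k + rem2 f g theta eta T y0 W r Delta k +
  rem3 f g theta eta T y0 W r Delta k.
Let df k := rem4 f g theta eta T y0 W r Delta k.

Lemma pc_em_succ k : pc_em f g theta eta T y0 W r Delta k.+1 =
  Y k + fY k * dt k + gY k * dW k + (dr k * dt k + df k * dW k).
Proof.
rewrite /dr /df /rem1 /rem2 /rem3 /rem4 /pc_pred /=.
rewrite /fY /gY /dt /dW /tau -/(pc_em f g theta eta T y0 W r Delta k) -/Y /corrected_drift.
ring.
Qed.

(** On the current cell the coefficient [df] already involves the increment of the driving path over
    the whole cell. The last term is therefore not adapted at intermediate times, and it is
    estimated by fourth powers instead of a martingale argument. *)
Definition scheme_rem t : R := let ka := grid_index Delta t in
  \sum_(k < ka) (dr k * dt k + df k * dW k) +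
  (dr ka * (t - tau ka) + df ka * (W t - W (tau ka))).

Lemma pc_em_sum k : Y k = y0 + \sum_(j < k) (fY j * dt j + gY j * dW j) +
  \sum_(j < k) (dr j * dt j + df j * dW j).
Proof.
elim: k => [|k ih]; first by rewrite !big_ord0 !addr0.
by rewrite /Y pc_em_succ ih !big_ord_recr/=; ring.
Qed.

Lemma pc_em_cont_decomp t : 0 <= t <= T ->
  pc_em_cont f g theta eta T y0 W r Delta t =
  y0 + \int[mu]_(s in `[0, t]) f (Ybar f g theta eta T y0 W r Delta s) (rbar T r Delta s) +
  step_integral n tau gY W t + scheme_rem t.
Proof.
move=> tT; rewrite /pc_em_cont.
rewrite (grid_step_Rintegral D0 (rem1 f g theta eta T y0 W r Delta) tT).
rewrite (grid_step_Rintegral D0 (rem2 f g theta eta T y0 W r Delta) tT).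
rewrite (grid_step_Rintegral D0 (rem3 f g theta eta T y0 W r Delta) tT).
rewrite !(step_integral_grid T0 D0)//; last first.
  by apply: grid_index_size => //; case/andP: tT.
rewrite /scheme_rem -/tau -/n -/Y -/gY; set ka := grid_index Delta t.
have -> : \sum_(k < ka) (dr k * dt k + df k * dW k) =
   \sum_(k < ka) rem1 f g theta eta T y0 W r Delta k * dt k +
   \sum_(k < ka) rem2 f g theta eta T y0 W r Delta k * dt k +
   \sum_(k < ka) rem3 f g theta eta T y0 W r Delta k * dt k +
   \sum_(k < ka) rem4 f g theta eta T y0 W r Delta k * dW k.
  by rewrite -!big_split/=; apply: eq_bigr => k _; rewrite /dr /df; ring.
by rewrite /dr /df /dt /dW /gY /Y /id/=; ring.
Qed.

(** All complete cells telescope into the grid value, so the displacement inside a cell involves the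
    data of that cell only. *)
Lemma pc_em_cont_within t (k := grid_index Delta t) : 0 <= t <= T ->
  pc_em_cont f g theta eta T y0 W r Delta t =
  Y k + ((fY k + dr k) * (t - tau k) + (gY k + df k) * (W t - W (tau k))).
Proof.
move=> tT; rewrite pc_em_cont_decomp//.
rewrite (grid_step_Rintegral D0 fY tT) !(step_integral_grid T0 D0)//; last first.
  by apply: grid_index_size => //; case/andP: tT.
rewrite pc_em_sum big_split/= /scheme_rem -/k /dt /dW /id -/tau; ring.
Qed.

Hypotheses (theta01 : 0 <= theta <= 1) (cb : coefficient_bounds f g eta K).

Let K1 : 1 <= K. Proof. exact: cb_ge1 cb. Qed.
Let eta01 : 0 <= eta <= 1. Proof. exact: cb_eta cb. Qed.
Let dg x i : derivable (g ^~ i) x 1. Proof. exact: (@cb_derivable _ _ _ _ _ _ cb). Qed.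
Let f_lip x z i : `|f x i - f z i| <= K * `|x - z|. Proof. exact: cb_f_lip cb _ _ _. Qed.
Let g_lip x z i : `|g x i - g z i| <= K * `|x - z|. Proof. exact: cb_g_lip cb _ _ _. Qed.
Let h_lip x z i : `|(f x i - corrected_drift f g eta x i) -
  (f z i - corrected_drift f g eta z i)| <= K * `|x - z|.
Proof. exact: cb_h_lip cb _ _ _. Qed.
Let f_lin x i : `|f x i| <= K * (1 + `|x|). Proof. exact: cb_f_lin cb _ _. Qed.
Let g_lin x i : `|g x i| <= K * (1 + `|x|). Proof. exact: cb_g_lin cb _ _. Qed.
Let h_lin x i : `|f x i - corrected_drift f g eta x i| <= K * (1 + `|x|).
Proof. exact: cb_h_lin cb _ _. Qed.

Let q k := 1 + `|Y k|.
Let hE x i : f x i - corrected_drift f g eta x i = eta * g x i * derive1 (g ^~ i) x.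
Proof. by rewrite /corrected_drift opprB addrC subrK. Qed.
Let hl (i : 'I_N) (x z : R) : `|eta * g x i * derive1 (g ^~ i) x -
  eta * g z i * derive1 (g ^~ i) z| <= K * `|x - z|.
Proof. by rewrite -!hE. Qed.
Let hn (i : 'I_N) (x : R) : `|eta * g x i * derive1 (g ^~ i) x| <= K * (1 + `|x|).
Proof. by rewrite -!hE. Qed.

Let dt0 k : 0 <= dt k. Proof. by have /andP[] := grid_step T D0 k. Qed.
Let dtD k : dt k <= Delta. Proof. by have /andP[] := grid_step T D0 k. Qed.
Let dt1 k : dt k <= 1. Proof. exact: le_trans D1. Qed.

Let drE k : dr k = theta * (f (Y k + fY k * dt k + gY k * dW k) (r (tau k)) - fY k) -
  theta * (eta * g (Y k + fY k * dt k + gY k * dW k) (r (tau k)) *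
    derive1 (g ^~ (r (tau k))) (Y k + fY k * dt k + gY k * dW k) -
    eta * gY k * derive1 (g ^~ (r (tau k))) (Y k)) - eta * gY k * derive1 (g ^~ (r (tau k))) (Y k).
Proof. by rewrite /dr /rem1 /rem2 /rem3 /pc_pred /predictor /partial_x /fY /gY /dt /dW /tau /Y; ring. Qed.

Lemma pc_em_within_sqr_le t (k := grid_index Delta t) : 0 <= t <= T ->
  (pc_em_cont f g theta eta T y0 W r Delta t - Y k) ^+ 2 <=
  171 * K ^+ 4 * (q k ^+ 2 * (Delta + (W t - W (tau k)) ^+ 2 + dW k ^+ 4 + (W t - W (tau k)) ^+ 4)).
Proof.
move=> tT; rewrite pc_em_cont_within// -/k addrAC subrr add0r.
have td : 0 <= t - tau k <= dt k.
  by rewrite subr_ge0 grid_index_le//= lerB// grid_index_ge.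
set i := r (tau k).
rewrite drE; apply: le_trans (within_sqr_le K1 theta01 eta01 (fun x z => f_lip x z i)
  (fun x z => g_lip x z i) (@hl i) (fun x => f_lin x i) (fun x => g_lin x i)
  (@hn i) (Y k) (dW k) (dt0 k) (dt1 k) (W t - W (tau k)) td) _.
apply: ler_wpM2l; first by rewrite mulr_ge0// exprn_ge0// (le_trans _ K1).
by rewrite ler_wpM2l ?sqr_ge0// !lerD2r.
Qed.

Lemma pc_em_succ_sqr_le k : 1 + Y k.+1 ^+ 2 <=
  (1 + Y k ^+ 2) + 420 * K ^+ 4 * ((1 + Y k ^+ 2) * (dt k + dW k ^+ 2 + dW k ^+ 4)) +
  2 * (Y k * gY k) * dW k.
Proof.
rewrite /Y pc_em_succ -/Y drE; set i := r (tau k).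
exact: (step_sqr_le K1 theta01 eta01 (fun x z => f_lip x z i) (fun x z => g_lip x z i)
  (@hl i) (fun x => f_lin x i) (fun x => g_lin x i) (@hn i) (Y k) (dW k) (dt0 k) (dt1 k)).
Qed.

Definition scheme_mart k : R := \sum_(j < k) hY j * (dW j ^+ 2 - dt j).
Definition scheme_defect k : R := q k * (dt k ^+ 2 + dt k * `|dW k| + `|dW k| ^+ 3).

(** Three contributions: the martingale part, bounded by its running maximum; the local defects,
    summed with the Cauchy-Schwarz inequality, which costs the factor [n]; and the incomplete cell.
    The constants are [27 = 3 * 9] and [168 = 3 * 56]. *)
Lemma scheme_rem_sqr_le t (k := grid_index Delta t) : 0 <= t <= T ->
  scheme_rem t ^+ 2 <= 3 * rmax scheme_mart n ^+ 2 +
    27 * K ^+ 6 * (n%:R * \sum_(j < n) scheme_defect j ^+ 2) +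
    168 * K ^+ 4 * (q k ^+ 2 * (Delta ^+ 2 + dW k ^+ 4 + (W t - W (tau k)) ^+ 4)).
Proof.
move=> tT; have kn : (k < n)%N by apply: grid_index_size => //; case/andP: tT.
have step j : dr j * dt j + df j * dW j = hY j * (dW j ^+ 2 - dt j) +
   (dr j * dt j + df j * dW j - hY j * (dW j ^+ 2 - dt j)) by ring.
rewrite /scheme_rem -/k; under eq_bigr => j _ do rewrite step.
rewrite big_split/=.
set A := \sum_(j < k) hY j * _; set B := \sum_(j < k) (_ - _); set C := dr k * _ + _.
have sq3 (a b c : R) : (a + b + c) ^+ 2 <= 3 * a ^+ 2 + 3 * b ^+ 2 + 3 * c ^+ 2.
  by have := sqr_ge0 (a - b); have := sqr_ge0 (a - c); have := sqr_ge0 (b - c); lra.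
apply: le_trans (sq3 _ _ _) _.
have hA : A ^+ 2 <= rmax scheme_mart n ^+ 2.
  have := le_rmax scheme_mart (ltnW kn); rewrite -/A => h.
  by rewrite -(real_normK (num_real A)) lerXn2r// nnegrE ?rmax_ge0.
have hC : C ^+ 2 <= 56 * K ^+ 4 * (q k ^+ 2 * (Delta ^+ 2 + dW k ^+ 4 + (W t - W (tau k)) ^+ 4)).
  have td : 0 <= t - tau k <= dt k.
    by rewrite subr_ge0 grid_index_le//= lerB// grid_index_ge.
  set i := r (tau k).
  rewrite /C drE; apply: le_trans (rem_within_sqr_le K1 theta01 eta01 (fun x z => f_lip x z i)
    (fun x z => g_lip x z i) (@hl i) (fun x => f_lin x i) (fun x => g_lin x i)
    (@hn i) (Y k) (dW k) (dt0 k) (dt1 k) (W t - W (tau k)) td) _.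
  apply: ler_wpM2l; first by rewrite mulr_ge0// exprn_ge0// (le_trans _ K1).
  by rewrite ler_wpM2l ?sqr_ge0// !lerD2r lerXn2r// nnegrE// ltW.
have hB : B ^+ 2 <= 9 * K ^+ 6 * (n%:R * \sum_(j < n) scheme_defect j ^+ 2).
  apply: le_trans (sqr_sum_le k (fun j => dr j * dt j + df j * dW j - hY j * (dW j ^+ 2 - dt j))) _.
  have K6 : 0 <= 9 * K ^+ 6 by rewrite mulr_ge0// exprn_ge0// (le_trans _ K1).
  have hd j : (dr j * dt j + df j * dW j - hY j * (dW j ^+ 2 - dt j)) ^+ 2 <=
      9 * K ^+ 6 * scheme_defect j ^+ 2.
    have := @rem_defect_le _ (f ^~ (r (tau j))) (g ^~ (r (tau j))) theta eta K K1 theta01 eta01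
      (fun x => @dg x _) (fun x z => f_lip x z _) (fun x z => g_lip x z _) (@hl _)
      (fun x => f_lin x _) (fun x => g_lin x _) (Y j) (dt j) (dW j) (dt0 j).
    set e := _ + _ => he.
    have -> : dr j * dt j + df j * dW j - hY j * (dW j ^+ 2 - dt j) = e.
      by rewrite drE /e /df /rem4 /hY hE; rewrite /pc_pred /predictor /fY /gY /dt /dW /tau /Y; ring.
    rewrite -(real_normK (num_real e)).
    have -> : 9 * K ^+ 6 * scheme_defect j ^+ 2 = (3 * K ^+ 3 * scheme_defect j) ^+ 2 by ring.
    have {}he : `|e| <= 3 * K ^+ 3 * scheme_defect j by rewrite /scheme_defect mulrA.
    by rewrite lerXn2r// nnegrE (le_trans _ he).
  apply: (@le_trans _ _ (k%:R * \sum_(j < k) 9 * K ^+ 6 * scheme_defect j ^+ 2)).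
    by rewrite ler_wpM2l// ler_sum.
  rewrite -mulr_sumr mulrCA ler_wpM2l// ler_pM ?ler_nat ?(ltnW kn)//.
    by apply: sumr_ge0 => j _; exact: sqr_ge0.
  rewrite -(big_mkord xpredT (fun j => scheme_defect j ^+ 2)).
  rewrite -(big_mkord xpredT (fun j => scheme_defect j ^+ 2)) (@big_cat_nat _ _ _ k 0 n)//= ?(ltnW kn)// lerDl.
  by apply: sumr_ge0 => j _; exact: sqr_ge0.
apply: lerD; [apply: lerD|]; first by rewrite ler_wpM2l.
  by apply: le_trans (ler_wpM2l _ hB) _ => //; rewrite !mulrA -natrM.
by apply: le_trans (ler_wpM2l _ hC) _ => //; rewrite !mulrA -natrM.
Qed.

End scheme_path.

(** * Adaptedness and moments of the scheme *)

Section scheme_adapted.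
Context d (Om : measurableType d) (R : realType) (N : nat).
Variables (f g : R -> 'I_N -> R) (theta eta T y0 Delta : R).
Hypotheses (mf : forall i, measurable_fun setT (f ^~ i))
  (mg : forall i, measurable_fun setT (g ^~ i))
  (mfb : forall i, measurable_fun setT ((corrected_drift f g eta) ^~ i)).
Local Notation tau := (grid T Delta).

Lemma adapted_switch (G : set (set Om)) (phi : R -> 'I_N -> R) (X : Om -> R) (rho : Om -> 'I_N) :
  (forall i, measurable_fun setT (phi ^~ i)) -> adapted_to G X ->
  (forall i, G [set w | rho w = i]) -> adapted_to G (fun w => phi (X w) (rho w)).
Proof.
move=> mphi aX Grho.
have -> : (fun w => phi (X w) (rho w)) =
    (fun w => \sum_(i < N) phi (X w) i * (w \in [set w | rho w = i])%:R).
  apply/funext => w; rewrite (bigD1 (rho w))//= mem_set// mulr1 big1 ?addr0// => i ir.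
  by rewrite memNset ?mulr0//= => /esym/eqP; exact/negP.
apply: measurable_sum => i; apply: measurable_funM; last exact: adapted_indic.
exact: (measurableT_comp (mphi i)).
Qed.

(** The sigma-algebra and the processes are left free since two uses are intended: the filtration at
    a grid time, and the sigma-algebra of [W] alone with the path of the chain frozen. The value at
    index [k] reads the chain only at earlier indices. *)
Lemma pc_em_adapted (G : set (set Om)) (W : R -> Om -> R) (r : R -> Om -> 'I_N) k :
  (forall j, (j <= k)%N -> adapted_to G (W (tau j))) ->
  (forall j i, (j < k)%N -> G [set w | r (tau j) w = i]) ->
  adapted_to G (fun w => pc_em f g theta eta T y0 (W ^~ w) (r ^~ w) Delta k).
Proof.
elim: k => [|k ih] aW ar; first exact: measurable_cst.
have aY : adapted_to G (fun w => pc_em f g theta eta T y0 (W ^~ w) (r ^~ w) Delta k).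
  by apply: ih => [j jk|j i jk]; [apply: aW; exact: leqW|apply: ar; exact: ltnW].
have adW : adapted_to G (fun w => W (tau k.+1) w - W (tau k) w).
  by apply: measurable_funB; apply: aW.
have rk i : G [set w | r (tau k) w = i] by exact: ar.
have ac c : adapted_to G (fun=> c) by exact: measurable_cst.
have aX : adapted_to G (fun w => predictor f g T (W ^~ w) (r ^~ w) Delta k
    (pc_em f g theta eta T y0 (W ^~ w) (r ^~ w) Delta k)).
  apply: measurable_funD; [apply: measurable_funD => //|]; apply: measurable_funM => //.
    exact: adapted_switch.
  exact: adapted_switch.
apply: measurable_funD; [apply: measurable_funD => //|]; apply: measurable_funM => //.
  apply: measurable_funD; (apply: measurable_funM; first exact: ac); exact: adapted_switch.
apply: measurable_funD; (apply: measurable_funM; first exact: ac); exact: adapted_switch.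
Qed.

End scheme_adapted.

Lemma pc_em_ext (R : realType) N (f g : R -> 'I_N -> R) (theta eta T y0 Delta : R)
    (W : R -> R) (r r' : R -> 'I_N) k :
  (forall j, (j < k)%N -> r (grid T Delta j) = r' (grid T Delta j)) ->
  pc_em f g theta eta T y0 W r Delta k = pc_em f g theta eta T y0 W r' Delta k.
Proof.
elim: k => // k ih rr /=.
by rewrite /predictor rr// ih// => j jk; apply: rr; exact: ltnW.
Qed.

Lemma lipschitz_measurable (R : realType) (phi : R -> R) (K : R) :
  (forall x z, `|phi x - phi z| <= K * `|x - z|) -> measurable_fun setT phi.
Proof.
move=> lip; apply: continuous_measurable_fun => x; apply/cvgrPdist_le => e e0.
have K0 : 0 < `|K| + 1 by rewrite ltr_wpDl.
apply/nbhs_ballP; exists (e / (`|K| + 1)); first by rewrite /= divr_gt0.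
move=> z /=; rewrite /ball/= ltr_pdivlMr// => xz.
apply: le_trans (lip _ _) _; apply: le_trans (ltW xz); rewrite mulrC.
by rewrite ler_wpM2l//; have := ler_norm K; lra.
Qed.

Section scheme_moments.
Context d (Om : measurableType d) (R : realType) (P : probability Om R) (N : nat).
Variables (F : R -> set (set Om)) (W : R -> Om -> R) (r : R -> Om -> 'I_N).
Hypotheses (usual : usual_filtration P F) (bm : brownian_motion P F W)
  (ar : forall (t : R) i, 0 <= t -> F t [set w | r t w = i]).
Variables (f g : R -> 'I_N -> R) (theta eta K T y0 Delta : R).
Hypotheses (T0 : 0 < T) (D0 : 0 < Delta) (D1 : Delta <= 1)
  (theta01 : 0 <= theta <= 1) (cb : coefficient_bounds f g eta K).
Local Notation E := (Ex P).
Local Notation tau := (grid T Delta).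
Let Y k w := pc_em f g theta eta T y0 (W ^~ w) (r ^~ w) Delta k.

Lemma cb_f_measurable i : measurable_fun setT (f ^~ i).
Proof. by apply: (@lipschitz_measurable _ _ K) => x z; exact: cb_f_lip cb _ _ _. Qed.

Lemma cb_g_measurable i : measurable_fun setT (g ^~ i).
Proof. by apply: (@lipschitz_measurable _ _ K) => x z; exact: cb_g_lip cb _ _ _. Qed.

Lemma cb_h_measurable i :
  measurable_fun setT (fun x => f x i - corrected_drift f g eta x i).
Proof. by apply: (@lipschitz_measurable _ _ K) => x z; exact: cb_h_lip cb _ _ _. Qed.

Lemma cb_fbar_measurable i : measurable_fun setT ((corrected_drift f g eta) ^~ i).
Proof.
apply: (eq_measurable_fun (fun x => f x i - (f x i - corrected_drift f g eta x i))).
  by move=> x _; rewrite opprB addrC subrK.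
by apply: measurable_funB; [exact: cb_f_measurable|exact: cb_h_measurable].
Qed.

Let tau0 k : 0 <= tau k. Proof. exact: grid_ge0. Qed.
Let taum k : tau k <= tau k.+1. Proof. exact: grid_homo. Qed.

Lemma scheme_adapted k : adapted_to (F (tau k)) (Y k).
Proof.
apply: pc_em_adapted.
- exact: cb_f_measurable.
- exact: cb_g_measurable.
- exact: cb_fbar_measurable.
- move=> j jk; apply: (adapted_sub (filt_mono usual (tau0 j) (grid_homo T D0 jk))).
  by apply: sub_measurable_adapted; exact: (bm_adapted bm).
- move=> j i jk; apply: (filt_mono usual (tau0 j) (grid_homo T D0 (ltnW jk))).
  exact: ar.
Qed.

Lemma scheme_coef_adapted (phi : R -> 'I_N -> R) k : (forall i, measurable_fun setT (phi ^~ i)) ->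
  adapted_to (F (tau k)) (fun w => phi (Y k w) (r (tau k) w)).
Proof. by move=> mphi; apply: adapted_switch => //; [exact: scheme_adapted|move=> i; exact: ar]. Qed.

Lemma scheme_measurable k : measurable_fun setT (Y k).
Proof. exact: adapted_measurable (filt_sub usual (tau0 k)) (@scheme_adapted k). Qed.

Let m2 k : measurable_fun setT (fun w => 1 + Y k w ^+ 2).
Proof. by apply: measurable_funD => //; apply: measurable_funX; exact: scheme_measurable. Qed.

Let p2 k w : 0 <= 1 + Y k w ^+ 2. Proof. by rewrite addr_ge0// sqr_ge0. Qed.

Let K0 : 0 <= K. Proof. exact: le_trans (cb_ge1 cb). Qed.

(** A discrete Gronwall argument. The linear term of the one-step bound has mean zero and the rest
    multiplies the mean by at most [1 + 2100 * K ^+ 4 * dt], below the exponential. Here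
    [2100 = 420 * 5], with [5 = 1 + 1 + 3] from the moments of the increment when [dt <= 1]. *)
Lemma scheme_sqr_le k :
  (E (fun w => 1 + Y k w ^+ 2)%R <= ((1 + y0 ^+ 2) * expR (2100 * K ^+ 4 * tau k))%:E)%E.
Proof.
elim: k => [|k ih].
  have e0 : E (fun w => 1 + Y 0 w ^+ 2) = (1 + y0 ^+ 2)%:E by exact: (Ex_cst P (1 + y0 ^+ 2)).
  by rewrite e0 grid0// mulr0 expR0 mulr1.
pose dt := tau k.+1 - tau k; pose dW w := W (tau k.+1) w - W (tau k) w.
have dt0 : 0 <= dt by rewrite subr_ge0.
have dt1 : dt <= 1 by apply: le_trans D1; have /andP[] := grid_step T D0 k.
have mdW : measurable_fun setT dW by exact: (bm_increment_measurable usual bm).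
pose Z w := 420 * K ^+ 4 * ((1 + Y k w ^+ 2) * (dt + dW w ^+ 2 + dW w ^+ 4)).
pose B w := (2 * (Y k w * g (Y k w) (r (tau k) w))) * dW w.
have K4 : 0 <= 420 * K ^+ 4 by apply: mulr_ge0; [rewrite ler0n|exact: exprn_ge0].
have phi0 x : 0 <= dt + x ^+ 2 + x ^+ 4 :> R.
  by apply: addr_ge0; [apply: addr_ge0 => //; exact: sqr_ge0|exact: exprn_even_ge0].
have mphi : measurable_fun setT (fun x : R => dt + x ^+ 2 + x ^+ 4).
  by apply: measurable_funD; [apply: measurable_funD => //|]; exact: measurable_funX.
have Y2 : (E (fun w => 1 + Y k w ^+ 2)%R < +oo)%E by apply: le_lt_trans ih _; exact: ltry.
have aX : adapted_to (F (tau k)) (fun w => 2 * (Y k w * g (Y k w) (r (tau k) w))).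
  apply: measurable_funM; first exact: measurable_cst.
  apply: measurable_funM; first exact: scheme_adapted.
  by apply: scheme_coef_adapted; exact: cb_g_measurable.
have mX : measurable_fun setT (fun w => 2 * (Y k w * g (Y k w) (r (tau k) w))).
  exact: adapted_measurable (filt_sub usual (tau0 k)) aX.
have mZ0 : measurable_fun setT (fun w => (1 + Y k w ^+ 2) * (dt + dW w ^+ 2 + dW w ^+ 4)).
  by apply: measurable_funM => //; exact: (measurableT_comp mphi).
have Z00 w : 0 <= (1 + Y k w ^+ 2) * (dt + dW w ^+ 2 + dW w ^+ 4) by rewrite mulr_ge0.
have [Bi B0] : P.-integrable setT (EFin \o B) /\ E B = 0%E.
  apply: Ex_indepM_eq0 => //.
  - apply: (@le_lt_trans _ _ ((4 * K)%:E * E (fun w => 1 + Y k w ^+ 2)%R)%E); last first.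
      by rewrite lte_mul_pinfty// ?lee_fin ?mulr_ge0// Ex_ge0.
    rewrite -Ex_Z ?mulr_ge0//; apply: Ex_le => // w.
    rewrite !normrM ger0_norm//.
    have h := cb_g_lin cb (Y k w) (r (tau k) w).
    apply: (@le_trans _ _ (2 * (`|Y k w| * (K * (1 + `|Y k w|))))); first by rewrite !ler_wpM2l.
    rewrite -(real_normK (num_real (Y k w))); have := sqr_ge0 (1 - `|Y k w|) => hs.
    by have := ler_wpM2l K0 hs; have := mulr_ge0 K0 (sqr_ge0 `|Y k w|); have := K0; lra.
  - apply: Ex_sqr_integrable => //; rewrite (Ex_increment_sqr usual bm)//; exact: ltry.
  - exact: (Ex_increment_mean usual bm).
  - apply: (adapted_indep2 (filt_sigma_algebra usual (tau0 k)) aX).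
    exact: (bm_independent bm (tau0 k) (taum k)).
apply: (@le_trans _ _ (E (fun w => (1 + Y k w ^+ 2) + Z w)%R)).
  apply: (Ex_le_addmean0 _ _ _ _ Bi B0) => //.
  - by apply: measurable_funD => //; apply: measurable_funM.
  - by move=> w; rewrite addr_ge0// mulr_ge0.
  - by move=> w; exact: (pc_em_succ_sqr_le T y0 (W ^~ w) (r ^~ w) D0 D1 theta01 cb k).
have Z0 w : 0 <= Z w by rewrite mulr_ge0.
have mZ : measurable_fun setT Z by apply: measurable_funM.
rewrite (Ex_D _ (m2 k) (p2 k) mZ Z0) /Z Ex_Z//.
have aY2 : adapted_to (F (tau k)) (fun w => 1 + Y k w ^+ 2).
  apply: measurable_funD; first exact: measurable_cst.
  by apply: measurable_funX; exact: scheme_adapted.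
rewrite (Ex_adapted_increment usual bm (tau0 k) (taum k) aY2 (p2 k) mphi phi0).
have ephi : (E (fun w => dt + dW w ^+ 2 + dW w ^+ 4)%R <= (5 * dt)%:E)%E.
  have mp n : measurable_fun setT (fun w => dW w ^+ n) by exact: measurable_funX.
  have s2 w : 0 <= dW w ^+ 2 by exact: sqr_ge0.
  have s4 w : 0 <= dW w ^+ 4 by exact: exprn_even_ge0.
  have m12 : measurable_fun setT (fun w => dt + dW w ^+ 2) by apply: measurable_funD.
  have p12 w : 0 <= dt + dW w ^+ 2 by rewrite addr_ge0.
  rewrite (Ex_D _ m12 p12 (mp 4) s4) (Ex_D _ (@measurable_cst _ _ _ _ setT dt) (fun=> dt0) (mp 2) s2).
  rewrite Ex_cst (Ex_increment_sqr usual bm (tau0 k) (taum k)) -EFinD.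
  apply: le_trans (leeD (lexx _) (Ex_increment_pow4 usual bm (tau0 k) (taum k))) _.
  rewrite -EFinD lee_fin -/dt.
  have h2 : dt ^+ 2 <= dt by rewrite expr2 ler_piMl.
  lra.
have Efin : E (fun w => 1 + Y k w ^+ 2) \is a fin_num by rewrite ge0_fin_numE// Ex_ge0.
move: ih; rewrite -(fineK Efin) lee_fin; set y := fine _ => ih.
have y_ge0 : 0 <= y by rewrite fine_ge0// Ex_ge0.
apply: (@le_trans _ _ (y%:E + (420 * K ^+ 4)%:E * (y%:E * (5 * dt)%:E))%E).
  by rewrite leeD2l// lee_wpmul2l// lee_wpmul2l.
rewrite -!EFinM -EFinD lee_fin.
have -> : y + 420 * K ^+ 4 * (y * (5 * dt)) = y * (1 + 2100 * K ^+ 4 * dt) by ring.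
have -> : 2100 * K ^+ 4 * tau k.+1 = 2100 * K ^+ 4 * tau k + 2100 * K ^+ 4 * dt.
  by rewrite /dt; ring.
have : 0 <= 2100 * K ^+ 4 by apply: mulr_ge0; [rewrite ler0n|exact: exprn_ge0].
move: (2100 * K ^+ 4) ih => C ih C0.
rewrite expRD mulrA ler_pM ?expR_ge1Dx//.
by apply: addr_ge0 => //; exact: mulr_ge0.
Qed.

(** Independent of [Delta]. The factor 2 passes from [1 + x ^+ 2] to [(1 + |x|) ^+ 2], the form in
    which linear growth is used. *)
Definition moment_bound : R := 2 * ((1 + y0 ^+ 2) * expR (2100 * K ^+ 4 * T)).

Lemma scheme_moment k : (E (fun w => (1 + `|Y k w|) ^+ 2)%R <= moment_bound%:E)%E.
Proof.
apply: (@le_trans _ _ (E (fun w => 2 * (1 + Y k w ^+ 2))%R)).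
  apply: Ex_le => w; first exact: sqr_ge0.
  by rewrite -(real_normK (num_real (Y k w))); have := sqr_ge0 (1 - `|Y k w|); lra.
rewrite /moment_bound EFinM Ex_Z; [|by []|exact: m2|exact: p2].
apply: lee_wpmul2l; first by rewrite lee_fin.
apply: le_trans (scheme_sqr_le k) _.
have : 0 <= 2100 * K ^+ 4 by apply: mulr_ge0; [rewrite ler0n|exact: exprn_ge0].
move: (2100 * K ^+ 4) => C K4.
rewrite lee_fin; apply: ler_wpM2l; first by rewrite addr_ge0// sqr_ge0.
by rewrite ler_expR; apply: ler_wpM2l => //; exact: grid_le.
Qed.

End scheme_moments.

(** * The accumulated remainder *)

Section scheme_remainder.
Context d (Om : measurableType d) (R : realType) (P : probability Om R) (N : nat).
Variables (F : R -> set (set Om)) (W : R -> Om -> R) (r : R -> Om -> 'I_N).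
Hypotheses (usual : usual_filtration P F) (bm : brownian_motion P F W)
  (ar : forall (t : R) i, 0 <= t -> F t [set w | r t w = i]).
Variables (f g : R -> 'I_N -> R) (theta eta K T y0 Delta m : R).
Hypotheses (T0 : 0 < T) (D0 : 0 < Delta) (D1 : Delta <= 1)
  (theta01 : 0 <= theta <= 1) (cb : coefficient_bounds f g eta K).
Local Notation E := (Ex P).
Local Notation tau := (grid T Delta).
Local Notation n := (grid_size T Delta).
Let Y k w := pc_em f g theta eta T y0 (W ^~ w) (r ^~ w) Delta k.
Let q k w := 1 + `|Y k w|.
Hypothesis moment : forall k, (E (fun w => q k w ^+ 2)%R <= m%:E)%E.

Let m0 : 0 <= m.
Proof. by have := le_trans (Ex_ge0 P (fun w => sqr_ge0 (q 0 w))) (moment 0); rewrite lee_fin. Qed.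

Let tau0 k : 0 <= tau k. Proof. exact: grid_ge0. Qed.
Let taum k : tau k <= tau k.+1. Proof. exact: grid_homo. Qed.
Let K0 : 0 <= K. Proof. exact: le_trans (cb_ge1 cb). Qed.

Let aq k : adapted_to (F (tau k)) (q k).
Proof.
apply: measurable_funD; first exact: measurable_cst.
by apply: measurableT_comp => //; exact: (scheme_adapted usual bm ar theta y0 T0 D0 cb).
Qed.

Let aq2 k : adapted_to (F (tau k)) (fun w => q k w ^+ 2).
Proof. by apply: measurable_funX; exact: aq. Qed.

Let mq2 k : measurable_fun setT (fun w => q k w ^+ 2).
Proof. exact: adapted_measurable (filt_sub usual (tau0 k)) (@aq2 k). Qed.

Let mW (s t : R) : 0 <= s -> s <= t -> measurable_fun setT (fun w => W t w - W s w).
Proof. exact: (bm_increment_measurable usual bm). Qed.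

(* [q k] is independent of increments after [tau k]. *)
Lemma moment_increment k t (phi : R -> R) (c : R) : tau k <= t ->
  measurable_fun setT phi -> (forall x, 0 <= phi x) ->
  (E (fun w => phi (W t w - W (tau k) w))%R <= c%:E)%E ->
  (E (fun w => q k w ^+ 2 * phi (W t w - W (tau k) w))%R <= (m * c)%:E)%E.
Proof.
move=> kt mphi phi0 phic.
rewrite (Ex_adapted_increment usual bm (tau0 k) kt (@aq2 k) (fun w => sqr_ge0 _) mphi phi0).
rewrite EFinM; apply: lee_pmul => //; first by apply: Ex_ge0 => w; exact: sqr_ge0.
by apply: Ex_ge0.
Qed.

(** The increment up to [t] contributes [5 * Delta] and the full increment of the cell [3 * Delta],
    which explains the 8. A pointwise mean at fixed [t] is enough here, no supremum over times. *)
Lemma scheme_within_envelope t : 0 <= t <= T -> exists U : Om -> R,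
  [/\ measurable_fun setT U, forall w, 0 <= U w,
    forall w, (pc_em_cont f g theta eta T y0 (W ^~ w) (r ^~ w) Delta t -
      Y (grid_index Delta t) w) ^+ 2 <= U w &
    (E U <= (171 * K ^+ 4 * (8 * m) * Delta)%:E)%E].
Proof.
move=> tT; set k := grid_index Delta t.
have kt : tau k <= t by exact: grid_index_le.
have tD : t - tau k <= Delta.
  have /andP[_] := grid_step T D0 k; apply: le_trans.
  by rewrite lerB// grid_index_ge.
have tk0 : 0 <= t - tau k by rewrite subr_ge0.
pose phi x : R := Delta + x ^+ 2 + x ^+ 4.
pose psi x : R := x ^+ 4.
have x4 x : 0 <= x ^+ 4 :> R by exact: exprn_even_ge0.
have phi0 x : 0 <= phi x.
  by apply: addr_ge0 => //; apply: addr_ge0; [exact: ltW|exact: sqr_ge0].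
have mphi : measurable_fun setT phi.
  by apply: measurable_funD; [apply: measurable_funD => //|]; exact: measurable_funX.
have mpsi : measurable_fun setT psi by exact: measurable_funX.
have mWt : measurable_fun setT (fun w => W t w - W (tau k) w) by exact: mW.
have mWs : measurable_fun setT (fun w => W (tau k.+1) w - W (tau k) w) by exact: mW.
have D2 : Delta ^+ 2 <= Delta by rewrite expr2 ler_piMl// ltW.
have dt2 : (t - tau k) ^+ 2 <= Delta ^+ 2 by rewrite lerXn2r// nnegrE// ltW.
have ds2 : (tau k.+1 - tau k) ^+ 2 <= Delta ^+ 2.
  by have /andP[h1 h2] := grid_step T D0 k; rewrite lerXn2r// nnegrE// ltW.
have ephi : (E (fun w => phi (W t w - W (tau k) w))%R <= (5 * Delta)%:E)%E.
  have mx j : measurable_fun setT (fun w => (W t w - W (tau k) w) ^+ j) by exact: measurable_funX.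
  have m12 : measurable_fun setT (fun w => Delta + (W t w - W (tau k) w) ^+ 2) by apply: measurable_funD.
  have p12 w : 0 <= Delta + (W t w - W (tau k) w) ^+ 2 by rewrite addr_ge0 ?sqr_ge0// ltW.
  rewrite (Ex_D _ m12 p12 (mx 4) (fun w => x4 _)).
  rewrite (Ex_D _ (@measurable_cst _ _ _ _ setT Delta) (fun=> ltW D0) (mx 2) (fun w => sqr_ge0 _)).
  rewrite Ex_cst (Ex_increment_sqr usual bm (tau0 k) kt) -EFinD.
  apply: le_trans (leeD (lexx _) (Ex_increment_pow4 usual bm (tau0 k) kt)) _.
  by rewrite -EFinD lee_fin; lra.
have epsi : (E (fun w => psi (W (tau k.+1) w - W (tau k) w))%R <= (3 * Delta)%:E)%E.
  apply: le_trans (Ex_increment_pow4 usual bm (tau0 k) (taum k)) _.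
  by rewrite lee_fin; lra.
have h1 := moment_increment kt mphi phi0 ephi.
have h2 := moment_increment (taum k) mpsi x4 epsi.
have m1 : measurable_fun setT (fun w => q k w ^+ 2 * phi (W t w - W (tau k) w)).
  by apply: measurable_funM => //; exact: measurableT_comp.
have m2 : measurable_fun setT (fun w => q k w ^+ 2 * psi (W (tau k.+1) w - W (tau k) w)).
  by apply: measurable_funM => //; exact: measurableT_comp.
have p1 w : 0 <= q k w ^+ 2 * phi (W t w - W (tau k) w) by rewrite mulr_ge0 ?sqr_ge0.
have p2 w : 0 <= q k w ^+ 2 * psi (W (tau k.+1) w - W (tau k) w) by rewrite mulr_ge0 ?sqr_ge0 ?x4.
have c0 : 0 <= 171 * K ^+ 4 by apply: mulr_ge0; [rewrite ler0n|exact: exprn_ge0].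
have mU : measurable_fun setT (fun w => q k w ^+ 2 * phi (W t w - W (tau k) w) +
    q k w ^+ 2 * psi (W (tau k.+1) w - W (tau k) w)) by exact: measurable_funD.
have U0 w : 0 <= q k w ^+ 2 * phi (W t w - W (tau k) w) +
    q k w ^+ 2 * psi (W (tau k.+1) w - W (tau k) w) by rewrite addr_ge0.
exists (fun w => 171 * K ^+ 4 * (q k w ^+ 2 * phi (W t w - W (tau k) w) +
  q k w ^+ 2 * psi (W (tau k.+1) w - W (tau k) w))); split.
- by apply: measurable_funM => //; exact: measurable_cst.
- by move=> w; apply: mulr_ge0.
- move=> w; apply: le_trans (pc_em_within_sqr_le y0 (W ^~ w) (r ^~ w) T0 D0 D1 theta01 cb tT) _.
  rewrite -/k -mulrDr /phi /psi /q /Y le_eqVlt; apply/orP; left; apply/eqP; ring.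
move: (171 * K ^+ 4) c0 => c c0.
rewrite Ex_Z// Ex_D// -!mulrA EFinM; apply: lee_wpmul2l => //.
by apply: le_trans (leeD h1 h2) _; rewrite -EFinD lee_fin; lra.
Qed.

Let M k w := scheme_mart f g theta eta T y0 Delta (W ^~ w) (r ^~ w) k.
Let Df k w := scheme_defect f g theta eta T y0 Delta (W ^~ w) (r ^~ w) k.

Let h k w := f (Y k w) (r (tau k) w) - corrected_drift f g eta (Y k w) (r (tau k) w).
Let z k w := (W (tau k.+1) w - W (tau k) w) ^+ 2 - (tau k.+1 - tau k).
Let dtD k : 0 <= tau k.+1 - tau k <= Delta. Proof. exact: grid_step. Qed.

(** Doob's inequality with the centered squares as increments, [32 = 4 * 8]. There are about
    [T / Delta] terms of order [Delta ^+ 2], so the total is of order [Delta]. *)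
Lemma scheme_mart_moment :
  (E (fun w => rmax (M ^~ w) n ^+ 2)%R <= (n%:R * (32 * (K ^+ 2 * m) * Delta ^+ 2))%:E)%E.
Proof.
have ah k : adapted_to (F (tau k)) (h k).
  exact: (scheme_coef_adapted usual bm ar theta y0 T0 D0 cb (cb_h_measurable cb)).
have mh k : measurable_fun setT (fun w => h k w ^+ 2).
  by apply: measurable_funX; exact: adapted_measurable (filt_sub usual (tau0 k)) (@ah k).
have Eh k : (E (fun w => h k w ^+ 2)%R <= (K ^+ 2 * m)%:E)%E.
  rewrite EFinM; apply: le_trans (lee_wpmul2l _ (moment k)); last by rewrite lee_fin sqr_ge0.
  rewrite -Ex_Z ?sqr_ge0//; last by move=> w; exact: sqr_ge0.
  apply: Ex_le => w; first exact: sqr_ge0.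
  rewrite -exprMn -(real_normK (num_real (h k w))) lerXn2r ?nnegrE//.
    by apply: mulr_ge0 => //; apply: addr_ge0.
  exact: cb_h_lin cb _ _.
have Ez k : (E (fun w => z k w ^+ 2)%R <= (8 * Delta ^+ 2)%:E)%E.
  apply: le_trans (Ex_increment_sqr_centered_sqr usual bm (tau0 k) (taum k)) _.
  have /andP[d1 d2] := dtD k.
  by rewrite lee_fin ler_wpM2l// lerXn2r// nnegrE ltW.
have D := @doob_transform _ _ _ P (fun k => F (tau k)) h z n.
apply: le_trans (D _ _ _ _ _ _ _ _ _) _ => {D}.
- by move=> i _; exact: (filt_sigma_algebra usual).
- by move=> i _; exact: (filt_mono usual).
- by move=> i _; exact: (filt_sub usual).
- by move=> i _; exact: ah.
- move=> i _; apply: measurable_funB; last exact: measurable_cst.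
  by apply: measurable_funX; exact: (bm_increment_adapted usual bm).
- move=> i _ A B GA mB.
  have mB' : measurable ((fun x : R => x ^+ 2 - (tau i.+1 - tau i)) @^-1` B).
    rewrite -[X in measurable X]setTI.
    have mf : measurable_fun setT (fun x : R => x ^+ 2 - (tau i.+1 - tau i)).
      by apply: measurable_funB => //; exact: measurable_funX.
    exact: mf.
  exact: (bm_independent bm (tau0 i) (taum i) GA mB').
- by move=> i _; exact: (Ex_increment_sqr_centered usual bm).
- by move=> i _; apply: le_lt_trans (Ez i) _; exact: ltry.
- by move=> i _; apply: le_lt_trans (Eh i) _; exact: ltry.
apply: (@le_trans _ _ (\sum_(i < n) (32 * (K ^+ 2 * m) * Delta ^+ 2)%:E)%E).
  apply: lee_sum => i _.
  apply: (@le_trans _ _ (4%:E * ((K ^+ 2 * m)%:E * (8 * Delta ^+ 2)%:E))%E).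
    rewrite lee_wpmul2l// lee_pmul// Ex_ge0// => w; exact: sqr_ge0.
  by rewrite -!EFinM lee_fin; lra.
by rewrite sumEFin lee_fin big_const_ord iter_addr_0 -[leLHS]mulr_natl.
Qed.

(** The three squared terms contribute 3, 3 and [3 * 15]. Order [Delta ^+ 3] is what is needed,
    because the Cauchy-Schwarz inequality multiplies the sum over cells by the number of cells. *)
Lemma scheme_defect_moment k : (E (fun w => Df k w ^+ 2)%R <= (51 * m * Delta ^+ 3)%:E)%E.
Proof.
have /andP[d0 dD] := dtD k; set dt := tau k.+1 - tau k in d0 dD.
have d1 : dt <= 1 by exact: le_trans D1.
pose phi x : R := 3 * dt ^+ 4 + 3 * dt ^+ 2 * x ^+ 2 + 3 * x ^+ 6.
have x6 x : 0 <= 3 * x ^+ 6 :> R by rewrite mulr_ge0// exprn_even_ge0.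
have d4 : 0 <= 3 * dt ^+ 4 by rewrite mulr_ge0// exprn_even_ge0.
have d2 : 0 <= 3 * dt ^+ 2 by rewrite mulr_ge0// sqr_ge0.
have phi0 x : 0 <= phi x.
  by apply: addr_ge0 => //; apply: addr_ge0 => //; apply: mulr_ge0 => //; exact: sqr_ge0.
have mphi : measurable_fun setT phi.
  apply: measurable_funD; [apply: measurable_funD|]; first exact: measurable_cst.
    by apply: measurable_funM; [exact: measurable_cst|exact: measurable_funX].
  by apply: measurable_funM; [exact: measurable_cst|exact: measurable_funX].
have mdW : measurable_fun setT (fun w => W (tau k.+1) w - W (tau k) w) by exact: mW.
have mx j : measurable_fun setT (fun w => (W (tau k.+1) w - W (tau k) w) ^+ j).
  exact: measurable_funX.
have ephi : (E (fun w => phi (W (tau k.+1) w - W (tau k) w))%R <= (51 * Delta ^+ 3)%:E)%E.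
  have m3 : measurable_fun setT (fun w => 3 * (W (tau k.+1) w - W (tau k) w) ^+ 6).
    by apply: measurable_funM => //; exact: mx.
  have m2 : measurable_fun setT (fun w => 3 * dt ^+ 2 * (W (tau k.+1) w - W (tau k) w) ^+ 2).
    by apply: measurable_funM => //; exact: mx.
  have p2 w : 0 <= 3 * dt ^+ 2 * (W (tau k.+1) w - W (tau k) w) ^+ 2.
    by apply: mulr_ge0 => //; exact: sqr_ge0.
  have m12 : measurable_fun setT
      (fun w => 3 * dt ^+ 4 + 3 * dt ^+ 2 * (W (tau k.+1) w - W (tau k) w) ^+ 2).
    by apply: measurable_funD.
  have p12 w : 0 <= 3 * dt ^+ 4 + 3 * dt ^+ 2 * (W (tau k.+1) w - W (tau k) w) ^+ 2.
    by apply: addr_ge0.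
  rewrite (Ex_D _ m12 p12 m3 (fun w => x6 _)).
  rewrite (Ex_D _ (@measurable_cst _ _ _ _ setT _) (fun=> d4) m2 p2).
  rewrite Ex_cst Ex_Z//; last by move=> w; exact: sqr_ge0.
  rewrite Ex_Z//; last by move=> w; exact: exprn_even_ge0.
  rewrite (Ex_increment_sqr usual bm (tau0 k) (taum k)) -/dt -EFinM -EFinD.
  have h6 := Ex_increment_pow6 usual bm (tau0 k) (taum k).
  apply: le_trans (leeD (lexx _) (lee_wpmul2l _ h6)) _; first by rewrite lee_fin.
  rewrite -EFinM -EFinD lee_fin -/dt.
  have e43 : dt ^+ 4 <= dt ^+ 3 by rewrite exprS ler_piMl// exprn_ge0.
  have e3 : dt ^+ 3 <= Delta ^+ 3 by rewrite lerXn2r// nnegrE ltW.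
  lra.
have h1 := moment_increment (taum k) mphi phi0 ephi.
rewrite mulrAC mulrC; apply: le_trans h1; apply: Ex_le => w; first exact: sqr_ge0.
rewrite /Df /scheme_defect exprMn ler_wpM2l ?sqr_ge0// -/dt /phi.
set s := W (tau k.+1) w - W (tau k) w.
have s2 : s ^+ 2 = `|s| ^+ 2 by rewrite real_normK ?num_real.
have s6 : s ^+ 6 = `|s| ^+ 6 by rewrite (exprM _ 2 3) s2 -exprM.
rewrite s2 s6; set a := `|s|.
have b1 := sqr_ge0 (dt ^+ 2 - dt * a); have b2 := sqr_ge0 (dt ^+ 2 - a ^+ 3).
by have b3 := sqr_ge0 (dt * a - a ^+ 3); lra.
Qed.

Let mY k : measurable_fun setT (Y k).
Proof. exact: (scheme_measurable usual bm ar theta y0 T0 D0 cb). Qed.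

Let mh k : measurable_fun setT (h k).
Proof.
exact: adapted_measurable (filt_sub usual (tau0 k))
  (scheme_coef_adapted usual bm ar theta y0 T0 D0 cb (cb_h_measurable cb)).
Qed.

Let mM k : measurable_fun setT (M k).
Proof.
apply: measurable_sum => j; apply: measurable_funM; first exact: mh.
by apply: measurable_funB => //; apply: measurable_funX; exact: mW.
Qed.

Let mDf k : measurable_fun setT (Df k).
Proof.
have mdW : measurable_fun setT (fun w => `|W (tau k.+1) w - W (tau k) w|).
  by apply: measurableT_comp => //; exact: mW.
apply: measurable_funM.
  by apply: measurable_funD => //; apply: measurableT_comp => //; exact: mY.
apply: measurable_funD; last exact: measurable_funX.
by apply: measurable_funD => //; apply: measurable_funM.
Qed.

(** The number of cells times [Delta] is at most [T + 1] once [Delta <= 1]. In the last summand,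
    [1 + 2 * 147] stands for [Delta ^+ 2] and two uses of the bound on fourth powers. *)
Definition remainder_bound : R :=
  3 * (32 * (K ^+ 2 * m) * (T + 1)) + 27 * K ^+ 6 * (51 * m * (T + 1) ^+ 2) +
  168 * K ^+ 4 * ((1 + 2 * 147) * m * (T + 1)).

Lemma scheme_rem_envelope : exists V : Om -> \bar R,
  [/\ measurable_fun setT V, forall w, (0 <= V w)%E,
    forall w, {within `[0, +oo[, continuous (W ^~ w)} -> forall t, 0 <= t <= T ->
      ((scheme_rem f g theta eta T y0 Delta (W ^~ w) (r ^~ w) t ^+ 2)%:E <= V w)%E &
    (\int[P]_w V w <= (remainder_bound * Delta)%:E)%E].
Proof.
have q2fin k : (E (fun w => q k w ^+ 2)%R < +oo)%E by apply: le_lt_trans (moment k) _; exact: ltry.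
have /choice[V HV] k := brownian_sup4 usual bm (tau0 k) (taum k) (@aq k) (q2fin k).
have mV k : measurable_fun setT (V k) by have [] := HV k.
have V0 k w : (0 <= V k w)%E by have [] := HV k.
have VE k : (\int[P]_w V k w <= (147 * m * Delta ^+ 2)%:E)%E.
  have [_ _ _ h1] := HV k; apply: (le_trans h1).
  have -> : 147 * m * Delta ^+ 2 = 147 * Delta ^+ 2 * m by rewrite mulrAC.
  have /andP[d1 d2] := dtD k.
  rewrite [X in (_ <= X)%E]EFinM; apply: lee_pmul; last exact: moment.
  - by rewrite lee_fin; apply: mulr_ge0; [rewrite ler0n|exact: sqr_ge0].
  - by apply: Ex_ge0 => w; exact: sqr_ge0.
  - rewrite lee_fin; apply: ler_wpM2l; first by rewrite ler0n.
    by rewrite lerXn2r// nnegrE ltW.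
pose A w := 3 * rmax (M ^~ w) n ^+ 2.
pose B w := 27 * K ^+ 6 * (n%:R * \sum_(j < n) Df j w ^+ 2).
(* The incomplete cell may be any cell, and the maximum over cells is bounded by their sum, which is
   affordable at order [Delta ^+ 2] per cell. [V k] is counted twice: for the full increment and for
   the increment up to [t]. *)
pose G k w : \bar R := ((q k w ^+ 2 * Delta ^+ 2)%:E + 2%:E * V k w)%E.
have c168 : 0 <= 168 * K ^+ 4 by apply: mulr_ge0; [rewrite ler0n|exact: exprn_ge0].
have c27 : 0 <= 27 * K ^+ 6 by apply: mulr_ge0; [rewrite ler0n|exact: exprn_ge0].
have G0 k w : (0 <= G k w)%E.
  by apply: adde_ge0; [rewrite lee_fin mulr_ge0// sqr_ge0|apply: mule_ge0].
have mqD k : measurable_fun setT (fun w => q k w ^+ 2 * Delta ^+ 2) by apply: measurable_funM.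
have mG k : measurable_fun setT (G k).
  apply: emeasurable_funD; first exact/measurable_EFinP.
  by apply: emeasurable_funM => //; exact: measurable_cst.
have A0 w : 0 <= A w by rewrite mulr_ge0// sqr_ge0.
have sD0 w : 0 <= n%:R * \sum_(j < n) Df j w ^+ 2.
  by apply: mulr_ge0 => //; apply: sumr_ge0 => j _; exact: sqr_ge0.
have B0 w : 0 <= B w by apply: mulr_ge0.
have mrm : measurable_fun setT (fun w => rmax (M ^~ w) n ^+ 2).
  by apply: measurable_funX; apply: measurable_rmax.
have mA : measurable_fun setT A by apply: measurable_funM.
have msD : measurable_fun setT (fun w => \sum_(j < n) Df j w ^+ 2).
  by apply: measurable_sum => j; apply: measurable_funX; exact: mDf.
have mB : measurable_fun setT B by apply: measurable_funM => //; apply: measurable_funM.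
have mS : measurable_fun setT (fun w => \sum_(k < n) G k w)%E by apply: emeasurable_sum.
have S0 w : (0 <= \sum_(k < n) G k w)%E by apply: sume_ge0.
have mcS : measurable_fun setT (fun w => (168 * K ^+ 4)%:E * \sum_(k < n) G k w)%E.
  by apply: emeasurable_funM => //; exact: measurable_cst.
have cS0 w : (0 <= (168 * K ^+ 4)%:E * \sum_(k < n) G k w)%E.
  by apply: mule_ge0 => //; rewrite lee_fin.
have mAB : measurable_fun setT (fun w => A w + B w) by apply: measurable_funD.
have AB0 w : 0 <= A w + B w by apply: addr_ge0.
exists (fun w => (A w + B w)%:E + (168 * K ^+ 4)%:E * \sum_(k < n) G k w)%E; split.
- by apply: emeasurable_funD => //; exact/measurable_EFinP.
- by move=> w; apply: adde_ge0 => //; rewrite lee_fin.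
- move=> w cW t tT.
  have := scheme_rem_sqr_le y0 (W ^~ w) (r ^~ w) T0 D0 D1 theta01 cb tT.
  set k := grid_index Delta t => h1.
  have kn : (k < n)%N by apply: grid_index_size => //; case/andP: tT.
  apply: (@le_trans _ _ (A w + B w + 168 * K ^+ 4 * (q k w ^+ 2 *
    (Delta ^+ 2 + (W (tau k.+1) w - W (tau k) w) ^+ 4 + (W t w - W (tau k) w) ^+ 4)))%:E).
    by rewrite lee_fin.
  rewrite EFinD leeD2l// EFinM; apply: lee_wpmul2l; first by rewrite lee_fin.
  rewrite (bigD1 (Ordinal kn))//=; apply: (@le_trans _ _ (G k w)); last first.
    by rewrite leeDl// sume_ge0.
  have [_ _ VW _] := HV k.
  rewrite !mulrDr -addrA EFinD leeD2l// EFinD.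
  have -> : (2%:E * V k w = V k w + V k w)%E by rewrite mule_natl mule2n.
  apply: leeD; apply: (VW w cW).
    by rewrite lexx taum.
  by rewrite grid_index_le// grid_index_ge.
rewrite ge0_integralD//; last 2 first.
- by move=> w _; rewrite lee_fin.
- exact/measurable_EFinP.
rewrite ge0_integralZl//.
rewrite ge0_integral_sum//.
have hAB : (E (fun w => A w + B w)%R <=
    (3 * (n%:R * (32 * (K ^+ 2 * m) * Delta ^+ 2)) +
     27 * K ^+ 6 * (n%:R * (n%:R * (51 * m * Delta ^+ 3))))%:E)%E.
  rewrite Ex_D// EFinD; apply: leeD.
    rewrite /A Ex_Z//; last by move=> w; exact: sqr_ge0.
    by rewrite [X in (_ <= X)%E]EFinM; apply: lee_wpmul2l => //; exact: scheme_mart_moment.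
  rewrite /B Ex_Z//; last by apply: measurable_funM.
  rewrite [X in (_ <= X)%E]EFinM; apply: lee_wpmul2l; first by rewrite lee_fin.
  rewrite Ex_Z//; last by move=> w; apply: sumr_ge0 => j _; exact: sqr_ge0.
  rewrite [X in (_ <= X)%E]EFinM; apply: lee_wpmul2l; first by rewrite lee_fin.
  rewrite Ex_sum; [|by move=> j; apply: measurable_funX; exact: mDf|by move=> j w; exact: sqr_ge0].
  apply: (@le_trans _ _ (\sum_(j < n) (51 * m * Delta ^+ 3)%:E)%E).
    by apply: lee_sum => j _; exact: scheme_defect_moment.
  by rewrite sumEFin lee_fin big_const_ord iter_addr_0 -[leLHS]mulr_natl.
have hG k : (\int[P]_w G k w <= ((1 + 2 * 147) * m * Delta ^+ 2)%:E)%E.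
  have D20 : 0 <= Delta ^+ 2 by exact: sqr_ge0.
  rewrite /G ge0_integralD//; last 4 first.
  - by move=> w _; rewrite lee_fin mulr_ge0// sqr_ge0.
  - exact/measurable_EFinP.
  - by move=> w _; apply: mule_ge0.
  - by apply: emeasurable_funM => //; exact: measurable_cst.
  rewrite ge0_integralZl//.
  have -> : (1 + 2 * 147) * m * Delta ^+ 2 = Delta ^+ 2 * m + 2 * (147 * m * Delta ^+ 2) by ring.
  rewrite [X in (_ <= X)%E]EFinD; apply: leeD.
    have := Ex_Z P D20 (mq2 k) (fun w => sqr_ge0 _); rewrite /Ex.
    under eq_integral do rewrite mulrC; move=> ->.
    by rewrite [X in (_ <= X)%E]EFinM; apply: lee_wpmul2l => //; exact: moment.
  by rewrite [X in (_ <= X)%E]EFinM; apply: lee_wpmul2l.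
have hS : (\sum_(k < n) \int[P]_w G k w <= \sum_(k < n) ((1 + 2 * 147) * m * Delta ^+ 2)%:E)%E.
  by apply: lee_sum => k _; exact: hG.
have {}hS := @lee_wpmul2l _ (168 * K ^+ 4)%:E c168 _ _ hS.
apply: le_trans (leeD hAB hS) _.
rewrite sumEFin -EFinM -EFinD lee_fin big_const_ord iter_addr_0 -mulr_natl.
have nD : n%:R * Delta <= T + 1 by apply: le_trans (grid_size_le T0 D0) _; rewrite lerD2l.
have nD0 : 0 <= n%:R * Delta by rewrite mulr_ge0// ltW.
have nD2 : (n%:R * Delta) ^+ 2 <= (T + 1) ^+ 2.
  by rewrite lerXn2r// nnegrE (le_trans nD0).
have e1 := ler_wpM2r (ltW D0) (ler_wpM2l (mulr_ge0 (sqr_ge0 K) m0) nD).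
have e2 := ler_wpM2r (ltW D0) (ler_wpM2l (mulr_ge0 (exprn_ge0 6 K0) m0) nD2).
have e3 := ler_wpM2r (ltW D0) (ler_wpM2l (mulr_ge0 (exprn_ge0 4 K0) m0) nD).
rewrite /remainder_bound.
move: (K ^+ 2) (K ^+ 6) (K ^+ 4) e1 e2 e3 => k2 k6 k4 e1 e2 e3.
lra.
Qed.

End scheme_remainder.

(** * The switching error *)

Section switching.
Context d (Om : measurableType d) (R : realType) (P : probability Om R) (N : nat).
Variables (F : R -> set (set Om)) (Q : 'M[R]_N) (W : R -> Om -> R) (r : R -> Om -> 'I_N).
Hypotheses (usual : usual_filtration P F) (bm : brownian_motion P F W)
  (mc : markov_chain P F Q r)
  (WR : independent_processes P (measurable : set (set R)) setT W r).
Local Notation E := (Ex P).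

(** The diagonal transition probability is [1 + Q i i * u] up to [o(u)], uniformly since there are
    finitely many states; the summand 1 in the constant absorbs the [o(u)]. The estimate is kept on
    cylinder events, so no conditional probability is formed. *)
Lemma transition_stay_ge : exists c u0 : R, [/\ 0 <= c, 0 < u0 &
  forall (n : nat) (s : nat -> R) (a : nat -> 'I_N) (u : R),
    0 <= s 0%N -> (forall k, (k < n)%N -> s k < s k.+1) -> 0 < u -> u < u0 ->
    (P ([set w | forall k, (k <= n)%N -> r (s k) w = a k] `&`
       [set w | r (s n + u) w <> a n]) <=
     (c * u)%:E * P [set w | forall k, (k <= n)%N -> r (s k) w = a k])%E].
Proof.
have [p [plim pchain]] := mc_transition mc.
have near0 : \forall u \near 0^'+, forall i : 'I_N,
    `|(p u i i - ((i == i)%:R + Q i i * u)) / u| < 1.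
  apply: filter_forall => i; have /cvgrPdist_lt/(_ 1 ltr01) := plim i i.
  by apply: filterS => u; rewrite sub0r normrN.
have /nbhs_ballP[e /= e0 He] := near0.
exists (1 + \sum_i `|Q i i|), e; split => //; first by rewrite addr_ge0// sumr_ge0.
move=> n s a u s0 sm u0 ue.
pose A := [set w | forall k, (k <= n)%N -> r (s k) w = a k].
have sk k : (k <= n)%N -> 0 <= s k.
  by elim: k => // k ih kn; apply: le_trans (ih (ltnW kn)) (ltW (sm k kn)).
have mr t i : 0 <= t -> measurable [set w | r t w = i].
  by move=> t0; apply: (filt_sub usual t0); exact: (mc_adapted mc).
have mA : measurable A.
  rewrite (_ : A = \bigcap_(k in `I_n.+1) [set w | r (s k) w = a k]); last first.
    by apply/seteqP; split => w h k; [move=> kn; apply: h|move=> kn; apply: h].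
  by apply: bigcap_measurable => [|k kn]; [exists 0%N|apply: mr; exact: sk].
have mB : measurable [set w | r (s n + u) w = a n].
  by apply: mr; rewrite addr_ge0// ?sk// ltW.
have hu : 1 - p u (a n) (a n) <= (1 + \sum_i `|Q i i|) * u.
  have ballu : ball 0 e u by rewrite /ball/= sub0r normrN gtr0_norm.
  have := He u ballu u0 (a n); rewrite eqxx/= normrM normfV (gtr0_norm u0) ltr_pdivrMr// mul1r => h.
  have h1 : - Q (a n) (a n) <= \sum_i `|Q i i|.
    apply: le_trans (_ : `|Q (a n) (a n)| <= _); first by rewrite -normrN ler_norm.
    by rewrite (bigD1 (a n))//= lerDl sumr_ge0.
  have h2 := ler_wpM2r (ltW u0) h1; move: h; rewrite ltr_norml => /andP[h3 _]; lra.
have -> : A `&` [set w | r (s n + u) w <> a n] = A `\` (A `&` [set w | r (s n + u) w = a n]).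
  by apply/seteqP; split => w /=; [move=> [h1 h2]; split => // -[]|move=> [h1 h2]; split => // h3; apply: h2].
rewrite measureD//; last 2 first.
- exact: measurableI.
- by apply: le_lt_trans (probability_le1 P mA) _; exact: ltry.
rewrite setIA setIid.
rewrite [X in (_ - X <= _)%E](_ : _ = (P A * (p u (a n) (a n))%:E)%E); last first.
  exact: (pchain n s a u (a n) s0 sm (ltW u0)).
have PA : P A \is a fin_num by exact: fin_num_measure.
have PA0 : 0 <= fine (P A) by exact: fine_ge0.
rewrite [X in (X - _ <= _)%E](_ : _ = (fine (P A))%:E); last by rewrite fineK.
rewrite -(fineK PA) -!EFinM -EFinB lee_fin.
by have := ler_wpM2r PA0 hu; lra.
Qed.

Variables (f g : R -> 'I_N -> R) (theta eta K T y0 Delta m : R).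
Hypotheses (T0 : 0 < T) (D0 : 0 < Delta) (cb : coefficient_bounds f g eta K).
Local Notation tau := (grid T Delta).
Local Notation n := (grid_size T Delta).
Let Y k w := pc_em f g theta eta T y0 (W ^~ w) (r ^~ w) Delta k.
Let q k w := 1 + `|Y k w|.

(** A deterministic path of the chain with prescribed values at the first grid points. Beyond index
    [k] the cast [inord] returns a default state, harmless because the scheme up to index [k] never
    reads it. *)
Let path (k : nat) (a : {ffun 'I_k.+1 -> 'I_N}) (t : R) : 'I_N :=
  a (inord (grid_index Delta t)).
Let Ya k (a : {ffun 'I_k.+1 -> 'I_N}) w :=
  pc_em f g theta eta T y0 (W ^~ w) (path a) Delta k.
Let cyl k (a : {ffun 'I_k.+1 -> 'I_N}) :=
  [set w | forall j, (j <= k)%N -> r (tau j) w = a (inord j)].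

Let path_grid k (a : {ffun 'I_k.+1 -> 'I_N}) j : (j < n)%N -> path a (tau j) = a (inord j).
Proof.
move=> jn; rewrite /path (grid_eq T0 D0 jn) (@grid_indexP _ _ D0 _ j)// lexx/=.
by rewrite ltr_pM2r// ltr_nat.
Qed.

Let Y_cyl k (a : {ffun 'I_k.+1 -> 'I_N}) w : (k < n)%N -> cyl a w -> Y k w = Ya a w.
Proof.
move=> kn cw; apply: pc_em_ext => j jk.
by rewrite path_grid ?(ltn_trans jk)// cw// ltnW.
Qed.

(* Decomposition along the path of [r], which is independent of [W]. *)
Let cyl_decomp k (X : R -> R) (C : 'I_N -> set Om) w : (k < n)%N ->
  X (Y k w) * (w \in C (r (tau k) w))%:R =
  \sum_(a : {ffun 'I_k.+1 -> 'I_N}) X (Ya a w) * (w \in cyl a `&` C (a ord_max))%:R.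
Proof.
move=> kn; pose aw : {ffun 'I_k.+1 -> 'I_N} := [ffun j : 'I_k.+1 => r (tau j) w].
have caw : cyl aw w by move=> j jk; rewrite /aw ffunE inordK.
rewrite (bigD1 aw)//= big1 ?addr0 => [|a aaw].
  by rewrite (Y_cyl kn caw) in_setI (mem_set caw)/= /aw ffunE.
rewrite in_setI memNset ?mulr0//= => ca; case/eqP: aaw.
by apply/ffunP => j; rewrite /aw ffunE ca -1?ltnS// inord_val.
Qed.

Let sW : sigma_algebra setT (process_sigma_algebra (measurable : set (set R)) W).
Proof. exact: smallest_sigma_algebra. Qed.
Let sr : sigma_algebra setT (process_sigma_algebra setT r).
Proof. exact: smallest_sigma_algebra. Qed.

Let rW t A : 0 <= t -> process_sigma_algebra setT r [set w | A (r t w)].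
Proof. by move=> t0; apply: sub_sigma_algebra; exists t, A. Qed.

Let cyl_sigma k (a : {ffun 'I_k.+1 -> 'I_N}) : process_sigma_algebra setT r (cyl a).
Proof.
pose G := process_sigma_algebra setT r.
have -> : cyl a = \bigcap_(j in `I_k.+1) [set w | r (tau j) w = a (inord j)].
  by apply/seteqP; split => w h j; [move=> kn; apply: h|move=> kn; apply: h].
have := @bigcap_measurable _ (g_sigma_algebraType G)
  (fun j => [set w | r (tau j) w = a (inord j)]) `I_k.+1.
move=> h; rewrite -(sigma_algebra_id sr); apply: h; first by exists 0%N.
move=> j _; apply: sub_sigma_algebra; apply: (rW (fun i => i = a (inord j))).
exact: grid_ge0.
Qed.

Let r_measurable C : process_sigma_algebra setT r C -> measurable C.
Proof.
apply: smallest_sub; first exact: sigma_algebra_measurable.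
move=> _ [t [B [t0 _ ->]]].
have -> : r t @^-1` B = \bigcup_(i in B) [set w | r t w = i].
  by apply/seteqP; split => w /=; [move=> h; exists (r t w)|move=> [i Bi /= ->]].
apply: fin_bigcup_measurable; first exact: finite_finset.
by move=> i _; apply: (filt_sub usual t0); exact: (mc_adapted mc).
Qed.

(** With the path frozen, the scheme is a function of [W] alone, while [C] belongs to the
    sigma-algebra of the chain; independence of the two processes factors the mean. *)
Let Ex_cyl k (a : {ffun 'I_k.+1 -> 'I_N}) C : process_sigma_algebra setT r C ->
  measurable_fun setT (fun w => (1 + `|Ya a w|) ^+ 2 * (w \in C)%:R) /\
  E (fun w => (1 + `|Ya a w|) ^+ 2 * (w \in C)%:R) =
  (E (fun w => (1 + `|Ya a w|) ^+ 2)%R * P C)%E.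
Proof.
move=> sC.
have aY : adapted_to (process_sigma_algebra (measurable : set (set R)) W)
    (fun w => (1 + `|Ya a w|) ^+ 2).
  apply: measurable_funX; apply: measurable_funD; first exact: measurable_cst.
  apply: measurableT_comp => //.
  apply: (@pc_em_adapted _ _ _ _ f g theta eta T y0 Delta (cb_f_measurable cb)
    (cb_g_measurable cb) (cb_fbar_measurable cb) _ W (fun t _ => path a t)).
    move=> j _; apply: sub_measurable_adapted => B mB.
    by apply: sub_sigma_algebra; exists (tau j), B; split => //; exact: grid_ge0.
  move=> j i _; have [->|ne] := eqVneq (path a (tau j)) i.
    rewrite (_ : [set _ | _] = setT); first exact: (@measurableT _ (g_sigma_algebraType _)).
    by apply/seteqP; split.
  rewrite (_ : [set _ | _] = set0); first exact: (@measurable0 _ (g_sigma_algebraType _)).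
  by apply/seteqP; split => // w /= e; rewrite e eqxx in ne.
have mW : process_sigma_algebra (measurable : set (set R)) W `<=` measurable.
  apply: smallest_sub; first exact: sigma_algebra_measurable.
  move=> _ [t [B [t0 mB ->]]]; rewrite -[X in measurable X]setTI.
  exact: (bm_measurable usual bm t0).
have mY := adapted_measurable mW aY.
have aC := @adapted_indic _ Om R _ _ sC.
have mC : measurable_fun setT (fun w => (w \in C)%:R : R).
  exact: adapted_measurable (fun A (h : process_sigma_algebra setT r A) => r_measurable h) aC.
split; first exact: measurable_funM.
rewrite ge0_Ex_indepM//; last first.
  move=> A B mA mB; apply: WR; first exact: (adapted_preimage sW aY mA).
  exact: (adapted_preimage sr aC mB).
congr (_ * _)%E; rewrite -(Ex_indic P (r_measurable sC)).
by apply: eq_integral => w _; rewrite indicE.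
Qed.

(** On each cylinder the mean factors, and the event that the chain has left its last state costs
    [c * Delta] times the probability of the cylinder. Summing over cylinders reassembles the second
    moment. *)
Lemma switching_moment c u0 s (k := grid_index Delta s) :
  (forall (n : nat) (s : nat -> R) (a : nat -> 'I_N) (u : R),
    0 <= s 0%N -> (forall k, (k < n)%N -> s k < s k.+1) -> 0 < u -> u < u0 ->
    (P ([set w | forall k, (k <= n)%N -> r (s k) w = a k] `&`
       [set w | r (s n + u) w <> a n]) <=
     (c * u)%:E * P [set w | forall k, (k <= n)%N -> r (s k) w = a k])%E) ->
  0 <= c -> Delta < u0 -> 0 <= s < T ->
  (E (fun w => q k w ^+ 2)%R <= m%:E)%E ->
  (E (fun w => q k w ^+ 2 * (r s w != r (tau k) w)%:R)%R <= (c * Delta * m)%:E)%E.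
Proof.
move=> stay c0 Du /andP[s0 sT] qm.
have sT' : 0 <= s <= T by rewrite s0 ltW.
have kn : (k < n)%N by apply: grid_index_size => //; exact: ltW.
have D0' := ltW D0; have q20 x : 0 <= (1 + `|x|) ^+ 2 :> R by exact: sqr_ge0.
have EqT : E (fun w => q k w ^+ 2)%R =
    (\sum_(a : {ffun 'I_k.+1 -> 'I_N}) E (fun w => (1 + `|Ya a w|) ^+ 2)%R * P (cyl a))%E.
  transitivity (E (fun w => \sum_(a : {ffun 'I_k.+1 -> 'I_N})
      (1 + `|Ya a w|) ^+ 2 * (w \in cyl a)%:R)%R).
    apply: eq_integral => w _; congr EFin.
    have := @cyl_decomp k (fun x => (1 + `|x|) ^+ 2) (fun=> setT) w kn.
    rewrite in_setT mulr1 => ->; apply: eq_bigr => a _; by rewrite setIT.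
  rewrite Ex_sum; last 2 first.
  - by move=> a; exact: (Ex_cyl a (cyl_sigma a)).1.
  - by move=> a w; rewrite mulr_ge0.
  by apply: eq_bigr => a _; exact: (Ex_cyl a (cyl_sigma a)).2.
pose C i := [set w | r s w <> i].
have sC k' (a : {ffun 'I_k'.+1 -> 'I_N}) : process_sigma_algebra setT r (cyl a `&` C (a ord_max)).
  rewrite -(sigma_algebra_id sr); apply: (@measurableI _ (g_sigma_algebraType _)).
    by apply: sub_sigma_algebra; exact: cyl_sigma.
  by apply: sub_sigma_algebra; exact: (rW (fun i => i <> a ord_max)).
rewrite [leLHS](_ : _ = (\sum_(a : {ffun 'I_k.+1 -> 'I_N}) E (fun w => (1 + `|Ya a w|) ^+ 2)%R *
       P (cyl a `&` C (a ord_max)))%E); last first.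
  transitivity (E (fun w => \sum_(a : {ffun 'I_k.+1 -> 'I_N})
      (1 + `|Ya a w|) ^+ 2 * (w \in cyl a `&` C (a ord_max))%:R)%R).
    apply: eq_integral => w _; congr EFin.
    rewrite -(@cyl_decomp k (fun x => (1 + `|x|) ^+ 2) C w kn); congr (_ * _%:R).
    by congr nat_of_bool; apply/idP/idP => [/eqP h|]; [rewrite inE|rewrite inE => /eqP].
  rewrite Ex_sum; last 2 first.
  - by move=> a; exact: (Ex_cyl a (sC _ a)).1.
  - by move=> a w; rewrite mulr_ge0.
  by apply: eq_bigr => a _; exact: (Ex_cyl a (sC _ a)).2.
apply: (@le_trans _ _ ((c * Delta)%:E * E (fun w => q k w ^+ 2)%R)%E); last first.
  by rewrite [X in (_ <= X)%E]EFinM lee_wpmul2l// lee_fin mulr_ge0.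
rewrite EqT ge0_sume_distrr; last first.
  by move=> a; rewrite mule_ge0// Ex_ge0.
apply: lee_sum => a _; rewrite muleCA; apply: lee_wpmul2l; first exact: Ex_ge0.
have sk : tau k <= s by exact: grid_index_le.
(* At the grid time itself no switch can have occurred; the transition estimate requires a positive
   elapsed time. *)
have [es|ns] := eqVneq s (tau k).
  rewrite (_ : _ `&` _ = set0); first by rewrite measure0 mule_ge0// lee_fin mulr_ge0.
  apply/seteqP; split => // w [cw]; rewrite /C/= es; apply.
  by rewrite cw//; congr (a _); apply: val_inj; rewrite /= inordK.
have u0' : 0 < s - tau k by rewrite subr_gt0 lt_neqAle eq_sym ns.
have uD : s - tau k <= Delta.
  have /andP[_] := grid_step T D0 k; apply: le_trans.
  by rewrite lerB// grid_index_ge.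
have strict j : (j < k)%N -> tau j < tau j.+1.
  move=> jk; rewrite !grid_eq ?(leq_ltn_trans _ kn)//; last exact: ltnW.
  by rewrite ltr_pM2r// ltr_nat.
have := stay k tau (fun j => a (inord j)) (s - tau k) (grid_ge0 T0 D0 0) strict u0'
  (le_lt_trans uD Du).
rewrite addrC subrK (_ : inord k = ord_max :> 'I_k.+1); last by apply: val_inj; rewrite /= inordK.
move=> h; apply: (le_trans h); apply: lee_wpmul2r => //.
by rewrite lee_fin ler_wpM2l.
Qed.

End switching.

(** * Gronwall's lemma *)

Section integral_inequalities.
Context {R : realType}.
Local Notation mu := (@lebesgue_measure R).

Lemma Rintegral_sqr_le (t : R) (phi : R -> R) : 0 <= t ->
  mu.-integrable `[0, t]%classic (EFin \o phi) ->
  (((\int[mu]_(s in `[0, t]) phi s) ^+ 2)%:E <=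
   t%:E * \int[mu]_(s in `[0%R, t]) (phi s ^+ 2)%R%:E)%E.
Proof.
rewrite le_eqVlt => /orP[/eqP <- _|t0 iphi].
  by rewrite set_itv1 Rintegral_set1 expr0n mul0e.
have [mphi iphi'] := integrableP _ _ _ iphi.
have mph : measurable_fun `[0, t] phi by exact/measurable_EFinP.
have J0 : (0 <= \int[mu]_(s in `[0%R, t]) (phi s ^+ 2)%R%:E)%E.
  by apply: integral_ge0 => s _; rewrite lee_fin sqr_ge0.
have [->|Jfin] := eqVneq (\int[mu]_(s in `[0%R, t]) (phi s ^+ 2)%R%:E)%E +oo%E.
  by rewrite gt0_muley ?lte_fin// leey.
pose A := fine (\int[mu]_(s in `[0%R, t]) (phi s ^+ 2)%R%:E)%E.
have JE : (\int[mu]_(s in `[0%R, t]) (phi s ^+ 2)%R%:E)%E = A%:E.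
  by rewrite fineK// ge0_fin_numE// ltey.
pose mm := \int[mu]_(s in `[0, t]) `|phi s|.
have mE : (\int[mu]_(s in `[0%R, t]) (`|phi s|)%R%:E)%E = mm%:E.
  by rewrite /mm /Rintegral fineK// ge0_fin_numE//; apply: integral_ge0 => s _; rewrite lee_fin.
have mm0 : 0 <= mm by apply: Rintegral_ge0.
(* The mean of the absolute value. Integrating [2 * c * |phi| <= phi ^+ 2 + c ^+ 2] with this
   optimal [c] is the Cauchy-Schwarz inequality against the constant 1. *)
pose c := mm / t; have c0 : 0 <= c by rewrite divr_ge0// ltW.
have c20 : 0 <= 2 * c by apply: mulr_ge0.
have mut : mu `[0, t]%classic = t%:E.
  by rewrite [LHS]lebesgue_measure_itv/= lte_fin t0 oppr0 adde0.
have key : ((2 * c * mm)%:E <= (A + c ^+ 2 * t)%:E)%E.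
  have mabs : measurable_fun `[0, t] (fun s => (`|phi s|)%:E).
    by apply/measurable_EFinP; apply: measurableT_comp.
  have msq : measurable_fun `[0, t] (fun s => (phi s ^+ 2)%:E).
    by apply/measurable_EFinP; exact: measurable_funX.
  have sq0 s : `[0, t]%classic s -> (0 <= (phi s ^+ 2)%:E)%E by rewrite lee_fin sqr_ge0.
  have csq0 s : `[0, t]%classic s -> (0 <= (c ^+ 2)%:E)%E by rewrite lee_fin sqr_ge0.
  rewrite EFinM -mE -ge0_integralZl; [|by []|exact: mabs|by move=> s _; rewrite lee_fin|
    by rewrite lee_fin].
  rewrite EFinD -JE [X in (_ <= _ + X)%E](_ : _ = \int[mu]_(s in `[0%R, t]) (c ^+ 2)%:E)%E; last first.
    by rewrite integral_cst// [X in (_ * X)%E]mut -EFinM.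
  rewrite -ge0_integralD; [|by []|exact: sq0|exact: msq|exact: csq0|exact: measurable_cst].
  apply: ge0_le_integral => //.
  - by move=> s _; rewrite -EFinM lee_fin; apply: mulr_ge0.
  - by apply: emeasurable_funM => //; exact: measurable_cst.
  - by apply: emeasurable_funD => //; exact: measurable_cst.
  - move=> s _; rewrite -EFinD -EFinM lee_fin -(real_normK (num_real (phi s))).
    by have := sqr_ge0 (`|phi s| - c); lra.
have {}key : mm ^+ 2 <= t * A.
  move: key; rewrite lee_fin /c => key.
  have t0' := ltW t0; have := ler_wpM2l t0' key.
  have -> : t * (2 * (mm / t) * mm) = 2 * mm ^+ 2 by field; rewrite gt_eqF.
  have -> : t * (A + (mm / t) ^+ 2 * t) = t * A + mm ^+ 2 by field; rewrite gt_eqF.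
  lra.
rewrite JE -EFinM lee_fin (le_trans _ key)// -(real_normK (num_real (\int[mu]_(s in _) _))).
by rewrite lerXn2r ?nnegrE//; exact: le_normr_Rintegral.
Qed.

(* On a step of length [h] with [b * h <= 1/2] the bound self-improves:
   [sup w <= a * (1 + b * T * c) + sup w / 2]. *)
Lemma gronwall_bounded (T b : R) : 0 < T -> 0 <= b -> exists2 c : R, 0 <= c &
  forall (a M : R) (w : R -> \bar R), 0 <= a -> measurable_fun `[0, T] w ->
  (forall s, 0 <= s <= T -> (0 <= w s)%E) -> (forall s, 0 <= s < T -> (w s <= M%:E)%E) ->
  (forall s, 0 <= s < T -> (w s <= a%:E + b%:E * \int[mu]_(u in `[0%R, s]) w u)%E) ->
  forall s, 0 <= s < T -> (w s <= (c * a)%:E)%E.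
Proof.
(* The number of steps for which [b * T / n <= 1 / 2]. It depends on [T] and [b] alone, and so does
   the constant obtained by induction. *)
move=> T0 b0; pose n := (Num.truncn (2 * b * T)).+1.
have n0 : 0 < n%:R :> R by [].
pose h := T / n%:R; have h0 : 0 < h by rewrite divr_gt0.
have bh : b * h <= 1 / 2.
  rewrite /h mulrA ler_pdivrMr//.
  by have := truncnS_gt (2 * b * T); rewrite -/n; lra.
suff H j : exists2 c : R, 0 <= c & forall (a M : R) (w : R -> \bar R), 0 <= a ->
    measurable_fun `[0, T] w ->
    (forall s, 0 <= s <= T -> (0 <= w s)%E) -> (forall s, 0 <= s < T -> (w s <= M%:E)%E) ->
    (forall s, 0 <= s < T -> (w s <= a%:E + b%:E * \int[mu]_(u in `[0%R, s]) w u)%E) ->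
    forall s, 0 <= s < T -> s <= j%:R * h -> (w s <= (c * a)%:E)%E.
  have [c c0 Hc] := H n; exists c => // a M w a0 mw w0 wM wI s sT.
  apply: (Hc a M w) => //; rewrite /h mulrC divfK ?gt_eqF//.
  by case/andP: sT => _ /ltW.
elim: j => [|j [c c0 Hc]].
  exists 1 => // a M w a0 mw w0 wM wI s sT; rewrite mul0r => s0.
  have e : s = 0 by apply/le_anti; rewrite s0; case/andP: sT.
  by have := wI s sT; rewrite e set_itv1 integral_set1 mule0 adde0 mul1r.
exists (2 * (1 + b * (T * c))); first by rewrite mulr_ge0// addr_ge0// !mulr_ge0// ltW.
move=> a M w a0 mw w0 wM wI.
pose D := [set s | 0 <= s < T /\ s <= j.+1%:R * h].
pose S := ereal_sup (w @` D).
have D0 : D 0 by rewrite /D/= lexx T0 mulr_ge0// ltW.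
have wS s : D s -> (w s <= S)%E by move=> Ds; apply: ereal_sup_ubound; exists s.
have S0 : (0 <= S)%E by apply: le_trans (wS 0 D0); apply: w0; rewrite lexx ltW.
(* The a priori bound [M] is used only here, to make the supremum finite so that half of it may be
   subtracted; it leaves no trace in the constant. *)
have SM : (S <= M%:E)%E by apply: ge_ereal_sup => _ [s [sT _] <-]; exact: wM.
have Sfin : S \is a fin_num by rewrite ge0_fin_numE// (le_lt_trans SM)// ltry.
have S0' : 0 <= fine S by exact: fine_ge0.
have Sle : (S <= (a + b * (T * (c * a)) + fine S / 2)%:E)%E.
  apply: ge_ereal_sup => _ [s [sT sj] <-]; apply: (le_trans (wI s sT)).
  have /andP[s0 sT'] := sT.
  pose A := `]j%:R * h, j.+1%:R * h]%classic : set R.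
  have mA : measurable A by exact: measurable_itv.
  have mI : measurable_fun `[0, s] (fun u => (\1_A u)%:E : \bar R).
    by apply/measurable_EFinP; apply: measurable_funTS; exact: measurable_indic.
  have h1 : (\int[mu]_(u in `[0%R, s]) w u <=
      \int[mu]_(u in `[0%R, s]) ((c * a)%:E + (fine S)%:E * (\1_A u)%:E))%E.
    apply: ge0_le_integral => //.
    - move=> u; rewrite /= in_itv/= => /andP[u0 us]; apply: w0.
      by rewrite u0 (le_trans us)// ltW.
    - apply: measurable_funS mw => // u; rewrite /= !in_itv/= => /andP[-> us].
      by rewrite (le_trans us)// ltW.
    - apply: emeasurable_funD; first exact: measurable_cst.
      by apply: emeasurable_funM; [exact: measurable_cst|exact: mI].
    move=> u; rewrite /= in_itv/= => /andP[u0 us].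
    have uT : 0 <= u < T by rewrite u0 (le_lt_trans us).
    have [uj|uj] := leP u (j%:R * h).
      apply: le_trans (Hc a M w a0 mw w0 wM wI u uT uj) _.
      by rewrite -EFinM -EFinD lee_fin lerDl mulr_ge0.
    rewrite indicE mem_set; last by rewrite /A/= in_itv/= uj (le_trans us).
    rewrite mule1 fineK//; apply: le_trans (leeDr _ _); last by rewrite lee_fin mulr_ge0.
    by apply: wS; split => //; rewrite (le_trans us).
  have h2 : (\int[mu]_(u in `[0%R, s]) ((c * a)%:E + (fine S)%:E * (\1_A u)%:E) <=
      (T * (c * a) + h * fine S)%:E)%E.
    rewrite ge0_integralD; [|by []|by move=> u _; rewrite lee_fin mulr_ge0|exact: measurable_cst|
      by move=> u _; rewrite -EFinM lee_fin mulr_ge0|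
      by apply: emeasurable_funM => //; exact: measurable_cst].
    rewrite ge0_integralZl; [|by []|exact: mI|by move=> u _; rewrite lee_fin|by rewrite lee_fin].
    rewrite integral_cst; last by [].
    rewrite integral_indic//.
    rewrite [X in ((c * a)%:E * X + _ <= _)%E](_ : _ = s%:E); last first.
      rewrite [LHS]lebesgue_measure_itv/= lte_fin; case: ltP => h3.
        by rewrite oppr0 adde0.
      by congr EFin; apply/le_anti; rewrite s0 h3.
    have hA : (mu (A `&` `[0%R, s]%classic) <= h%:E)%E.
      apply: (@le_trans _ _ (mu A)); first by apply: le_measure; rewrite ?inE//; exact: measurableI.
      rewrite [leLHS]lebesgue_measure_itv/= lte_fin ltr_pM2r// ltr_nat ltnSn -EFinB lee_fin.
      by rewrite -mulrBl -natr1 addrAC subrr add0r mul1r.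
    apply: le_trans (leeD (lexx _) (lee_wpmul2l _ hA)) _; first by rewrite lee_fin.
    rewrite -!EFinM -EFinD lee_fin [c * a * s]mulrC [fine S * h]mulrC lerD2r.
    by rewrite ler_wpM2r ?mulr_ge0// ltW.
  apply: le_trans (leeD (lexx _) (lee_wpmul2l _ (le_trans h1 h2))) _; first by rewrite lee_fin.
  by rewrite -EFinM -EFinD lee_fin; have := ler_wpM2r S0' bh; lra.
move=> s sT sj; apply: (le_trans (wS s (conj sT sj))).
by move: Sle; rewrite -(fineK Sfin) !lee_fin; lra.
Qed.

End integral_inequalities.

(** * The localized error *)

Section localized.
Context d (Om : measurableType d) (R : realType) (P : probability Om R) (N : nat).
Variables (F : R -> set (set Om)) (W : R -> Om -> R) (r : R -> Om -> 'I_N).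
Hypotheses (usual : usual_filtration P F) (bm : brownian_motion P F W)
  (ar : forall (t : R) i, 0 <= t -> F t [set w | r t w = i]).
Local Notation E := (Ex P).
Local Notation mu := (@lebesgue_measure R).
Variables (f g : R -> 'I_N -> R) (theta eta K T y0 : R).
Hypotheses (T0 : 0 < T) (theta01 : 0 <= theta <= 1) (cb : coefficient_bounds f g eta K).
Variables (y I : R -> Om -> R).
Hypotheses (y_adapted : forall t : R, 0 <= t <= T -> sub_measurable (F t) (y t))
  (drift : class_L P F T 1 (fun t w => f (y t w) (r t w)))
  (ito : is_ito_integral P F W T (fun t w => g (y t w) (r t w)) I).
Variable bad : set Om.
Hypotheses (F_bad : F 0 bad)
  (W_cont : forall w, ~ bad w -> {within `[0, +oo[, continuous (W ^~ w)})
  (y_cont : forall w, ~ bad w -> {within `[0, T], continuous (y ^~ w)})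
  (I_cont : forall w, ~ bad w -> {within `[0, T], continuous (I ^~ w)})
  (f_int : forall w, ~ bad w ->
     mu.-integrable `[0, T]%classic (EFin \o (fun s => f (y s w) (r s w))))
  (y_eq : forall w, ~ bad w -> forall t : R, 0 <= t <= T ->
     y t w = y0 + \int[mu]_(s in `[0, t]) f (y s w) (r s w) + I t w).
Variable qt : nat -> R.
Hypotheses (qt_itv : forall i, 0 <= qt i <= T)
  (qt_dense : forall s, 0 <= s <= T -> forall e : R, 0 < e ->
     exists i, qt i <= s /\ s - qt i < e).

(** Only countably many times are tested, which gives measurability, and only those up to [s], which
    gives adaptedness. Paths outside [bad] are continuous, so the countable test controls the whole
    interval. *)
Definition level_set (l s : R) : set Om :=
  ~` bad `&` [set w | forall i, qt i <= s -> `|y (qt i) w| <= l].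

Lemma level_set_adapted l s : 0 <= s <= T -> F s (level_set l s).
Proof.
move=> /andP[s0 sT]; have sF := filt_sigma_algebra usual s0.
rewrite -(sigma_algebra_id sF); apply: (@measurableI _ (g_sigma_algebraType _)).
  apply: (@measurableC _ (g_sigma_algebraType _)); apply: sub_sigma_algebra.
  exact: (filt_mono usual (lexx 0) s0).
have -> : [set w | forall i, qt i <= s -> `|y (qt i) w| <= l] =
    \bigcap_i (if qt i <= s then y (qt i) @^-1` [set x | `|x| <= l] else setT).
  apply/seteqP; split => w /= h i; first by move=> _; case: ifP => // qs; exact: h.
  by move=> qs; have := h i Logic.I; rewrite qs.
apply: (@bigcapT_measurable _ (g_sigma_algebraType _)) => i; case: ifP => [qs|_]; last exact: measurableT.
apply: sub_sigma_algebra; apply: (filt_mono usual _ qs); first by case/andP: (qt_itv i).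
rewrite (_ : [set x | _] = `[- l, l]%classic); first exact: (y_adapted (qt_itv i)).
by apply/seteqP; split => x /=; rewrite in_itv/= ler_norml.
Qed.

Lemma level_set_dec l s s' : s <= s' -> level_set l s' `<=` level_set l s.
Proof. by move=> ss w [nb h]; split => // i qs; apply: h; exact: le_trans ss. Qed.

Let y_measurable t : 0 <= t <= T -> measurable_fun setT (y t).
Proof.
move=> tT; have /andP[t0 _] := tT.
apply: (@adapted_measurable _ _ _ (F t)); first exact: (filt_sub usual).
by apply: sub_measurable_adapted; exact: y_adapted.
Qed.

Lemma level_set_measurable l :
  measurable [set z : R * Om | 0 <= z.1 <= T /\ level_set l z.1 z.2].
Proof.
have -> : [set z : R * Om | 0 <= z.1 <= T /\ level_set l z.1 z.2] =
    (`[0, T]%classic `*` ~` bad) `&`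
    \bigcap_i ((`]-oo, qt i[%classic `*` setT) `|` (setT `*` [set w | `|y (qt i) w| <= l])).
  apply/seteqP; split => -[s w] /=; rewrite in_itv/=.
    move=> [sT [nb h]]; split => // i _; rewrite /= in_itv/=.
    by have [qs|sq] := leP (qt i) s; [right; split => //; exact: h|left].
  move=> [[sT nb] h]; split => //; split => // i qs.
  by have [[]|[]//] := h i Logic.I; rewrite /= in_itv/= ltNge qs.
apply: measurableI.
  apply: measurableX => //; apply: measurableC; exact: (filt_sub usual (lexx 0)).
apply: bigcapT_measurable => i; apply: measurableU; apply: measurableX => //.
rewrite -[X in measurable X]setTI (_ : [set w | _] = y (qt i) @^-1` `[- l, l]%classic).
  exact: (y_measurable (qt_itv i)).
by apply/seteqP; split => w /=; rewrite in_itv/= ler_norml.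
Qed.

(** Here the times must be dense from below: only those not exceeding [s] are constrained, and
    continuity carries the bound from them to [s]. *)
Lemma level_set_le l s w : 0 <= s <= T -> level_set l s w -> `|y s w| <= l.
Proof.
move=> sT [nb h]; rewrite leNgt; apply/negP => ls.
have /subspace_continuousP/(_ s) := y_cont nb.
rewrite /= in_itv/= sT => /(_ isT)/cvgrPdist_lt/(_ (`|y s w| - l)).
rewrite subr_gt0 => /(_ ls); rewrite /within/= => /nbhs_ballP[e /= e0 He].
have [i [qs qe]] := qt_dense sT e0.
have be : ball s e (qt i) by rewrite /ball/= ger0_norm ?subr_ge0.
have := He _ be; rewrite in_itv/= qt_itv => /(_ isT) h1.
have h2 := h i qs; have h3 := ler_distD 0 (y s w) (y (qt i) w).
have := ler_normD (y s w - y (qt i) w) (y (qt i) w); rewrite subrK; lra.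
Qed.

Variables (Delta m sw : R).
Hypotheses (D0 : 0 < Delta) (D1 : Delta <= 1).
Local Notation tau := (grid T Delta).
Local Notation n := (grid_size T Delta).
Let Y k w := pc_em f g theta eta T y0 (W ^~ w) (r ^~ w) Delta k.
Let q k w := 1 + `|Y k w|.
Hypotheses (moment : forall k, (E (fun w => q k w ^+ 2)%R <= m%:E)%E)
  (switch : forall s, 0 <= s < T -> (E (fun w => q (grid_index Delta s) w ^+ 2 *
    (r s w != r (tau (grid_index Delta s)) w)%:R)%R <= (sw * Delta)%:E)%E).
Variable l : R.
Hypothesis l0 : 0 <= l.
Let G := level_set l.
Let fY k w := f (Y k w) (r (tau k) w).
Let gY k w := g (Y k w) (r (tau k) w).
Let psif s w := step_value n tau (fY ^~ w) s.
Let psig s w := step_value n tau (gY ^~ w) s.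
(** The quantity for Gronwall's lemma: its time integral controls the drift part of the error and
    the integral gap alike. *)
Let phi s w := ((psif s w - f (y s w) (r s w)) ^+ 2 +
  (psig s w - g (y s w) (r s w)) ^+ 2) * (w \in G s)%:R.
Let gap s w := step_integral n tau (gY ^~ w) (W ^~ w) s - I s w.
Let Z s w := pc_em_cont f g theta eta T y0 (W ^~ w) (r ^~ w) Delta s - y s w.
Let wf s := (\int[P]_w (phi s w)%:E)%E.

Let tau0 k : 0 <= tau k. Proof. exact: grid_ge0. Qed.
Let taum k : tau k <= tau k.+1. Proof. exact: grid_homo. Qed.
Let K0 : 0 <= K. Proof. exact: le_trans (cb_ge1 cb). Qed.

Let fY_adapted k : adapted_to (F (tau k)) (fY k).
Proof. exact: (scheme_coef_adapted usual bm ar theta y0 T0 D0 cb (cb_f_measurable cb)). Qed.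
Let gY_adapted k : adapted_to (F (tau k)) (gY k).
Proof. exact: (scheme_coef_adapted usual bm ar theta y0 T0 D0 cb (cb_g_measurable cb)). Qed.
Let fY_measurable k : measurable_fun setT (fY k).
Proof. exact: adapted_measurable (filt_sub usual (tau0 k)) (@fY_adapted k). Qed.
Let gY_measurable k : measurable_fun setT (gY k).
Proof. exact: adapted_measurable (filt_sub usual (tau0 k)) (@gY_adapted k). Qed.

Let phi0 s w : 0 <= phi s w.
Proof. by apply: mulr_ge0 => //; apply: addr_ge0; exact: sqr_ge0. Qed.

Let mphiT : measurable_fun (`[0, T] `*` setT) (fun z : R * Om => (phi z.1 z.2)%:E).
Proof.
apply/measurable_EFinP; apply: measurable_funM.
  apply: measurable_funD; apply: measurable_funX; apply: measurable_funB.
  - by apply: measurable_funTS; apply: (@measurable_step_value _ Om R n tau fY).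
  - exact: (cl_measurable drift).
  - by apply: measurable_funTS; apply: (@measurable_step_value _ Om R n tau gY).
  - exact: (cl_measurable (ito_integrand ito)).
apply: (@eq_measurable_fun _ _ _ _ _
  (\1_[set z : R * Om | 0 <= z.1 <= T /\ G z.1 z.2] : R * Om -> R)).
  move=> z /set_mem[/=]; rewrite in_itv/= => zT _; rewrite indicE.
  suff -> : (z \in [set z : R * Om | 0 <= z.1 <= T /\ G z.1 z.2]) = (z.2 \in G z.1) by [].
  by apply/idP/idP; rewrite !inE/= => // -[].
by apply: measurable_funTS; apply: measurable_indic; exact: level_set_measurable.
Qed.

Let mphi t : t <= T -> measurable_fun (`[0, t] `*` setT) (fun z : R * Om => (phi z.1 z.2)%:E).
Proof.
move=> tT; apply: measurable_funS mphiT; first exact: measurableX.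
move=> z [] /=; rewrite !in_itv/= => /andP[-> zt] _; split => //.
by rewrite (le_trans zt).
Qed.

Let phie0 s w : (0 <= (phi s w)%:E)%E. Proof. by rewrite lee_fin. Qed.

Let mPhi t : t <= T -> measurable_fun setT (fun w => \int[mu]_(s in `[0%R, t]) (phi s w)%:E)%E.
Proof.
move=> tT; apply: (@measurable_time_integral _ _ _ `[0, t]%classic (fun s w => (phi s w)%:E)) => //.
exact: mphi.
Qed.

Let Phi0 t w : (0 <= \int[mu]_(s in `[0%R, t]) (phi s w)%:E)%E.
Proof. exact: integral_ge0. Qed.

Let tonelli t : t <= T -> (\int[P]_w \int[mu]_(s in `[0%R, t]) (phi s w)%:E =
  \int[mu]_(s in `[0%R, t]) wf s)%E.
Proof.
move=> tT; apply: (@time_space_tonelli _ _ _ P `[0, t]%classic (fun s w => (phi s w)%:E)) => //.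
exact: mphi.
Qed.

Let mwf : measurable_fun `[0, T] wf.
Proof.
by apply: (@measurable_space_integral _ _ _ P `[0, T]%classic (fun s w => (phi s w)%:E)).
Qed.

Let lin2 (ph : R -> 'I_N -> R) x i : (forall x i, `|ph x i| <= K * (1 + `|x|)) ->
  ph x i ^+ 2 <= K ^+ 2 * (1 + `|x|) ^+ 2.
Proof.
move=> H; rewrite -(real_normK (num_real (ph x i))) -exprMn lerXn2r ?nnegrE//.
by apply: mulr_ge0 => //; apply: addr_ge0.
Qed.

Let gY2 k : (E (fun w => gY k w ^+ 2)%R <= (K ^+ 2 * m)%:E)%E.
Proof.
have mq : measurable_fun setT (fun w => q k w ^+ 2).
  apply: measurable_funX; apply: measurable_funD => //; apply: measurableT_comp => //.
  exact: (scheme_measurable usual bm ar theta y0 T0 D0 cb).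
apply: (@le_trans _ _ (E (fun w => K ^+ 2 * q k w ^+ 2)%R)).
  by apply: Ex_le => w; [exact: sqr_ge0|apply: lin2; exact: cb_g_lin cb].
rewrite Ex_Z ?sqr_ge0//; last by move=> w; exact: sqr_ge0.
by rewrite [X in (_ <= X)%E]EFinM; apply: lee_wpmul2l => //; rewrite lee_fin sqr_ge0.
Qed.

Let gap_max S t w : R := \big[Num.max/0]_(s <- S) `|gap (Num.max 0 (Num.min s t)) w|.

(** The level enters only through the bound [K * (1 + l)] on the localized integrand, a hypothesis
    of the isometry inequality. The constant 16 does not see it. *)
Let gap_moment t S : 0 <= t <= T -> (forall s, s \in S -> 0 <= s <= t) ->
  (E (fun w => gap_max S t w ^+ 2 * (w \in G t)%:R)%R <=
   16%:E * \int[mu]_(s in `[0%R, t]) wf s)%E.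
Proof.
move=> tT St; have /andP[t0 tleT] := tT.
have K1l : 0 <= K * (1 + l) by apply: mulr_ge0 => //; apply: addr_ge0.
have := @ito_localized_sup _ _ _ P F W usual bm T _ I ito n tau gY
  (fun k _ => tau0 k) (fun k _ => taum k) (fun k _ => @gY_adapted k)
  (fun k _ => le_lt_trans (gY2 k) (ltry _)) (K * (1 + l)) G K1l
  (@level_set_adapted l) (fun s s' _ ss _ => @level_set_dec l s s' ss)
  (level_set_measurable l) _ t S tT St.
move=> /(_ _) h; apply: le_trans (h _) _ => {h}.
  move=> s w sT Gs; apply: le_trans (cb_g_lin cb _ _) _.
  by apply: ler_wpM2l => //; rewrite lerD2l; exact: level_set_le Gs.
rewrite -tonelli//; apply: lee_wpmul2l => //; apply: ge0_le_integralT => w.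
  by apply: integral_ge0 => s _; rewrite lee_fin mulr_ge0// sqr_ge0.
rewrite integral_mkcond [X in (_ <= X)%E]integral_mkcond; apply: ge0_le_integralT => s.
  by rewrite patchE; case: ifP => // _; rewrite lee_fin mulr_ge0// sqr_ge0.
rewrite !patchE; case: ifP => // _; rewrite lee_fin ler_wpM2r//.
by rewrite lerDr sqr_ge0.
Qed.

Let gapE t w : 0 <= t -> gap_max [:: t] t w ^+ 2 = gap t w ^+ 2.
Proof.
move=> t0; rewrite /gap_max big_cons big_nil minxx (max_idPr t0).
by rewrite (max_idPl (normr_ge0 _)) real_normK ?num_real.
Qed.

Variable V : Om -> \bar R.
Hypotheses (mV : measurable_fun setT V) (V0 : forall w, (0 <= V w)%E)
  (VR : forall w, {within `[0, +oo[, continuous (W ^~ w)} -> forall t, 0 <= t <= T ->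
      ((scheme_rem f g theta eta T y0 Delta (W ^~ w) (r ^~ w) t ^+ 2)%:E <= V w)%E)
  (VE : (\int[P]_w V w <= (remainder_bound K T m * Delta)%:E)%E).

(** Subtracting the two equations leaves a drift difference, the gap between the stochastic
    integrals and the remainder; 3 comes from the square of the sum and [T] from the Cauchy-Schwarz
    inequality in time. *)
Let Z_sqr_le t w : 0 <= t <= T -> G t w -> ((Z t w ^+ 2)%:E <=
  3%:E * (T%:E * \int[mu]_(s in `[0%R, t]) (phi s w)%:E + (gap t w ^+ 2)%:E + V w))%E.
Proof.
move=> tT Gt; have [nb _] := Gt; have /andP[t0 tleT] := tT.
pose df s := f (Y (grid_index Delta s) w) (r (tau (grid_index Delta s)) w) - f (y s w) (r s w).
have sub : `[0, t]%classic `<=` `[0, T]%classic.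
  by move=> s; rewrite /= !in_itv/= => /andP[-> st]; rewrite (le_trans st).
have fi : mu.-integrable `[0, t]%classic (EFin \o (fun s => f (y s w) (r s w))).
  exact: integrableS (f_int nb).
have si : mu.-integrable `[0, t]%classic (EFin \o (fun s => fY (grid_index Delta s) w)).
  exact: (grid_step_integrable D0 (fY ^~ w)).
have di : mu.-integrable `[0, t]%classic (EFin \o df).
  have h : mu.-integrable `[0, t]%classic ((EFin \o (fun s => fY (grid_index Delta s) w)) \-
    (EFin \o (fun s => f (y s w) (r s w))))%E by apply: integrableB.
  by apply: eq_integrable h.
have dE : \int[mu]_(s in `[0, t]) df s =
    \int[mu]_(s in `[0, t]) f (Ybar f g theta eta T y0 (W ^~ w) (r ^~ w) Delta s)
      (rbar T (r ^~ w) Delta s) - \int[mu]_(s in `[0, t]) f (y s w) (r s w).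
  by apply: RintegralB.
have -> : Z t w = \int[mu]_(s in `[0, t]) df s + gap t w +
    scheme_rem f g theta eta T y0 Delta (W ^~ w) (r ^~ w) t.
  rewrite /Z (pc_em_cont_decomp f g theta eta y0 (W ^~ w) (r ^~ w) T0 D0 tT) (y_eq nb tT).
  rewrite dE /gap /gY /Y; ring.
set a := \int[mu]_(s in _) _; set c := scheme_rem _ _ _ _ _ _ _ _ _ _.
have sq3 (x1 x2 x3 : R) : (x1 + x2 + x3) ^+ 2 <= 3 * (x1 ^+ 2 + x2 ^+ 2 + x3 ^+ 2).
  by have := sqr_ge0 (x1 - x2); have := sqr_ge0 (x1 - x3); have := sqr_ge0 (x2 - x3); lra.
apply: (@le_trans _ _ (3 * (a ^+ 2 + gap t w ^+ 2 + c ^+ 2))%:E); first by rewrite lee_fin.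
rewrite EFinM; apply: lee_wpmul2l => //.
rewrite EFinD; apply: leeD; last by apply: VR => //; exact: W_cont.
rewrite EFinD; apply: leeD => //; apply: le_trans (Rintegral_sqr_le t0 di) _.
have dphi : (\int[mu]_(s in `[0%R, t]) (df s ^+ 2)%:E <= \int[mu]_(s in `[0%R, t]) (phi s w)%:E)%E.
  have md : measurable_fun `[0, t[ (fun s => (df s ^+ 2)%:E).
    apply/measurable_EFinP; apply: measurable_funX.
    have /measurable_EFinP h := measurable_int _ di.
    by apply: measurable_funS h => // s; rewrite /= !in_itv/= => /andP[-> /ltW].
  have mp : measurable_fun `[0, t[ (fun s => (phi s w)%:E).
    have h : measurable_fun `[0, t] (fun s => (phi s w)%:E).
      apply: (@measurable_section _ _ _ `[0, t]%classic (fun s w => (phi s w)%:E)) => //.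
      exact: mphi.
    by apply: measurable_funS h => // s; rewrite /= !in_itv/= => /andP[-> /ltW].
  (* The end point is removed because [t] may be [T], where the step value no longer represents the
     scheme. *)
  rewrite -integral_itv_bndo_bndc//.
  rewrite -[X in (_ <= X)%E]integral_itv_bndo_bndc//.
  rewrite integral_mkcond [X in (_ <= X)%E]integral_mkcond; apply: ge0_le_integralT => s.
    by rewrite patchE; case: ifP => // _; rewrite lee_fin sqr_ge0.
  rewrite !patchE; case: ifP => // /set_mem; rewrite /= in_itv/= => /andP[s0 st].
  have sT : 0 <= s < T by rewrite s0 (lt_le_trans st).
  have Gs : G s w by apply: level_set_dec Gt; exact: ltW.
  by rewrite lee_fin /phi (mem_set Gs) mulr1 /psif (step_value_grid T0 D0 _ sT) lerDl sqr_ge0.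
apply: le_trans (lee_wpmul2l _ dphi) _; first by rewrite lee_fin.
by apply: lee_wpmul2r => //; rewrite lee_fin.
Qed.

Let mgap t : 0 <= t <= T -> measurable_fun setT (gap t).
Proof.
move=> /[dup] tT /andP[t0 _]; apply: measurable_funB; last first.
  apply: (@adapted_measurable _ _ _ (F t)); first exact: (filt_sub usual).
  by apply: sub_measurable_adapted; exact: (ito_adapted ito).
apply: measurable_sum => k; apply: measurable_funM => //.
by apply: measurable_funB; apply: (bm_measurable usual bm); rewrite le_min t0 tau0.
Qed.

Let mGi t : 0 <= t <= T -> measurable_fun setT (fun w => (w \in G t)%:R : R).
Proof.
move=> tT; apply: (@adapted_measurable _ _ _ (F t)).
  by apply: (filt_sub usual); case/andP: tT.
by apply: adapted_indic; exact: level_set_adapted.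
Qed.

Let gap_energy t : 0 <= t <= T -> (E (fun w => gap t w ^+ 2 * (w \in G t)%:R)%R <=
   16%:E * \int[mu]_(s in `[0%R, t]) wf s)%E.
Proof.
move=> tT; have /andP[t0 _] := tT.
have := @gap_moment t [:: t] tT; under eq_fun do rewrite gapE//.
by apply=> s; rewrite inE => /eqP ->; rewrite lexx t0.
Qed.

(** A bound that depends on the level. It is only the a priori finiteness required by Gronwall's
    lemma. *)
Let wf_bounded s : 0 <= s < T ->
  (wf s <= (4 * K ^+ 2 * m + 4 * (K * (1 + l)) ^+ 2)%:E)%E.
Proof.
move=> sT; have sT' : 0 <= s <= T by case/andP: sT => -> /ltW.
set k := grid_index Delta s.
have mq : measurable_fun setT (fun w => q k w ^+ 2).
  apply: measurable_funX; apply: measurable_funD => //; apply: measurableT_comp => //.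
  exact: (scheme_measurable usual bm ar theta y0 T0 D0 cb).
have c0 : 0 <= 4 * K ^+ 2 by rewrite mulr_ge0// sqr_ge0.
have d0 : 0 <= 4 * (K * (1 + l)) ^+ 2 by rewrite mulr_ge0// sqr_ge0.
apply: (@le_trans _ _ (E (fun w => 4 * K ^+ 2 * q k w ^+ 2 + 4 * (K * (1 + l)) ^+ 2)%R)).
  apply: Ex_le => // w; rewrite /phi; have [Gs|nG] := boolP (w \in G s); last first.
    by rewrite mulr0; apply: addr_ge0 => //; apply: mulr_ge0 => //; exact: sqr_ge0.
  rewrite mulr1 /psif /psig !(step_value_grid T0 D0 _ sT) -/k.
  have h1 := lin2 (Y k w) (r (tau k) w) (cb_f_lin cb).
  have h2 := lin2 (Y k w) (r (tau k) w) (cb_g_lin cb).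
  have yl : K ^+ 2 * (1 + `|y s w|) ^+ 2 <= (K * (1 + l)) ^+ 2.
    rewrite exprMn ler_wpM2l ?sqr_ge0// lerXn2r ?nnegrE ?addr_ge0// lerD2l.
    by apply: level_set_le => //; exact: set_mem Gs.
  have h3 := le_trans (lin2 (y s w) (r s w) (cb_f_lin cb)) yl.
  have h4 := le_trans (lin2 (y s w) (r s w) (cb_g_lin cb)) yl.
  rewrite -/(q k w) in h1 h2; rewrite -/(fY k w) in h1; rewrite -/(gY k w) in h2.
  have := sqr_ge0 (fY k w + f (y s w) (r s w)); have := sqr_ge0 (gY k w + g (y s w) (r s w)).
  lra.
rewrite Ex_D//; last 2 first.
- by apply: measurable_funM.
- by move=> w; apply: mulr_ge0 => //; exact: sqr_ge0.
rewrite Ex_cst Ex_Z//; last by move=> w; exact: sqr_ge0.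
by rewrite EFinD leeD2r// [X in (_ <= X)%E]EFinM; apply: lee_wpmul2l.
Qed.

(** The three sources of error in turn: switching of the chain, displacement of the scheme inside a
    cell, accumulated remainder. *)
Definition local_error_const : R :=
  24 * K ^+ 2 * sw + 6 * K ^+ 2 * (171 * K ^+ 4 * (8 * m)) +
  18 * K ^+ 2 * remainder_bound K T m.

(** The coefficients at [(Y k, r (tau k))] and [(y s, r s)] are compared through [(Y k, r s)] and
    the continuous approximation at [s]. Only the first comparison changes the regime; it uses
    linear growth and the switching estimate, the others use Lipschitz continuity. The factors are
    [24 = 2 * 3 * 4], [6 = 2 * 3] and [18 = 6 * 3], and [T + 16] adds the drift and the stochastic
    integral. *)
Let wf_gronwall s : 0 <= s < T ->
  (wf s <= (local_error_const * Delta)%:E +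
     (18 * K ^+ 2 * (T + 16))%:E * \int[mu]_(u in `[0%R, s]) wf u)%E.
Proof.
move=> sT; have sT' : 0 <= s <= T by case/andP: sT => -> /ltW.
have sleT : s <= T by case/andP: sT'.
set k := grid_index Delta s.
have [U [mU U0 UY UE]] := scheme_within_envelope usual bm ar T0 D0 D1 theta01 cb moment sT'.
have mq : measurable_fun setT (fun w => q k w ^+ 2).
  apply: measurable_funX; apply: measurable_funD => //; apply: measurableT_comp => //.
  exact: (scheme_measurable usual bm ar theta y0 T0 D0 cb).
pose A w := q k w ^+ 2 * (r s w != r (tau k) w)%:R.
have A0 w : 0 <= A w by rewrite mulr_ge0// sqr_ge0.
have mA : measurable_fun setT A.
  apply: measurable_funM => //.
  have mr u i : 0 <= u -> measurable [set w | r u w = i].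
    by move=> u0; apply: (filt_sub usual u0); exact: ar.
  have -> : (fun w => (r s w != r (tau k) w)%:R : R) =
      (fun w => 1 - \sum_(i < N) (w \in [set w | r s w = i])%:R * (w \in [set w | r (tau k) w = i])%:R).
    apply/funext => w; rewrite (bigD1 (r s w))//= mem_set// mul1r big1 => [|i ir]; last first.
      by rewrite memNset ?mul0r//= => /esym/eqP; exact/negP.
    rewrite addr0; have [e|ne] := eqVneq (r s w) (r (tau k) w).
      by rewrite mem_set/= ?e// subrr.
    by rewrite memNset/= ?subr0// => e; rewrite e eqxx in ne.
  have mi (B : set Om) : measurable B -> measurable_fun setT (fun w => (w \in B)%:R : R).
    move=> mB; apply: (eq_measurable_fun (\1_B : Om -> R)); first by move=> w _; rewrite indicE.
    exact: measurable_indic.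
  apply: measurable_funB => //; apply: measurable_sum => i.
  by apply: measurable_funM; apply: mi; apply: mr => //; case/andP: sT.
have K20 : 0 <= K ^+ 2 by exact: sqr_ge0.
have c24 : 0 <= 24 * K ^+ 2 by rewrite mulr_ge0.
have c6 : 0 <= 6 * K ^+ 2 by rewrite mulr_ge0.
have c18 : 0 <= 18 * K ^+ 2 by rewrite mulr_ge0.
pose B w := gap s w ^+ 2 * (w \in G s)%:R.
have B0 w : 0 <= B w by rewrite mulr_ge0// sqr_ge0.
have mB : measurable_fun setT B.
  by apply: measurable_funM; [apply: measurable_funX; exact: mgap|exact: mGi].
pose Phi w := (\int[mu]_(u in `[0%R, s]) (phi u w)%:E)%E.
have R0 w : (0 <= T%:E * Phi w + V w)%E.
  apply: adde_ge0; last exact: V0.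
  by apply: mule_ge0; [rewrite lee_fin ltW|exact: Phi0].
have lip2 (ph : R -> 'I_N -> R) w : (forall x z i, `|ph x i - ph z i| <= K * `|x - z|) ->
    (forall x i, `|ph x i| <= K * (1 + `|x|)) ->
    (ph (Y k w) (r (tau k) w) - ph (y s w) (r s w)) ^+ 2 <=
    12 * K ^+ 2 * A w + 3 * K ^+ 2 * U w + 3 * K ^+ 2 * Z s w ^+ 2.
  move=> plip plin; pose x := pc_em_cont f g theta eta T y0 (W ^~ w) (r ^~ w) Delta s.
  have sq3 (x1 x2 x3 : R) : (x1 + x2 + x3) ^+ 2 <= 3 * (x1 ^+ 2 + x2 ^+ 2 + x3 ^+ 2).
    by have := sqr_ge0 (x1 - x2); have := sqr_ge0 (x1 - x3); have := sqr_ge0 (x2 - x3); lra.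
  have l2 u v i : (ph u i - ph v i) ^+ 2 <= K ^+ 2 * (u - v) ^+ 2.
    rewrite -(real_normK (num_real (ph u i - _))) -(real_normK (num_real (u - v))) -exprMn.
    by rewrite lerXn2r ?nnegrE// mulr_ge0.
  have -> : ph (Y k w) (r (tau k) w) - ph (y s w) (r s w) =
    (ph (Y k w) (r (tau k) w) - ph (Y k w) (r s w)) +
    (ph (Y k w) (r s w) - ph x (r s w)) + (ph x (r s w) - ph (y s w) (r s w)) by ring.
  apply: le_trans (sq3 _ _ _) _.
  have h1 : (ph (Y k w) (r (tau k) w) - ph (Y k w) (r s w)) ^+ 2 <= 4 * K ^+ 2 * A w.
    rewrite /A; have [->|ne] := eqVneq (r s w) (r (tau k) w); first by rewrite subrr expr0n/= !mulr0.
    rewrite mulr1; have a1 := lin2 (Y k w) (r (tau k) w) plin.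
    have a2 := lin2 (Y k w) (r s w) plin; rewrite -/(q k w) in a1 a2.
    by have := sqr_ge0 (ph (Y k w) (r (tau k) w) + ph (Y k w) (r s w)); lra.
  have h2 := l2 (Y k w) x (r s w); have h3 := l2 x (y s w) (r s w).
  have h4 : K ^+ 2 * (Y k w - x) ^+ 2 <= K ^+ 2 * U w.
    by rewrite ler_wpM2l// -sqrrN opprB; exact: UY.
  rewrite -/(Z s w) in h3; lra.
have le w : ((phi s w)%:E <= (24 * K ^+ 2 * A w + 6 * K ^+ 2 * U w + 18 * K ^+ 2 * B w)%:E +
    (18 * K ^+ 2)%:E * (T%:E * Phi w + V w))%E.
  have rhs0 : (0 <= (18 * K ^+ 2)%:E * (T%:E * Phi w + V w))%E.
    by apply: mule_ge0; [rewrite lee_fin|exact: R0].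
  have [Gs|nG] := boolP (w \in G s); last first.
    rewrite /phi (negbTE nG) mulr0; apply: adde_ge0 => //; rewrite lee_fin.
    by apply: addr_ge0; [apply: addr_ge0|]; apply: mulr_ge0.
  have p1 : phi s w <= 24 * K ^+ 2 * A w + 6 * K ^+ 2 * U w + 6 * K ^+ 2 * Z s w ^+ 2.
    rewrite /phi Gs mulr1 /psif /psig !(step_value_grid T0 D0 _ sT) -/k.
    have h1 := lip2 f w (cb_f_lip cb) (cb_f_lin cb).
    have h2 := lip2 g w (cb_g_lip cb) (cb_g_lin cb).
    rewrite -/(fY k w) in h1; rewrite -/(gY k w) in h2; lra.
  have := Z_sqr_le sT' (set_mem Gs); rewrite -/(Phi w) => zl.
  apply: (@le_trans _ _ ((24 * K ^+ 2 * A w + 6 * K ^+ 2 * U w)%:E +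
      (6 * K ^+ 2)%:E * (Z s w ^+ 2)%:E)%E); first by rewrite -EFinM -EFinD lee_fin.
  rewrite [X in (_ <= X + _)%E]EFinD -addeA leeD2l//.
  apply: le_trans (lee_wpmul2l _ zl) _; first by rewrite lee_fin.
  rewrite muleA -EFinM (_ : 6 * K ^+ 2 * 3 = 18 * K ^+ 2); last by ring.
  rewrite addeAC ge0_muleDr; [|exact: R0|by rewrite lee_fin sqr_ge0].
  by rewrite [leLHS]addeC /B Gs mulr1 [X in (_ <= X + _)%E]EFinM.
have mPhi' := mPhi sleT.
have mR : measurable_fun setT (fun w => T%:E * Phi w + V w)%E.
  by apply: emeasurable_funD => //; apply: emeasurable_funM => //; exact: measurable_cst.
have m1 : measurable_fun setT (fun w => 24 * K ^+ 2 * A w) by apply: measurable_funM.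
have m2 : measurable_fun setT (fun w => 6 * K ^+ 2 * U w) by apply: measurable_funM.
have m3 : measurable_fun setT (fun w => 18 * K ^+ 2 * B w) by apply: measurable_funM.
have m12 : measurable_fun setT (fun w => 24 * K ^+ 2 * A w + 6 * K ^+ 2 * U w).
  by apply: measurable_funD.
have m123 : measurable_fun setT (fun w => 24 * K ^+ 2 * A w + 6 * K ^+ 2 * U w + 18 * K ^+ 2 * B w).
  by apply: measurable_funD.
have n1 w : 0 <= 24 * K ^+ 2 * A w by apply: mulr_ge0.
have n2 w : 0 <= 6 * K ^+ 2 * U w by apply: mulr_ge0.
have n3 w : 0 <= 18 * K ^+ 2 * B w by apply: mulr_ge0.
have n12 w : 0 <= 24 * K ^+ 2 * A w + 6 * K ^+ 2 * U w by apply: addr_ge0.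
have n123 w : 0 <= 24 * K ^+ 2 * A w + 6 * K ^+ 2 * U w + 18 * K ^+ 2 * B w by apply: addr_ge0.
apply: le_trans (ge0_le_integralT P _ le) _ => //.
rewrite ge0_integralD; [|by []|by move=> w _; rewrite lee_fin|exact/measurable_EFinP|
  by move=> w _; apply: mule_ge0; [rewrite lee_fin|exact: R0]|
  by apply: emeasurable_funM => //; exact: measurable_cst].
rewrite ge0_integralZl; [|by []|exact: mR|by move=> w _; exact: R0|by rewrite lee_fin].
rewrite ge0_integralD; [|by []|by move=> w _; apply: mule_ge0; [rewrite lee_fin ltW|exact: Phi0]|
  by apply: emeasurable_funM => //; exact: measurable_cst|by move=> w _; exact: V0|exact: mV].
rewrite ge0_integralZl; [|by []|exact: mPhi'|by move=> w _; exact: Phi0|by rewrite lee_fin ltW].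
rewrite /Phi tonelli//; set J := (\int[mu]_(u in `[0%R, s]) wf u)%E.
have J0 : (0 <= J)%E by apply: integral_ge0 => u _; apply: integral_ge0 => w _.
have e1 : (E (fun w => 24 * K ^+ 2 * A w + 6 * K ^+ 2 * U w + 18 * K ^+ 2 * B w)%R <=
   (24 * K ^+ 2 * (sw * Delta) + 6 * K ^+ 2 * (171 * K ^+ 4 * (8 * m) * Delta))%:E +
   (18 * K ^+ 2)%:E * (16%:E * J))%E.
  rewrite (Ex_D _ m12 n12 m3 n3) (Ex_D _ m1 n1 m2 n2) !Ex_Z// EFinD; apply: leeD.
    apply: leeD; rewrite [X in (_ <= X)%E]EFinM; apply: lee_wpmul2l; rewrite ?lee_fin//.
    exact: switch.
  by apply: lee_wpmul2l; rewrite ?lee_fin//; exact: gap_energy.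
have e2 : ((18 * K ^+ 2)%:E * (T%:E * J + \int[P]_w V w) <=
    (18 * K ^+ 2)%:E * (T%:E * J + (remainder_bound K T m * Delta)%:E))%E.
  by apply: lee_wpmul2l; rewrite ?lee_fin// leeD2l.
apply: le_trans (leeD e1 e2) _.
have TJ0 : (0 <= T%:E * J)%E by apply: mule_ge0 => //; rewrite lee_fin ltW.
have sw0 : 0 <= remainder_bound K T m * Delta.
  by rewrite -lee_fin; apply: le_trans VE; apply: integral_ge0.
have eJ : ((18 * K ^+ 2 * (T + 16))%:E * J =
    (18 * K ^+ 2)%:E * (16%:E * J) + (18 * K ^+ 2)%:E * (T%:E * J))%E.
  rewrite !muleA -!EFinM -ge0_muleDl; last 2 first.
  - by rewrite lee_fin mulr_ge0.
  - by rewrite lee_fin mulr_ge0// ltW.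
  by rewrite -EFinD; congr (_%:E * _)%E; rewrite addrC mulrDr.
have eD : ((18 * K ^+ 2)%:E * (T%:E * J + (remainder_bound K T m * Delta)%:E) =
    (18 * K ^+ 2)%:E * (T%:E * J) + (18 * K ^+ 2)%:E * (remainder_bound K T m * Delta)%:E)%E.
  by apply: ge0_muleDr.
rewrite eD eJ [X in (_ + X <= _)%E]addeC addeACA leeD2r//.
rewrite -EFinM -EFinD lee_fin /local_error_const le_eqVlt; apply/orP; left; apply/eqP; ring.
Qed.

Definition error_const (c : R) : R :=
  3 * ((T + 16) * (T * (c * local_error_const)) + remainder_bound K T m).

(** The Gronwall constant [c] is a parameter characterized by its property, so that one and the same
    [c] serves every level and every step size. The drift part of the error grows with [t] and is
    bounded by its value at [T]; the gap needs an envelope. *)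
Lemma localized_error (c : R) : 0 <= c ->
  (forall (a M : R) (w : R -> \bar R), 0 <= a -> measurable_fun `[0, T] w ->
    (forall s, 0 <= s <= T -> (0 <= w s)%E) -> (forall s, 0 <= s < T -> (w s <= M%:E)%E) ->
    (forall s, 0 <= s < T ->
      (w s <= a%:E + (18 * K ^+ 2 * (T + 16))%:E * \int[mu]_(u in `[0%R, s]) w u)%E) ->
    forall s, 0 <= s < T -> (w s <= (c * a)%:E)%E) ->
  exists B : Om -> \bar R, [/\ measurable_fun setT B, forall w, (0 <= B w)%E,
    forall w, level_set l T w -> forall t, 0 <= t <= T -> ((Z t w ^+ 2)%:E <= B w)%E &
    (\int[P]_w B w <= (error_const c * Delta)%:E)%E].
Proof.
move=> c0 gronwall; pose lc := local_error_const * Delta.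
have TT : 0 <= T <= T by rewrite lexx ltW.
have m0 : 0 <= m.
  by rewrite -lee_fin; apply: le_trans (moment 0); apply: Ex_ge0 => w; exact: sqr_ge0.
have sw0 : 0 <= sw * Delta.
  rewrite -lee_fin; apply: le_trans (switch (s := 0) _); last by rewrite lexx.
  by apply: Ex_ge0 => w; rewrite mulr_ge0// sqr_ge0.
have rb0 : 0 <= remainder_bound K T m * Delta.
  by rewrite -lee_fin; apply: le_trans VE; apply: integral_ge0.
have lc0 : 0 <= lc.
  rewrite /lc /local_error_const; have -> : forall a b s e r D : R,
    (a * s + b * e + r) * D = a * (s * D) + b * e * D + r * D by move=> *; ring.
  apply: addr_ge0; [apply: addr_ge0|rewrite -mulrA].
  - by apply: mulr_ge0 => //; apply: mulr_ge0 => //; exact: sqr_ge0.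
  - apply: mulr_ge0; last exact: ltW.
    apply: mulr_ge0; first by apply: mulr_ge0 => //; exact: sqr_ge0.
    apply: mulr_ge0; first by apply: mulr_ge0; [rewrite ler0n|exact: exprn_ge0].
    by apply: mulr_ge0.
  - by apply: mulr_ge0 => //; apply: mulr_ge0 => //; exact: sqr_ge0.
have wf0 s : (0 <= wf s)%E by apply: integral_ge0 => w _.
have wfle s : 0 <= s < T -> (wf s <= (c * lc)%:E)%E.
  exact: (gronwall lc _ wf lc0 mwf (fun s _ => wf0 s) wf_bounded wf_gronwall s).
set J := (\int[mu]_(s in `[0%R, T]) wf s)%E.
have JT : (J <= (T * (c * lc))%:E)%E.
  have mwf' : measurable_fun `[0, T[ wf.
    by apply: measurable_funS mwf => // s; rewrite /= !in_itv/= => /andP[-> /ltW].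
  rewrite /J -integral_itv_bndo_bndc//.
  apply: (@le_trans _ _ (\int[mu]_(s in `[0%R, T[) (c * lc)%:E)%E).
    apply: ge0_le_integral => // s; rewrite /= in_itv/=; exact: wfle.
  rewrite integral_cst// [X in (_ * X <= _)%E](_ : _ = T%:E); first by rewrite -EFinM mulrC.
  by rewrite [LHS]lebesgue_measure_itv/= lte_fin T0 oppr0 adde0.
have J0 : (0 <= J)%E by exact: integral_ge0.
pose x p w := rmax (fun i => gap (qt i) w) p ^+ 2 * (w \in G T)%:R.
have mx p : measurable_fun setT (x p).
  apply: measurable_funM; last exact: mGi.
  by apply: measurable_funX; apply: measurable_rmax => i _; exact: mgap.
have x0 p w : 0 <= x p w by rewrite mulr_ge0// sqr_ge0.
have xS p w : x p w <= x p.+1 w.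
  by rewrite ler_wpM2r// lerXn2r ?nnegrE ?rmax_ge0//= le_max lexx.
have xJ p : (E (x p) <= 16%:E * J)%E.
  pose S := [seq qt i | i <- iota 0 p.+1].
  have ST s : s \in S -> 0 <= s <= T by move=> /mapP[i _ ->].
  apply: le_trans (gap_moment TT ST); apply: Ex_le => // w.
  have gm0 (S' : seq R) : 0 <= gap_max S' T w.
    by rewrite /gap_max; elim: S' => [|s S' ih]; rewrite ?big_nil// big_cons le_max normr_ge0.
  rewrite ler_wpM2r// lerXn2r ?nnegrE ?rmax_ge0//.
  apply: rmax_le => i ip; have : qt i \in S by apply/mapP; exists i; rewrite ?mem_iota.
  rewrite /gap_max; elim: S {ST} => // s S ih.
  rewrite inE big_cons le_max => /orP[/eqP <-|/ih ->]; last by rewrite orbT.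
  by have /andP[q0 qT] := qt_itv i; rewrite (min_idPl qT) (max_idPr q0) lexx.
(* Finite maxima over the dense times satisfy a common bound; continuity of the gap then extends the
   envelope to all of [[0, T]]. *)
have [VM [mVM VM0 xV VME]] := monotone_envelope mx x0 xS xJ.
have mPT := mPhi (lexx T).
pose B0 w := (T%:E * \int[mu]_(s in `[0%R, T]) (phi s w)%:E + VM w + V w)%E.
have T0e : (0 <= T%:E)%E by rewrite lee_fin ltW.
have p1 w : (0 <= T%:E * \int[mu]_(s in `[0%R, T]) (phi s w)%:E)%E by apply: mule_ge0.
have p2 w : (0 <= T%:E * \int[mu]_(s in `[0%R, T]) (phi s w)%:E + VM w)%E by apply: adde_ge0.
have q1 : measurable_fun setT (fun w => T%:E * \int[mu]_(s in `[0%R, T]) (phi s w)%:E)%E.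
  by apply: emeasurable_funM => //; exact: measurable_cst.
have q2 : measurable_fun setT (fun w => T%:E * \int[mu]_(s in `[0%R, T]) (phi s w)%:E + VM w)%E.
  by apply: emeasurable_funD.
have mB0 : measurable_fun setT B0 by apply: emeasurable_funD.
have B00 w : (0 <= B0 w)%E by apply: adde_ge0.
exists (fun w => 3%:E * B0 w)%E; split.
- by apply: emeasurable_funM => //; exact: measurable_cst.
- by move=> w; apply: mule_ge0.
- move=> w GT t tT; have [nb _] := GT; have /andP[t0 tleT] := tT.
  have Gt : G t w by apply: level_set_dec GT.
  apply: le_trans (Z_sqr_le tT Gt) _; apply: lee_wpmul2l => //.
  rewrite /B0 leeD2r// leeD//.
    apply: lee_wpmul2l => //; rewrite integral_mkcond [X in (_ <= X)%E]integral_mkcond.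
    apply: ge0_le_integralT => s; first by rewrite patchE; case: ifP.
    rewrite !patchE; case: ifP => [/set_mem|_]; last by case: ifP.
    rewrite /= in_itv/= => /andP[s0 st]; rewrite mem_set//= in_itv/= s0.
    exact: le_trans tleT.
  have cgap p : {within `[0, T], continuous (fun t =>
      step_integral p tau (gY ^~ w) (W ^~ w) t)}.
    elim: p => [|p ih].
      have -> : (fun t => step_integral 0 tau (gY ^~ w) (W ^~ w) t) = fun=> 0.
        by apply/funext => u; rewrite /step_integral big_ord0.
      by move=> u; exact: cvg_cst.
    have -> : (fun t => step_integral p.+1 tau (gY ^~ w) (W ^~ w) t) = (fun t => step_integral p tau (gY ^~ w) (W ^~ w) t +
      gY p w * (W (Num.min t (tau p.+1)) w - W (Num.min t (tau p)) w)).
      by apply/funext => u; rewrite /step_integral big_ord_recr.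
    move=> u; apply: cvgD; first exact: ih.
    apply: cvgM; first exact: cvg_cst.
    apply: cvgB; first exact: (within_comp_minr (tau0 p.+1) (W_cont nb)).
    exact: (within_comp_minr (tau0 p) (W_cont nb)).
  apply: (@continuous_dense_le _ 0 T qt (fun s => gap s w ^+ 2)) => //.
  + move=> s sT e e0; have [i [h1 h2]] := qt_dense sT e0.
    by exists i; rewrite ger0_norm ?subr_ge0.
  + move=> u; apply: (cvg_comp _ (fun z => z ^+ 2)); last exact: exprn_continuous.
    by apply: cvgB; [exact: cgap|exact: (I_cont nb)].
  + move=> i; apply: le_trans (xV i w); rewrite lee_fin /x (mem_set GT) mulr1.
    rewrite -(real_normK (num_real (gap (qt i) w))) lerXn2r ?nnegrE ?rmax_ge0//.
    exact: (le_rmax (fun i => gap (qt i) w)).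
rewrite ge0_integralZl; [|by []|exact: mB0|by move=> w _; exact: B00|by rewrite lee_fin].
rewrite ge0_integralD; [|by []|by move=> w _; exact: p2|exact: q2|by move=> w _; exact: V0|exact: mV].
rewrite ge0_integralD; [|by []|by move=> w _; exact: p1|exact: q1|by move=> w _; exact: VM0|exact: mVM].
rewrite ge0_integralZl; [|by []|exact: mPT|by move=> w _; exact: Phi0|exact: T0e].
rewrite tonelli// -/J.
have e1 := lee_wpmul2l T0e JT.
have s16 : (0 <= 16%:E :> \bar R)%E by rewrite lee_fin.
have e2 := le_trans VME (lee_wpmul2l s16 JT).
apply: (@le_trans _ _ (3 * (T * (T * (c * lc)) + 16 * (T * (c * lc)) +
  remainder_bound K T m * Delta))%:E); last first.
  by rewrite lee_fin /error_const /lc le_eqVlt; apply/orP; left; apply/eqP; ring.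
rewrite EFinM; apply: lee_wpmul2l => //; rewrite EFinD; apply: leeD => //.
by rewrite EFinD; apply: leeD.
Qed.

End localized.

(** * The strong error *)

Section strong_error.
Context d (Om : measurableType d) (R : realType) (P : probability Om R) (N : nat).
Variables (F : R -> set (set Om)) (Q : 'M[R]_N) (W : R -> Om -> R) (r : R -> Om -> 'I_N).
Hypotheses (usual : usual_filtration P F) (bm : brownian_motion P F W)
  (mc : markov_chain P F Q r)
  (WR : independent_processes P (measurable : set (set R)) setT W r).
Local Notation mu := (@lebesgue_measure R).
Variables (f g : R -> 'I_N -> R) (theta eta K T y0 : R) (y : R -> Om -> R).
Hypotheses (T0 : 0 < T) (theta01 : 0 <= theta <= 1) (cb : coefficient_bounds f g eta K)
  (sol : strong_solution P F W r T f g y0 y).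

(** All almost sure properties are gathered outside one negligible set. The usual conditions place
    this set in [F 0], so removing it does not spoil adaptedness of the level sets. *)
Lemma exceptional_set : exists (I : R -> Om -> R) (bad : set Om),
  [/\ is_ito_integral P F W T (fun t w => g (y t w) (r t w)) I,
      measurable bad, P bad = 0%E, F 0 bad &
      forall w, ~ bad w -> [/\ {within `[0, +oo[, continuous (W ^~ w)},
        {within `[0, T], continuous (y ^~ w)}, {within `[0, T], continuous (I ^~ w)},
        mu.-integrable `[0, T]%classic (EFin \o (fun s => f (y s w) (r s w))) &
        forall t : R, 0 <= t <= T ->
          y t w = y0 + \int[mu]_(s in `[0, t]) f (y s w) (r s w) + I t w]].
Proof.
have [I [ito eqn]] := sol_equation sol; exists I.
have := filterI (bm_continuous bm) (filterI (sol_continuous sol) (filterI (ito_continuous ito)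
  (filterI (cl_integrable (sol_drift sol)) eqn))).
move=> [bad [mbad Pbad sub]]; exists bad; split => //.
  by apply: (filt_null usual); exists bad; split.
move=> w nb; have [h1 [h2 [h3 [h4 h5]]]] := contrapT (fun h => nb (sub w h)).
split => //; apply/integrableP; split.
  apply: (@measurable_section _ _ _ `[0, T]%classic (fun s w => (f (y s w) (r s w))%:E)) => //.
  by apply/measurable_EFinP; exact: (cl_measurable (sol_drift sol)).
by move: h4; under eq_integral do rewrite expr1.
Qed.

Lemma dense_from_below : exists qt : nat -> R, (forall i, 0 <= qt i <= T) /\
  (forall s, 0 <= s <= T -> forall e : R, 0 < e -> exists i, qt i <= s /\ s - qt i < e).
Proof.
have [q [qT qd]] := dense_times (ltW T0).
exists (fun i => if i is j.+1 then q j else 0); split; first by case=> [|i] //; rewrite lexx ltW.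
move=> s /andP[]; rewrite le_eqVlt => /orP[/eqP <- _ e e0|s0 sT e e0].
  by exists 0%N; rewrite lexx subrr.
(* A dense time within [h] of [s - h] lies strictly below [s] and within [2 * h <= e] of it. The
   time 0, added as the first term, takes care of [s = 0]. *)
pose h := Num.min s e / 2; have h0 : 0 < h by rewrite divr_gt0// lt_min s0.
have hs : h + h <= s by rewrite -splitr ge_min lexx.
have he : h + h <= e by rewrite -splitr ge_min lexx orbT.
have sh : 0 <= s - h <= T by apply/andP; split; lra.
have [i] := qd _ sh _ h0; rewrite ltr_norml => /andP[i1 i2].
by exists i.+1; split; lra.
Qed.

Lemma level_set_exhausts (bad : set Om) (qt : nat -> R) w :
  (forall i, 0 <= qt i <= T) -> ~ bad w -> {within `[0, T], continuous (y ^~ w)} ->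
  exists n0 : nat, forall n, (n0 <= n)%N -> level_set y bad qt n%:R T w.
Proof.
move=> qT nb cy.
have [a _ ya] := EVT_max (ltW T0) cy; have [b _ yb] := EVT_min (ltW T0) cy.
exists (Num.truncn (`|y a w| + `|y b w|)).+1 => n n0n; split => // i _.
have ni : `|y a w| + `|y b w| <= n%:R.
  by apply: le_trans (ltW (truncnS_gt _)) _; rewrite ler_nat.
have qi : qt i \in `[0, T] by rewrite in_itv/= qT.
have h1 := ya _ qi; have h2 := yb _ qi; rewrite ler_norml.
have h3 := ler_norm (y a w); have h4 := ler_norm (- y b w); rewrite normrN in h4.
have h5 := normr_ge0 (y a w); have h6 := normr_ge0 (y b w).
by apply/andP; split; lra.
Qed.

(** Each level yields an envelope whose mean is at most the same multiple of [Delta]. A path outside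
    the exceptional set belongs to all sufficiently high level sets, so the lower limit of the
    envelopes dominates its squared supremum, and Fatou's lemma bounds the mean of that limit. *)
Theorem strong_error_le : exists C u0 : R, [/\ 0 < C, 0 < u0 &
  forall Delta, 0 < Delta -> Delta <= 1 -> Delta < u0 ->
    (\int[P]_w ereal_sup
       [set (`|pc_em_cont f g theta eta T y0 (W^~ w) (r^~ w) Delta t
               - y t w| ^+ 2)%R%:E | t in `[0%R, T]] <= (C * Delta)%:E)%E].
Proof.
have ar t i : 0 <= t -> F t [set w | r t w = i] by exact: (mc_adapted mc).
have [I [bad [ito mbad Pbad Fbad good]]] := exceptional_set.
have [qt [qT qd]] := dense_from_below.
have [c [u0 [c0 u00 stay]]] := transition_stay_ge usual mc.
pose m := moment_bound K T y0.
have K0 : 0 <= 18 * K ^+ 2 * (T + 16).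
  by apply: mulr_ge0; [rewrite mulr_ge0// sqr_ge0|rewrite addr_ge0// ltW].
have [cg cg0 gron] := gronwall_bounded T0 K0.
pose C := error_const K T m (c * m) cg.
have C0 : 0 < `|C| + 1 by rewrite ltr_wpDl.
exists (`|C| + 1), u0; split => //.
move=> Delta D0 D1 Du.
have moment := scheme_moment usual bm ar y0 T0 D0 D1 theta01 cb.
have [V [mV V0 VR VE]] := scheme_rem_envelope usual bm ar T0 D0 D1 theta01 cb moment.
have switch s : 0 <= s < T -> (Ex P (fun w =>
    (1 + `|pc_em f g theta eta T y0 (W ^~ w) (r ^~ w) Delta (grid_index Delta s)|) ^+ 2 *
    (r s w != r (grid T Delta (grid_index Delta s)) w)%:R)%R <= (c * m * Delta)%:E)%E.
  move=> sT; rewrite mulrAC.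
  exact: (switching_moment usual bm mc WR T0 D0 cb stay c0 Du sT (moment _)).
have Wc w (nb : ~ bad w) : {within `[0, +oo[, continuous (W ^~ w)} by have [] := good w nb.
have yc w (nb : ~ bad w) : {within `[0, T], continuous (y ^~ w)} by have [] := good w nb.
have Ic w (nb : ~ bad w) : {within `[0, T], continuous (I ^~ w)} by have [] := good w nb.
have fi w (nb : ~ bad w) : mu.-integrable `[0, T]%classic (EFin \o (fun s => f (y s w) (r s w))).
  by have [] := good w nb.
have ye w (nb : ~ bad w) t : 0 <= t <= T ->
    y t w = y0 + \int[mu]_(s in `[0, t]) f (y s w) (r s w) + I t w.
  by have [_ _ _ _] := good w nb; apply.
have /choice[B HB] (l : nat) := localized_error usual bm ar T0 theta01 cb (sol_adapted sol)
  (sol_drift sol) ito Fbad Wc yc Ic fi ye qT qd D0 D1 moment switch (ler0n R l) mV V0 VR VE cg0 gron.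
have mB l : measurable_fun setT (B l) by have [] := HB l.
have B0 l w : (0 <= B l w)%E by have [] := HB l.
(* The envelopes of different levels are chosen independently and need not be monotone, hence a
   lower limit. *)
pose L w := limn_einf (B ^~ w).
have L0 w : (0 <= L w)%E.
  rewrite /L limn_einf_lim; apply: lime_ge; first exact: is_cvg_einfs.
  by apply: nearW => l; apply: le_ereal_inf_tmp => _ [k _ <-].
have mL : measurable_fun setT L.
  rewrite (_ : L = fun w => limn (einfs (B ^~ w))); last by apply/funext => w; rewrite /L limn_einf_lim.
  apply: (emeasurable_fun_cvg (fun n w => einfs (B ^~ w) n)) => [n|w _].
    exact: measurable_fun_einfs.
  exact: is_cvg_einfs.
have mbadi : measurable_fun setT (fun w => +oo * (\1_bad w)%:E : \bar R)%E.
  by apply: emeasurable_funM => //; apply/measurable_EFinP; exact: measurable_indic.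
have badi0 w : (0 <= +oo * (\1_bad w)%:E)%E by apply: mule_ge0; rewrite ?leey ?lee_fin.
(* On the exceptional set nothing is known about the paths; the infinite term covers it there and
   integrates to 0. *)
apply: (@le_trans _ _ (\int[P]_w (L w + +oo * (\1_bad w)%:E))%E).
  apply: ge0_le_integralT => w.
    apply: le_trans (_ : 0%:E <= (`|pc_em_cont f g theta eta T y0 (W^~ w) (r^~ w) Delta 0
               - y 0 w| ^+ 2)%R%:E)%E _; first by rewrite lee_fin sqr_ge0.
    by apply: ereal_sup_ubound; exists 0 => //; rewrite /= in_itv/= lexx ltW.
  have [bw|nb] := pselect (bad w).
    by rewrite indicE mem_set// mule1 addey ?leey// gt_eqF// (lt_le_trans _ (L0 w))// ltNy0.
  rewrite indicE memNset// mule0 adde0; apply: ge_ereal_sup => _ [t tT <-].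
  have tT' : 0 <= t <= T by move: tT; rewrite /= in_itv.
  have [n0 Hn0] := level_set_exhausts qT nb (yc w nb).
  rewrite /L limn_einf_lim; apply: lime_ge; first exact: is_cvg_einfs.
  exists n0 => // n /= n0n; apply: le_ereal_inf_tmp => _ [k /= nk <-].
  have [_ _ HBk _] := HB k; rewrite real_normK ?num_real//; apply: HBk => //.
  by apply: Hn0; exact: leq_trans nk.
rewrite ge0_integralD; [|by []|by move=> w _; exact: L0|exact: mL|by move=> w _; exact: badi0|
  exact: mbadi].
rewrite [X in (_ + X <= _)%E](_ : _ = 0%E); last first.
  rewrite ge0_integralZl; [|by []|by apply/measurable_EFinP; exact: measurable_indic|
    by move=> w _; rewrite lee_fin|by rewrite leey].
  by rewrite integral_indic// setIT [X in (_ * X)%E]Pbad mule0.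
rewrite adde0; apply: le_trans (fatou P measurableT mB (fun l w _ => B0 l w)) _.
rewrite limn_einf_lim; apply: lime_le; first exact: is_cvg_einfs.
apply: nearW => l; apply: le_trans (_ : _ <= \int[P]_w B l w)%E _.
  by apply: ereal_inf_lbound; exists l => /=.
have [_ _ _ h] := HB l; apply: (le_trans h); rewrite lee_fin.
apply: ler_wpM2r; first exact: ltW.
by apply: le_trans (ler_norm _) _; rewrite lerDl.
Qed.

End strong_error.

Lemma le_sqrt_mul (R : realType) (a b L : R) : 0 <= b -> `|a| ^+ 2 <= L * b ^+ 2 ->
  `|a| <= Num.sqrt L * b.
Proof.
move=> b0 h; have [L0|L0] := leP 0 L.
  rewrite -[leLHS]ger0_norm// -sqrtr_sqr -[b in leRHS]ger0_norm// -[`|b|]sqrtr_sqr.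
  by rewrite -sqrtrM// ler_wsqrtr.
have : `|a| ^+ 2 <= 0 by apply: (le_trans h); rewrite nmulr_rle0 ?sqr_ge0.
by rewrite exprn_even_le0//= normr_eq0 => /eqP ->; rewrite normr0 mulr_ge0 ?sqrtr_ge0.
Qed.

Unset Implicit Arguments.

Theorem theorem3p1 (R : realType) (d : measure_display) (Om : measurableType d)
  (P : probability Om R) (F : R -> set (set Om)) (T : R)
  (N : nat) (Q : 'M[R]_N) (W : R -> Om -> R) (r : R -> Om -> 'I_N)
  (f g : R -> 'I_N -> R) (y0 : R) (i0 : 'I_N) (theta eta : R)
  (L1 L2 L3 L4 : R) (y : R -> Om -> R) :
  0 < T ->
  usual_filtration P F ->
  brownian_motion P F W ->
  markov_chain P F Q r ->
  {ae P, forall w, r 0 w = i0} ->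
  independent_processes P (measurable : set (set R)) setT W r ->
  (forall i, measurable_fun setT (f^~ i)) ->
  (forall i, measurable_fun setT (g^~ i)) ->
  (forall x i, derivable (g^~ i) x 1) ->
  0 <= theta <= 1 ->
  0 <= eta <= 1 ->
  0 < L1 -> 0 < L2 -> 0 < L3 -> 0 < L4 ->
  (forall x z i,
     `|f x i - f z i| ^+ 2 + `|g x i - g z i| ^+ 2 <= L1 * `|x - z| ^+ 2) ->
  (forall x i,
     Num.max (`|f x i| ^+ 2) (`|g x i| ^+ 2) <= L2 * (1 + `|x| ^+ 2)) ->
  (forall x z i,
     `|corrected_drift f g eta x i - corrected_drift f g eta z i| ^+ 2
       <= L3 * `|x - z| ^+ 2) ->
  (forall x i, `|corrected_drift f g eta x i| ^+ 2 <= L4 * (1 + `|x| ^+ 2)) ->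
  strong_solution P F W r T f g y0 y ->
  exists C : R, 0 < C /\
  exists rho : R -> R, (rho u / u @[u --> 0^'+] --> 0) /\
  \forall Delta \near 0^'+,
    (\int[P]_w ereal_sup
       [set (`|pc_em_cont f g theta eta T y0 (W^~ w) (r^~ w) Delta t
               - y t w| ^+ 2)%R%:E | t in `[0%R, T]]
     <= (C * Delta + rho Delta)%R%:E)%E.
Proof.
move=> T0 usual bm mc _ WR _ _ dg theta01 eta01 _ _ _ _ GL LG GL' LG' sol.
pose a1 := Num.sqrt L1; pose a2 := Num.sqrt L2.
pose a3 := Num.sqrt L3; pose a4 := Num.sqrt L4.
have [p1 p2 p3 p4] : [/\ 0 <= a1, 0 <= a2, 0 <= a3 & 0 <= a4] by split; exact: sqrtr_ge0.
have widen (b c x : R) : 0 <= x -> b <= c -> b * x <= c * x by move=> *; rewrite ler_wpM2r.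
have f_lip x z i : `|f x i - f z i| <= a1 * `|x - z|.
  by apply: le_sqrt_mul => //; apply: le_trans (GL x z i); rewrite lerDl sqr_ge0.
have g_lip x z i : `|g x i - g z i| <= a1 * `|x - z|.
  by apply: le_sqrt_mul => //; apply: le_trans (GL x z i); rewrite lerDr sqr_ge0.
have b_lip x z i : `|corrected_drift f g eta x i - corrected_drift f g eta z i| <= a3 * `|x - z|.
  by apply: le_sqrt_mul.
have lin (L x : R) : 0 <= L -> L * (1 + `|x| ^+ 2) <= L * (1 + `|x|) ^+ 2.
  by move=> L0; rewrite ler_wpM2l//; have := normr_ge0 x; rewrite sqrrD; lra.
have q0 (x : R) : 0 <= 1 + `|x| by rewrite addr_ge0.
have L20 : 0 <= L2.
  have := le_trans _ (LG 0 i0); rewrite normr0 expr0n addr0 mulr1; apply.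
  by rewrite le_max sqr_ge0.
have L40 : 0 <= L4.
  by have := LG' 0 i0; rewrite normr0 expr0n addr0 mulr1; apply: le_trans; exact: sqr_ge0.
have f_lin x i : `|f x i| <= a2 * (1 + `|x|).
  apply: (@le_sqrt_mul _ _ _ L2 (q0 x)).
  apply: le_trans _ (lin L2 x L20); apply: le_trans _ (LG x i).
  by rewrite le_max lexx.
have g_lin x i : `|g x i| <= a2 * (1 + `|x|).
  apply: (@le_sqrt_mul _ _ _ L2 (q0 x)).
  apply: le_trans _ (lin L2 x L20); apply: le_trans _ (LG x i).
  by rewrite le_max lexx orbT.
have b_lin x i : `|corrected_drift f g eta x i| <= a4 * (1 + `|x|).
  by apply: (@le_sqrt_mul _ _ _ L4 (q0 x)); apply: le_trans (LG' x i) (lin L4 x L40).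
(* One constant for all conditions. For [f - corrected_drift] the bounds [a1 + a3] and [a2 + a4] are
   needed, and the 1 ensures [1 <= K]. *)
pose K := 1 + a1 + a2 + a3 + a4.
have cb : coefficient_bounds f g eta K.
  split => //; first by rewrite /K; lra.
  - by move=> x z i; apply: le_trans (f_lip x z i) (widen _ _ _ _ _) => //; rewrite /K; lra.
  - by move=> x z i; apply: le_trans (g_lip x z i) (widen _ _ _ _ _) => //; rewrite /K; lra.
  - move=> x z i.
    have -> : f x i - corrected_drift f g eta x i - (f z i - corrected_drift f g eta z i) =
      f x i - f z i - (corrected_drift f g eta x i - corrected_drift f g eta z i) by ring.
    apply: le_trans (ler_normB _ _) _; apply: le_trans (lerD (f_lip x z i) (b_lip x z i)) _.
    by rewrite -mulrDl; apply: widen => //; rewrite /K; lra.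
  - by move=> x i; apply: le_trans (f_lin x i) (widen _ _ _ _ _) => //; rewrite /K; lra.
  - by move=> x i; apply: le_trans (g_lin x i) (widen _ _ _ _ _) => //; rewrite /K; lra.
  - move=> x i; apply: le_trans (ler_normB _ _) _.
    apply: le_trans (lerD (f_lin x i) (b_lin x i)) _.
    by rewrite -mulrDl; apply: widen => //; rewrite /K; lra.
have [C [u0 [C0 u00 HC]]] := strong_error_le usual bm mc WR T0 theta01 cb sol.
(* The estimate is exactly linear for small [Delta], so the remainder of order [o(Delta)] is the
   zero function. *)
exists C; split => //; exists (fun=> 0); split.
  by under eq_fun do rewrite mul0r; exact: cvg_cst.
near=> Delta; rewrite addr0; apply: HC; near: Delta.
- exact: nbhs_right_gt.
- exact: nbhs_right_le.
- exact: nbhs_right_lt.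
Unshelve. all: by end_near.
Qed.
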